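(* Let $X,\Sigma,A,T,P,\mathcal G,f_\lambda,c$ be as in the context. Suppose that the linear equation $x'=A(t)x$, $t\in\mathbb R$, has no nonzero bounded solutions, that $$q:=\sup_{t\in\mathbb R}\int_{-\infty}^{\infty}c(s)\|\mathcal G(t,s)\|\,ds<1,$$ and that $\epsilon\colon\mathbb R\to(0,\infty)$ is a continuous map with $$L:=\sup_{t\in\mathbb R}\int_{-\infty}^{\infty}\epsilon(s)\|\mathcal G(t,s)\|\,ds<+\infty.$$ For each $\lambda\in\Sigma$ let $y_\lambda\colon\mathbb R\to X$ be a continuously differentiable map satisfying $$|y_\lambda'(t)-A(t)y_\lambda(t)-f_\lambda(t,y_\lambda(t))|\le\epsilon(t)\quad\text{for all }t\in\mathbb R,$$ and let $x_\lambda\colon\mathbb R\to X$ be the unique solution of $x'=A(t)x+f_\lambda(t,x)$, $t\in\mathbb R$, such that $\sup_{t\in\mathbb R}|x_\lambda(t)-y_\lambda(t)|\le\frac{L}{1-q}$. Take $k\in\mathbb N$ and suppose there exists $C>0$ such that the following conditions hold: (1) for each $t\in\mathbb R$ the map $(\lambda,x)\mapsto f_\lambda(t,x)$ is $C^{k+1}$, and for all $2\le i\le k+1$, $0\le j\le i$ and $t\in\mathbb R$, $$\sup_{\lambda\in\Sigma}\sup_{x\in X}\left\|\frac{\partial^i}{\partial\lambda^{i-j}\partial x^j}f_\lambda(t,x)\right\|\le C\epsilon(t);$$ (2) for each $t\in\mathbb R$ the maps $\lambda\mapsto y_\lambda(t)$ and $\lambda\mapsto y_\lambda'(t)$ are both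 $C^{k+1}$, and $$\left|\frac{\partial^i}{\partial\lambda^i}y_\lambda'(t)-A(t)\frac{\partial^i}{\partial\lambda^i}y_\lambda(t)-\frac{d^i}{d\lambda^i}f_\lambda(t,y_\lambda(t))\right|\le C\epsilon(t)$$ for all $1\le i\le k+1$, all $t\in\mathbb R$ and all $\lambda\in\Sigma$. Furthermore, for every $\lambda_0\in\Sigma$ there exist $M_{\lambda_0}>1$ and a neighborhood $\Sigma_0$ of $\lambda_0$ such that $$\max_{1\le i\le k+1}\sup_{t\in\mathbb R}\left\|\frac{\partial^i}{\partial\lambda^i}y_\lambda(t)\right\|\le M_{\lambda_0}\quad\text{for each }\lambda\in\Sigma_0.$$ Then the map $\lambda\mapsto x_\lambda(t)$ is $C^k$ on $\Sigma$ for each $t\in\mathbb R$.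
   Context: $X=(X,|\cdot|)$ is an arbitrary Banach space; $\mathcal B(X)$ is the space of bounded linear operators on $X$ with operator norm $\|\cdot\|$. $\Sigma$ is an open subset of another Banach space, whose norm is also denoted $|\cdot|$. $A\colon\mathbb R\to\mathcal B(X)$ is continuous and $T(t,s)$, $t,s\in\mathbb R$, is the evolution family of $x'=A(t)x$ (so $x(t)=T(t,s)x(s)$ for every solution $x$). $P\colon\mathbb R\to\mathcal B(X)$ is a continuous map and $$\mathcal G(t,s)=\begin{cases}T(t,s)P(s)& t\ge s,\\ -T(t,s)(\mathrm{Id}-P(s))& t<s.\end{cases}$$ For each $\lambda\in\Sigma$, $f_\lambda\colon\mathbb R\times X\to X$ is continuous, and there is a continuous map $c\colon\mathbb R\to[0,\infty)$ such that $|f_\lambda(t,x)-f_\lambda(t,y)|\le c(t)|x-y|$ for all $t\in\mathbb R$, $\lambda\in\Sigma$, $x,y\in X$. Under the stated hypotheses on $A,P,f_\lambda,c,\epsilon,y_\lambda$ (no nonzero bounded solutions, $q<1$, $L<\infty$, $y_\lambda$ approximate solution), it is known that for each $\lambda\in\Sigma$ the solution $x_\lambda$ described in the claim exists and is unique. The prime denotes the derivative in $t$. The symbols $\frac{\partial^i}{\partial\lambda^{i-j}\partial x^j}$ denote partial Fréchet derivatives, and $\frac{d^i}{d\lambda^i}f_\lambda(t,y_\lambda(t))$ is the $i$-th (total) derivative of $\lambda\mapsto f_\lambda(t,y_\lambda(t))$; norms of derivatives are norms of the corresponding multilinear maps. *)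

(* Defs.v *)
From HB Require Import structures.
From mathcomp Require Import all_boot all_order all_algebra.
From mathcomp Require Import all_classical all_reals all_analysis.

Set Implicit Arguments.
Unset Strict Implicit.
Unset Printing Implicit Defensive.

Import Order.TTheory GRing.Theory Num.Theory.
Import numFieldNormedType.Exports.

Local Open Scope classical_set_scope.
Local Open Scope ring_scope.

Section BoundedLinear.
Context {R : realType} {U V : normedModType R}.

Definition is_blin (f : U -> V) : Prop :=
  linear f /\ exists M : R, forall u, `|f u| <= M * `|u|.

Definition blin_pred : {pred U -> V} := fun f => `[< is_blin f >].

Lemma blin_submod_closed : submod_closed blin_pred.
Proof.
split => [|a f g /asboolP[lf [M fM]] /asboolP[lg [N gN]]]; apply/asboolP.
- split; first by move=> a u v; rewrite scaler0 addr0.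
  by exists 0 => u; rewrite normr0 mul0r.
- split.
    move=> b u v; rewrite !fctE lf lg !scalerDr !scalerA (mulrC a b).
    by rewrite addrACA.
  exists (`|a| * M + N) => u; rewrite mulrDl -mulrA.
  apply: (le_trans (ler_normD _ _)); apply: lerD => //=.
  by rewrite normrZ ler_wpM2l.
Qed.

HB.instance Definition _ :=
  GRing.isSubmodClosed.Build R (U -> V) blin_pred blin_submod_closed.

Record blin := Blin { blin_fun :> U -> V ; blinP : blin_fun \in blin_pred }.

HB.instance Definition _ := [isSub for blin_fun].
HB.instance Definition _ := [Choice of blin by <:].
HB.instance Definition _ := [SubChoice_isSubLmodule of blin by <:].

Lemma blin_is_linear (f : blin) : linear f.
Proof. by have /asboolP[] := blinP f. Qed.

HB.instance Definition _ (f : blin) :=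
  GRing.isLinear.Build R U V _ (blin_fun f) (blin_is_linear f).

Definition opnorm (f : blin) : R := sup [set `|f u| | u in [set u | `|u| <= 1]].

Lemma opnorm_has_sup (f : blin) :
  has_sup [set `|f u| | u in [set u : U | `|u| <= 1]].
Proof.
split; first by exists `|f 0|, 0 => //=; rewrite normr0.
have /asboolP[_ [M fM]] := blinP f.
exists `|M| => _ [u /= u1 <-]; apply: (le_trans (fM u)).
apply: (@le_trans _ _ (`|M| * `|u|)); first by rewrite ler_wpM2r// ler_norm.
by rewrite ler_piMr.
Qed.

Lemma opnorm_ge0 (f : blin) : 0 <= opnorm f.
Proof.
apply: (@le_trans _ _ `|f 0|) => //.
apply: (sup_upper_bound (opnorm_has_sup f)); exists 0 => //=.
by rewrite normr0.
Qed.

Lemma ler_opnorm (f : blin) u : `|f u| <= opnorm f * `|u|.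
Proof.
have [->|u0] := eqVneq u 0; first by rewrite linear0 !normr0 mulr0.
have u0' : 0 < `|u| by rewrite normr_gt0.
rewrite -ler_pdivrMr//.
have -> : `|f u| / `|u| = `|f (`|u|^-1 *: u)|.
  by rewrite linearZ/= normrZ ger0_norm ?invr_ge0// mulrC.
apply: (sup_upper_bound (opnorm_has_sup f)).
exists (`|u|^-1 *: u) => //=.
by rewrite normrZ ger0_norm ?invr_ge0// mulVf// gt_eqF.
Qed.

Lemma opnorm_le (f : blin) M : 0 <= M ->
  (forall u, `|f u| <= M * `|u|) -> opnorm f <= M.
Proof.
move=> M0 fM; apply: ge_sup; first by case: (opnorm_has_sup f).
move=> _ [u /= u1 <-]; apply: (le_trans (fM u)).
by rewrite ler_piMr.
Qed.

Lemma opnormD (f g : blin) : opnorm (f + g) <= opnorm f + opnorm g.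
Proof.
apply: opnorm_le => [|u]; first by rewrite addr_ge0 ?opnorm_ge0.
rewrite mulrDl; apply: (le_trans (ler_normD _ _)).
by apply: lerD; exact: ler_opnorm.
Qed.

Lemma opnormZ_le (a : R) (f : blin) : opnorm (a *: f) <= `|a| * opnorm f.
Proof.
apply: opnorm_le => [|u]; first by rewrite mulr_ge0 ?opnorm_ge0.
have -> : (a *: f) u = a *: f u by [].
by rewrite normrZ -mulrA ler_wpM2l// ler_opnorm.
Qed.

Lemma opnormZ (a : R) (f : blin) : opnorm (a *: f) = `|a| * opnorm f.
Proof.
apply/eqP; rewrite eq_le opnormZ_le/=.
have [->|a0] := eqVneq a 0; first by rewrite normr0 mul0r opnorm_ge0.
have {1}-> : f = a^-1 *: (a *: f) by rewrite scalerA mulVf// scale1r.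
rewrite -ler_pdivlMl ?normr_gt0// -normfV.
exact: opnormZ_le.
Qed.

Lemma opnorm_eq0 (f : blin) : opnorm f = 0 -> f = 0.
Proof.
move=> f0; apply/val_inj/funext => u /=.
apply/eqP; rewrite -normr_le0.
by apply: (le_trans (ler_opnorm f u)); rewrite f0 mul0r.
Qed.

HB.instance Definition _ :=
  Lmodule_isNormed.Build R blin opnormD opnormZ opnorm_eq0.

Lemma ler_blin (f : blin) u : `|f u| <= `|f| * `|u|.
Proof. exact: ler_opnorm. Qed.

Lemma blin_le (f : blin) M : 0 <= M ->
  (forall u, `|f u| <= M * `|u|) -> `|f| <= M.
Proof. exact: opnorm_le. Qed.

End BoundedLinear.
Arguments blin {R} U V.

Section Composition.
Context {R : realType} {U V W : normedModType R}.

Lemma blin_comp_subproof (g : blin V W) (f : blin U V) :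
  (g \o f) \in @blin_pred R U W.
Proof.
apply/asboolP; split; first by move=> a u v; rewrite /= !linearP.
exists (`|g| * `|f|) => u /=; apply: (le_trans (ler_blin _ _)).
by rewrite -mulrA ler_wpM2l// ler_blin.
Qed.

Definition blin_comp (g : blin V W) (f : blin U V) : blin U W :=
  Blin (blin_comp_subproof g f).

Lemma blin_postcomp_subproof (g : blin V W) :
  blin_comp g \in @blin_pred R (blin U V) (blin U W).
Proof.
apply/asboolP; split.
  by move=> a f h; apply/val_inj/funext => u; rewrite /= linearP.
exists `|g| => f; apply: blin_le => [|u]; first by rewrite mulr_ge0.
apply: (le_trans (ler_blin g (f u))).
by rewrite -mulrA ler_wpM2l// ler_blin.
Qed.

Definition blin_postcomp (g : blin V W) : blin (blin U V) (blin U W) :=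
  Blin (blin_postcomp_subproof g).

End Composition.

Lemma blin_id_subproof {R : realType} (U : normedModType R) :
  (id : U -> U) \in @blin_pred R U U.
Proof. by apply/asboolP; split=> //; exists 1 => u; rewrite mul1r. Qed.

Definition blin_id {R : realType} (U : normedModType R) : blin U U :=
  Blin (blin_id_subproof U).

Section HigherDerivatives.
Context {R : realType}.

(* If f is differentiable at x, then 'd f x is continuous, hence bounded, so
   that fderiv f x is 'd f x as an element of B(U, V); otherwise fderiv f x is
   an unspecified operator. *)
Definition fderiv {U V : normedModType R} (f : U -> V) (x : U) : blin U V :=
  insubd (0 : blin U V) ('d f x : U -> V).

Lemma fderivE {U V : normedModType R} (f : U -> V) (x : U) :
  differentiable f x -> fderiv f x = 'd f x :> (U -> V).
Proof.
move=> dfx; rewrite [LHS]val_insubd; case: ifPn => // /negP; case.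
apply/asboolP; split; first exact: linearP.
have /linear_boundedP[M [Mr fM]] :=
  @continuous_linear_bounded _ _ _ 0 ('d f x) (@diff_continuous _ _ _ _ _ dfx 0).
by exists (M + 1) => u; apply: fM; rewrite ltrDl.
Qed.

(* Continuous i-linear maps U x ... x U -> V in curried form: the iterated
   operator norm B(U, B(U, ... B(U, V))) is the usual norm
   sup { |M u_1 ... u_i| : |u_j| <= 1 } of multilinear maps. *)
Fixpoint mlin (i : nat) (U V : normedModType R) : normedModType R :=
  if i is i'.+1 then blin U (mlin i' U V) else V.

Fixpoint fderivn {U V : normedModType R} (i : nat) (f : U -> V) :
    U -> mlin i U V :=
  if i is i'.+1 then fderiv (fderivn i' f) else f.

(* Meant for open S: differentiability and continuity at the points of S are
   taken in the whole of U, so they only depend on f near these points. *)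
Definition Ck {U V : normedModType R} (k : nat) (S : set U) (f : U -> V) :=
  (forall i x, (i < k)%N -> S x -> differentiable (fderivn i f) x) /\
  (forall x, S x -> {for x, continuous (fderivn k f)}).

(* M |-> B \o M on i-linear maps. *)
Fixpoint mlin_comp {U V W : normedModType R} (i : nat) (B : blin V W) :
    blin (mlin i U V) (mlin i U W) :=
  if i is i'.+1 then blin_postcomp (mlin_comp i' B) else B.

(* The partial derivative of order m + j of g at (l, x): j times in x, then m
   times in l. *)
Definition partialn {E X Y : normedModType R} (m j : nat) (g : E -> X -> Y)
    (l : E) (x : X) : mlin m E (mlin j X Y) :=
  fderivn m (fun l' => fderivn j (g l') x) l.

End HigherDerivatives.

Section Equation.
Context {R : realType} {X : normedModType R}.

Definition is_solution (F : R -> X -> X) (x : R -> X) :=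
  forall t : R, is_derive t 1 x (F t (x t)).

(* t |-> T(t, s) v is the unique solution on R of x' = A(t) x with x(s) = v;
   in particular x(t) = T(t, s) x(s) for every solution x. *)
Definition evolution_family (A : R -> blin X X) (T : R -> R -> blin X X) :=
  forall (s : R) (v : X) (x : R -> X),
    is_solution A x /\ x s = v <-> forall t, x t = T t s v.

Definition green (T : R -> R -> blin X X) (P : R -> blin X X) (t s : R) :
    blin X X :=
  if s <= t then blin_comp (T t s) (P s)
  else - blin_comp (T t s) (blin_id X - P s).

Definition green_sup (T : R -> R -> blin X X) (P : R -> blin X X)
    (w : R -> R) : \bar R :=
  ereal_sup
    [set (\int[lebesgue_measure]_s (w s * `|green T P t s|)%:E)%E
    | t in [set: R]].

End Equation.

(* Main.v *)
(* The difference z = x - y is the bounded solution of z' = A(t) z + F(t, l, z),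
   where F(t, l, u) = f_l(t, y_l + u) - y_l' + A(t) y_l is c(t)-Lipschitz in u
   and has derivatives in (l, u) bounded by multiples of w = c + eps. Solving
   u' = A(t) u + g for a bounded u is a linear operation in g that turns
   |g| <= a c + b w into |u| <= a q + b (q + L). As q < 1, comparing the
   equations of two parameters gives that z is Lipschitz in l, and a second
   order expansion identifies its derivative as the solution of the variational
   equation, v' = A(t) v + d_l F + d_u F v. This is again of that kind, affine in
   v, with values in B(E, X) and one derivative less: induct on the order.
   Bounds on the mixed partial derivatives of f bound its total derivatives by
   Schwarz's theorem.

   For k = 0 the hypotheses do not bound the first derivatives of f and y'
   uniformly in t, and continuity comes from dominated convergence in the
   Green integrals, iterated so as to gain a factor q each time. *)

(* No first derivative of [f] in the parameter is bounded by the hypotheses, so F is not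
   differentiated summand by summand: it is split as the increment f(y + u) - f(y) minus the
   residual y' - A y - f(y). The parameter derivative of the increment is controlled by second
   derivatives of [f] times |u|, that of the residual by condition (2). Hence u is kept in a ball,
   of radius rho + 1 with rho = L / (1 - q), and the parameter in a ball where the derivatives of y
   are uniformly bounded; convexity serves the mean value inequality.

   The order drops from k + 1 to k because bounds of order k + 1 become Lipschitz bounds of order k,
   which pass to the solution and give continuity.

   The obstacle to the induction: [f] is continuous in (t, x), but its derivatives are taken at
   fixed t, so the coefficients of the variational equation need not be norm-continuous curves of
   operators. They are continuous after evaluation at a vector, as locally uniform limits of
   difference quotients. Operator-valued equations are therefore solved vector by vector, through
   test functionals. *)
Require Import Defs.
From HB Require Import structures.
From mathcomp Require Import all_boot all_order all_algebra.
From mathcomp Require Import all_classical all_reals all_analysis.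
From mathcomp Require Import measurable_realfun ring lra.
Import Order.TTheory GRing.Theory Num.Theory.
Import numFieldNormedType.Exports.
Local Open Scope classical_set_scope.
Local Open Scope ring_scope.

Set Implicit Arguments.
Unset Strict Implicit.
Unset Printing Implicit Defensive.

(** * Identities in additive groups *)

Section ZmodReflection.
Context (V : zmodType).

Inductive zexpr := ZVar of nat | ZZero | ZAdd of zexpr & zexpr | ZOpp of zexpr.

Fixpoint zeval (s : seq V) (e : zexpr) : V :=
  match e with
  | ZVar n => nth 0 s n
  | ZZero => 0
  | ZAdd e1 e2 => zeval s e1 + zeval s e2
  | ZOpp e1 => - zeval s e1
  end.

Fixpoint zcoef (e : zexpr) (i : nat) : int :=
  match e with
  | ZVar n => ((n == i) : nat)%:Z
  | ZZero => 0
  | ZAdd e1 e2 => zcoef e1 i + zcoef e2 i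
  | ZOpp e1 => - zcoef e1 i
  end.

Lemma zevalE s e : zeval s e = \sum_(i < size s) nth 0 s i *~ zcoef e i.
Proof.
elim: e => [n||e1 IH1 e2 IH2|e IH] /=.
- have [sn|ns] := leqP (size s) n.
    rewrite nth_default// big1// => i _; rewrite gtn_eqF//.
    exact: leq_trans (ltn_ord i) sn.
  rewrite (bigD1 (Ordinal ns))//= eqxx mulr1z big1 ?addr0// => i ni.
  rewrite (_ : (n == i) = false)//; apply: contra_neqF ni => /eqP ni.
  exact/val_inj.
- by rewrite big1// => i _; rewrite mulr0z.
- by rewrite IH1 IH2 -big_split/=; apply: eq_bigr => i _; rewrite mulrzDr.
- by rewrite IH -sumrN; apply: eq_bigr => i _; rewrite mulrNz.
Qed.

(** Each expression is the integer combination of its atoms given by [zcoef], so comparing finitely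
    many integers by computation proves the identity. *)
Lemma zmod_reflect s e1 e2 :
  all (fun i => zcoef e1 i == zcoef e2 i) (iota 0 (size s)) ->
  zeval s e1 = zeval s e2.
Proof.
move=> /allP e12; rewrite !zevalE; apply: eq_bigr => i _.
by rewrite (eqP (e12 i _))// mem_iota/= add0n ltn_ord.
Qed.

End ZmodReflection.

Ltac zmod_mem x l :=
  lazymatch l with
  | nil => constr:(false)
  | x :: _ => constr:(true)
  | _ :: ?l' => zmod_mem x l'
  end.

Ltac zmod_atoms t l :=
  lazymatch t with
  | (?a + ?b)%R => let l1 := zmod_atoms a l in zmod_atoms b l1
  | (- ?a)%R => zmod_atoms a l
  | 0%R => l
  | _ => let b := zmod_mem t l in
         lazymatch b with true => l | false => constr:(t :: l) end
  end.

Ltac zmod_index x l :=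
  lazymatch l with
  | x :: _ => constr:(0%N)
  | _ :: ?l' => let n := zmod_index x l' in constr:(S n)
  end.

Ltac zmod_reify t l :=
  lazymatch t with
  | (?a + ?b)%R =>
      let u := zmod_reify a l in let v := zmod_reify b l in constr:(ZAdd u v)
  | (- ?a)%R => let u := zmod_reify a l in constr:(ZOpp u)
  | 0%R => constr:(ZZero)
  | _ => let n := zmod_index t l in constr:(ZVar n)
  end.

(* [ring] needs a multiplication, hence does not apply in normed modules. *)
Ltac zmodl :=
  lazymatch goal with
  | |- @eq ?T ?t1 ?t2 =>
      let l := zmod_atoms t1 (@nil T) in
      let l := zmod_atoms t2 l in
      let e1 := zmod_reify t1 l in
      let e2 := zmod_reify t2 l in
      exact: (@zmod_reflect (T : zmodType) l e1 e2 isT)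
  end.

(** * Bounded linear operators *)

Section BlinTools.
Context {R : realType}.

Lemma mk_blin_subproof {U V : normedModType R} (f : U -> V) (M : R) :
  linear f -> (forall u, `|f u| <= M * `|u|) -> f \in @blin_pred R U V.
Proof. by move=> lf fM; apply/asboolP; split=> //; exists M. Qed.

Definition mk_blin {U V : normedModType R} (f : U -> V) (lf : linear f)
    (M : R) (fM : forall u, `|f u| <= M * `|u|) : blin U V :=
  Blin (mk_blin_subproof lf fM).

Lemma blin_eqP {U V : normedModType R} (f g : blin U V) :
  (forall u, f u = g u) <-> f = g.
Proof. by split=> [fg|->//]; apply/val_inj/funext. Qed.

Lemma blinD {U V : normedModType R} (f g : blin U V) u : (f + g) u = f u + g u.
Proof. by []. Qed.

Lemma blinN {U V : normedModType R} (f : blin U V) u : (- f) u = - f u.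
Proof. by []. Qed.

Lemma blinB {U V : normedModType R} (f g : blin U V) u : (f - g) u = f u - g u.
Proof. by []. Qed.

Lemma blin0 {U V : normedModType R} u : (0 : blin U V) u = 0.
Proof. by []. Qed.

Lemma blin_compE {U V W : normedModType R} (g : blin V W) (f : blin U V) u :
  blin_comp g f u = g (f u).
Proof. by []. Qed.

Lemma blin_comp_le {U V W : normedModType R} (g : blin V W) (f : blin U V) :
  `|blin_comp g f| <= `|g| * `|f|.
Proof.
apply: blin_le => [|u]; first exact: mulr_ge0.
by rewrite blin_compE (le_trans (ler_blin _ _))// -mulrA ler_wpM2l// ler_blin.
Qed.

Lemma blin_postcomp_le {U V W : normedModType R} (g : blin V W) :
  `|blin_postcomp g : blin (blin U V) (blin U W)| <= `|g|.
Proof. by apply: blin_le => // f; exact: blin_comp_le. Qed.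

Lemma ler_blin2 {U V : normedModType R} (f : blin U V) (a : R) u :
  `|f| <= a -> `|f u| <= a * `|u|.
Proof. by move=> fa; rewrite (le_trans (ler_blin _ _))// ler_wpM2r. Qed.

Lemma blin_postcompL_linear {U V W : normedModType R} :
  linear (@blin_postcomp R U V W).
Proof. by move=> a f g; apply/blin_eqP => h; apply/blin_eqP => u. Qed.

(** Composition as a bounded bilinear map: the rules for bilinear maps then also cover the
    composites of derivatives produced by the chain rule. *)
Definition blin_compL (U V W : normedModType R) :
    blin (blin V W) (blin (blin U V) (blin U W)) :=
  @mk_blin (blin V W) (blin (blin U V) (blin U W)) (@blin_postcomp R U V W)
    blin_postcompL_linear 1
    (fun g => eq_ind_r (fun z => _ <= z) (blin_postcomp_le g) (mul1r _)).

Lemma blin_flip_subproof {U V W : normedModType R} (B : blin U (blin V W)) (v : V) :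
  linear (fun u => B u v) /\ forall u, `|B u v| <= (`|B| * `|v|) * `|u|.
Proof.
split=> [a u1 u2|u]; first by rewrite linearP.
rewrite (le_trans (ler_blin _ _))// mulrAC ler_wpM2r//; exact: ler_blin.
Qed.

Definition blin_flip1 {U V W : normedModType R} (B : blin U (blin V W)) (v : V) :
    blin U W :=
  mk_blin (proj1 (blin_flip_subproof B v)) (proj2 (blin_flip_subproof B v)).

Lemma blin_flip1_linear {U V W : normedModType R} (B : blin U (blin V W)) :
  linear (blin_flip1 B).
Proof. by move=> a v1 v2; apply/blin_eqP => u; rewrite /= linearP. Qed.

Lemma blin_flip1_le {U V W : normedModType R} (B : blin U (blin V W)) v :
  `|blin_flip1 B v| <= `|B| * `|v|.
Proof.
apply: blin_le => [|u]; first exact: mulr_ge0.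
exact: (proj2 (blin_flip_subproof B v)).
Qed.

(** Swaps the arguments of a bilinear map. In the derivative of [B (f y) (g y)] the increment enters
    one term through the first slot, with [g x] frozen in the second. *)
Definition blin_flip {U V W : normedModType R} (B : blin U (blin V W)) :
    blin V (blin U W) :=
  mk_blin (blin_flip1_linear B) (blin_flip1_le B).

Lemma blin_flip_le {U V W : normedModType R} (B : blin U (blin V W)) :
  `|blin_flip B| <= 1 * `|B|.
Proof. by rewrite mul1r; apply: blin_le => // v; exact: blin_flip1_le. Qed.

Lemma blin_flip_linear {U V W : normedModType R} :
  linear (@blin_flip U V W).
Proof. by move=> a f g; apply/blin_eqP => v; apply/blin_eqP => u. Qed.

Definition blin_flipL (U V W : normedModType R) :
    blin (blin U (blin V W)) (blin V (blin U W)) :=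
  mk_blin (@blin_flip_linear U V W) blin_flip_le.

Definition blin_precomp {U V W : normedModType R} (f : blin U V) :
    blin (blin V W) (blin U W) :=
  blin_flip (blin_compL U V W) f.

Definition blin_ev (U V : normedModType R) (u : U) : blin (blin U V) V :=
  blin_flip (blin_id (blin U V)) u.

Lemma blin_evE (U V : normedModType R) (u : U) (f : blin U V) :
  blin_ev V u f = f u.
Proof. by []. Qed.

Lemma blin_ev_le (U V : normedModType R) (u : U) : `|blin_ev V u| <= `|u|.
Proof. by apply: blin_le => // f; rewrite blin_evE mulrC ler_blin. Qed.

Lemma prod_normE1 {U V : normedModType R} (p : U * V) : `|p| = Num.max `|p.1| `|p.2|.
Proof. by []. Qed.

Lemma prod_norm_le {U V : normedModType R} (p : U * V) (a : R) :
  (`|p| <= a) = (`|p.1| <= a) && (`|p.2| <= a).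
Proof. by rewrite prod_normE1 ge_max. Qed.

Lemma prod_norm_fst {U V : normedModType R} (p : U * V) : `|p.1| <= `|p|.
Proof. by rewrite prod_normE1 le_max lexx. Qed.

Lemma prod_norm_snd {U V : normedModType R} (p : U * V) : `|p.2| <= `|p|.
Proof. by rewrite prod_normE1 le_max lexx orbT. Qed.

Definition blin_fst (U V : normedModType R) : blin (U * V)%type U :=
  @mk_blin (U * V)%type U fst (fun _ _ _ => erefl) 1
    (fun p => eq_ind_r (fun z => _ <= z) (prod_norm_fst p) (mul1r _)).

Definition blin_snd (U V : normedModType R) : blin (U * V)%type V :=
  @mk_blin (U * V)%type V snd (fun _ _ _ => erefl) 1
    (fun p => eq_ind_r (fun z => _ <= z) (prod_norm_snd p) (mul1r _)).

Lemma blin_inl_subproof (U V : normedModType R) :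
  linear (fun u : U => (u, 0 : V)) /\ forall u : U, `|(u, 0 : V)| <= 1 * `|u|.
Proof.
split=> [a u v|u]; last by rewrite mul1r prod_norm_le lexx normr0/=.
by apply: injective_projections; rewrite /= ?scaler0 ?addr0.
Qed.

Definition blin_inl (U V : normedModType R) : blin U (U * V)%type :=
  mk_blin (proj1 (blin_inl_subproof U V)) (proj2 (blin_inl_subproof U V)).

Lemma blin_inr_subproof (U V : normedModType R) :
  linear (fun v : V => (0 : U, v)) /\ forall v : V, `|(0 : U, v)| <= 1 * `|v|.
Proof.
split=> [a u v|u]; last by rewrite mul1r prod_norm_le lexx normr0 andbT.
by apply: injective_projections; rewrite /= ?scaler0 ?addr0.
Qed.

Definition blin_inr (U V : normedModType R) : blin V (U * V)%type :=
  mk_blin (proj1 (blin_inr_subproof U V)) (proj2 (blin_inr_subproof U V)).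

End BlinTools.

(** * Completeness of B(U, V) *)

Section BlinComplete.
Context {R : realType} {U : normedModType R} {V : completeNormedModType R}.

(** Pointwise limits exist by completeness of V. The induction on the order of differentiability
    needs this, since it replaces the value space Y by B(E, Y). *)
Lemma blin_complete (F : set_system (blin U V)) :
  ProperFilter F -> cauchy F -> cvg F.
Proof.
move=> FF Fc.
have Fc' : forall e : R, 0 < e -> exists2 f0 : blin U V, True &
    F [set g | `|f0 - g| < e].
  move=> e e0; have [f0 Ff0] := proj1 (cauchyP F) Fc e e0.
  by exists f0 => //; move: Ff0; rewrite -ball_normE.
have Fu (u : U) : cvg ((fun f : blin U V => f u) @ F).
  apply/cauchy_cvgP/cauchy_exP => e e0.
  have u1 : 0 < `|u| + 1 by rewrite ltr_wpDl.
  have [f0 _ Ff0] := Fc' (e / (`|u| + 1)) (divr_gt0 e0 u1).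
  exists (f0 u); rewrite -ball_normE.
  suff : F [set g | `|f0 u - g u| < e] by [].
  apply: filterS Ff0 => g /= fg.
  rewrite -blinB (le_lt_trans (ler_blin _ _))//.
  apply: (@le_lt_trans _ _ (`|f0 - g| * (`|u| + 1))).
    by rewrite ler_wpM2l// lerDl.
  by rewrite -ltr_pdivlMr.
pose l u := lim ((fun f : blin U V => f u) @ F).
have lP u : (fun f : blin U V => f u) @ F --> l u by exact: Fu.
have l_lin : linear l.
  move=> a u v; apply: (@cvg_lim V) => //.
  under eq_fun do rewrite linearP.
  by apply: cvgD; [apply: cvgZr|]; exact: lP.
(* For each u some [g] is both close to [f0] in norm and close to the limit at u. This [g] depends
   on u, but the resulting bound on [f0 u - l u] does not. *)
have key e : 0 < e -> exists2 f0 : blin U V, F [set g | `|f0 - g| < e] &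
    forall u, `|f0 u - l u| <= e * `|u|.
  move=> e0; have [f0 _ Ff0] := Fc' e e0; exists f0 => // u.
  have : (fun f : blin U V => `|f0 u - f u|) @ F --> `|f0 u - l u|.
    by apply: cvg_norm; apply: cvgB; [exact: cvg_cst|exact: lP].
  move=> /cvgrPdist_le h; apply/ler_addgt0Pr => d d0.
  have [g [/= fg hd]] := @filter_ex _ F FF _ (filterI Ff0 (h d d0)).
  have : `|f0 u - g u| <= e * `|u|.
    by rewrite -blinB (le_trans (ler_blin _ _))// ler_wpM2r// ltW.
  move=> h1; move: hd; rewrite ler_norml => /andP[_ h2]; lra.
have [f1 _ f1l] := key 1 ltr01.
have l_b u : `|l u| <= (`|f1| + 1) * `|u|.
  rewrite -[l u](subKr (f1 u)) (le_trans (ler_normB _ _))// mulrDl.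
  by rewrite lerD ?ler_blin.
apply/cvg_ex; exists (mk_blin l_lin l_b).
apply/cvgrPdist_le => e e0.
have e20 : 0 < e / 2 by rewrite divr_gt0.
have [f0 Ff0 f0l] := key _ e20.
apply: filterS Ff0 => g /= fg.
apply: blin_le => [|u]; first exact: ltW.
rewrite blinB /= -[l u](subKr (f0 u)) addrAC.
rewrite (le_trans (ler_normB _ _))// [e]splitr mulrDl lerD//.
by rewrite -blinB (le_trans (ler_blin _ _))// ler_wpM2r// ltW.
Qed.

End BlinComplete.

HB.instance Definition _ (R : realType) (U : normedModType R)
    (V : completeNormedModType R) :=
  Uniform_isComplete.Build (blin U V) (@blin_complete R U V).

(** * Derivatives *)

Section Derivatives.
Context {R : realType}.

(** Carries the derivative as an element of B(U, V); [hasdP] identifies it with differentiability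
    and [fderiv]. The variant [hasdc] for curves keeps a vector as derivative and matches
    [is_derive]. *)
Definition hasd {U V : normedModType R} (f : U -> V) (x : U) (D : blin U V) :=
  forall e : R, 0 < e -> exists2 d : R, 0 < d &
    forall h, `|h| < d -> `|f (x + h) - f x - D h| <= e * `|h|.

Definition hasdc {V : normedModType R} (u : R -> V) (t : R) (v : V) :=
  forall e : R, 0 < e -> exists2 d : R, 0 < d &
    forall h : R, `|h| < d -> `|u (t + h) - u t - h *: v| <= e * `|h|.

Lemma blin_continuous {U V : normedModType R} (f : blin U V) : continuous f.
Proof.
move=> x; apply/cvgrPdist_le => e e0.
have M1 : 0 < `|f| + 1 by rewrite ltr_wpDl.
apply/nbhs_normP; exists (e / (`|f| + 1)) => /=; first exact: divr_gt0.
move=> z /= zx; rewrite -linearB (le_trans (ler_blin _ _))//.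
apply: (@le_trans _ _ ((`|f| + 1) * `|x - z|)); first by rewrite ler_wpM2r// lerDl.
by rewrite -ler_pdivlMl// mulrC ltW.
Qed.

Lemma hasdP {U V : normedModType R} (f : U -> V) (x : U) (D : blin U V) :
  hasd f x D <-> differentiable f x /\ fderiv f x = D.
Proof.
split=> [fD|[df <-]].
- have fo : f \o shift x = cst (f x) + (D : U -> V) +o_ 0 id.
    apply/eqaddoP => e e0; have [d d0 fd] := fD e e0.
    apply/nbhs_norm0P; exists d => //= h hd.
    by have := fd h hd; rewrite [x + h]addrC -addrA -opprD.
  have dE := @diff_unique _ _ _ f (D : {linear U -> V}) x (@blin_continuous _ _ D) fo.
  have df : differentiable f x.
    by apply/diff_locallyP; split; rewrite dE//; exact: blin_continuous.
  by split=> //; apply/blin_eqP => u; rewrite fderivE// dE.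
- move=> e e0; have /diff_locallyP[_ /eqaddoP/(_ e e0)] := df.
  move=> /nbhs_norm0P[d /= d0 fd]; exists d => // h hd.
  have := fd h hd; rewrite /= -fderivE//.
  by rewrite [x + h]addrC -addrA -opprD.
Qed.

Lemma hasd_diff {U V : normedModType R} (f : U -> V) x D :
  hasd f x D -> differentiable f x.
Proof. by move=> /hasdP[]. Qed.

Lemma hasd_fderiv {U V : normedModType R} (f : U -> V) x D :
  hasd f x D -> fderiv f x = D.
Proof. by move=> /hasdP[]. Qed.

Lemma diff_hasd {U V : normedModType R} (f : U -> V) x :
  differentiable f x -> hasd f x (fderiv f x).
Proof. by move=> df; apply/hasdP. Qed.

Lemma hasdcP {V : normedModType R} (u : R -> V) (t : R) (v : V) :
  hasdc u t v <-> is_derive t 1 u v.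
Proof.
split=> [ut|ut].
- have /cvg_lim ul : (fun h => h^-1 *: ((u \o shift t) (h *: (1 : R)) - u t)) @ 0^' --> v.
    apply/cvgrPdist_le => e e0; have [d d0 ud] := ut e e0.
    rewrite near_withinE; apply/(@nbhs_norm0P _ R^o); exists d => //= h hd h0.
    have := ud h hd; rewrite [h%:A]mulr1 [h + t]addrC => {}ud.
    rewrite -[v in v - _]scale1r -(mulVf h0) -scalerA -scalerBr normrZ normfV.
    by rewrite distrC ler_pdivrMl ?normr_gt0// mulrC.
  split; last exact: ul.
  apply/cvg_ex; exists v.
  apply/cvgrPdist_le => e e0; have [d d0 ud] := ut e e0.
  rewrite near_withinE; apply/(@nbhs_norm0P _ R^o); exists d => //= h hd h0.
  have := ud h hd; rewrite [h%:A]mulr1 [h + t]addrC => {}ud.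
  rewrite -[v in v - _]scale1r -(mulVf h0) -scalerA -scalerBr normrZ normfV.
  by rewrite distrC ler_pdivrMl ?normr_gt0// mulrC.
- move=> e e0; have := @ex_derive _ _ _ _ _ _ _ ut => /derivable_nbhsP/eqaddoP/(_ e e0).
  rewrite (@derive_val _ _ _ _ _ _ _ ut) => /nbhs_norm0P[d /= d0 ud].
  exists d => // h hd; move: (ud h hd).
  rewrite -[X in `|X| <= _]/(u (h * 1 + t) - (u t + h *: v)) mulr1 => {}ud.
  by rewrite [t + h]addrC -addrA -opprD.
Qed.

Lemma hasd_ext {U V : normedModType R} (f g : U -> V) x D :
  (\forall y \near x, f y = g y) -> hasd f x D -> hasd g x D.
Proof.
move=> fg0; have fgx := nbhs_singleton fg0.
move: fg0 => /nbhs_normP[r /= r0 fg] fD e e0; have [d d0 fd] := fD e e0.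
exists (Num.min d r); first by rewrite lt_min d0.
move=> h; rewrite lt_min => /andP[hd hr].
have fgh : f (x + h) = g (x + h) by apply: fg; rewrite /= opprD addNKr normrN.
by rewrite -fgh -fgx fd.
Qed.

Lemma hasd_lip {U V : normedModType R} (f : U -> V) x D :
  hasd f x D -> exists2 d : R, 0 < d &
    forall h, `|h| < d -> `|f (x + h) - f x| <= (`|D| + 1) * `|h|.
Proof.
move=> /(_ 1 ltr01)[d d0 fd]; exists d => // h hd.
rewrite -[X in `|X|](subrK (D h)) (le_trans (ler_normD _ _))//.
by rewrite addrC mulrDl lerD ?ler_blin ?fd.
Qed.

Lemma hasd_cvg {U V : normedModType R} (f : U -> V) x D :
  hasd f x D -> {for x, continuous f}.
Proof. by move=> /hasd_diff/differentiable_continuous. Qed.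

Lemma hasd_cst {U V : normedModType R} (v : V) (x : U) : hasd (fun=> v) x 0.
Proof.
by move=> e e0; exists 1 => // h _; rewrite blin0 !subrr normr0 mulr_ge0// ltW.
Qed.

Lemma hasd_blin {U V : normedModType R} (B : blin U V) (x : U) : hasd B x B.
Proof.
move=> e e0; exists 1 => // h _.
have -> : B (x + h) - B x - B h = 0 by rewrite linearD /=; zmodl.
by rewrite normr0 mulr_ge0// ltW.
Qed.

Lemma hasdD {U V : normedModType R} (f g : U -> V) x Df Dg :
  hasd f x Df -> hasd g x Dg -> hasd (fun y => f y + g y) x (Df + Dg).
Proof.
move=> fD gD e e0; have e2 : 0 < e / 2 by rewrite divr_gt0.
have [d d0 fd] := fD _ e2; have [r r0 gr] := gD _ e2.
exists (Num.min d r); first by rewrite lt_min d0.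
move=> h; rewrite lt_min => /andP[hd hr].
rewrite blinD.
have -> : f (x + h) + g (x + h) - (f x + g x) - (Df h + Dg h) =
  (f (x + h) - f x - Df h) + (g (x + h) - g x - Dg h) by zmodl.
by rewrite (le_trans (ler_normD _ _))// [e]splitr mulrDl lerD ?fd ?gr.
Qed.

Lemma hasd_comp {U V W : normedModType R} (g : V -> W) (f : U -> V) x Dg Df :
  hasd g (f x) Dg -> hasd f x Df -> hasd (g \o f) x (blin_comp Dg Df).
Proof.
move=> gD fD e e0.
have [r r0 fr] := hasd_lip fD.
set K := `|Df| + 1 in fr; have K0 : 0 < K by rewrite ltr_wpDl.
set L := `|Dg| + 1; have L0 : 0 < L by rewrite ltr_wpDl.
have e1 : 0 < e / 2 / K by rewrite !divr_gt0.
have e2 : 0 < e / 2 / L by rewrite !divr_gt0.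
have [d d0 gd] := gD _ e1; have [s s0 fs] := fD _ e2.
exists (Num.min (Num.min s r) (d / K)); first by rewrite !lt_min r0 s0 divr_gt0.
move=> h; rewrite !lt_min => /andP[/andP[hs hr]]; rewrite ltr_pdivlMr// => hd.
have fh := fr h hr.
have /gd : `|f (x + h) - f x| < d by rewrite (le_lt_trans fh)// mulrC.
rewrite [f x + _]addrC subrK /= => gh.
have -> : g (f (x + h)) - g (f x) - Dg (Df h) =
  (g (f (x + h)) - g (f x) - Dg (f (x + h) - f x)) +
   Dg (f (x + h) - f x - Df h).
  by rewrite [in RHS](linearB _ _ (Df h)) /= addrA subrK.
rewrite (le_trans (ler_normD _ _))// [e]splitr mulrDl lerD//.
  rewrite (le_trans gh)//.
  by have := ler_wpM2l (ltW e1) fh; rewrite mulrA divfK ?gt_eqF.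
rewrite (le_trans (ler_blin _ _))// (le_trans (ler_wpM2l _ (fs h hs)))//.
have DL : `|Dg| <= L by rewrite lerDl.
have := ler_wpM2r (mulr_ge0 (ltW e2) (normr_ge0 h)) DL.
by rewrite [leRHS]mulrA [L * _]mulrC divfK ?gt_eqF.
Qed.

Lemma hasd_postcomp {U V W : normedModType R} (B : blin V W) (f : U -> V) x Df :
  hasd f x Df -> hasd (fun y => B (f y)) x (blin_comp B Df).
Proof. by move=> fD; apply: (hasd_comp _ fD); exact: hasd_blin. Qed.

Lemma hasdN {U V : normedModType R} (f : U -> V) x Df :
  hasd f x Df -> hasd (fun y => - f y) x (- Df).
Proof.
move=> fD e e0; have [d d0 fd] := fD _ e0; exists d => // h hd.
by rewrite blinN -!opprD normrN fd.
Qed.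

Lemma hasdB {U V : normedModType R} (f g : U -> V) x Df Dg :
  hasd f x Df -> hasd g x Dg -> hasd (fun y => f y - g y) x (Df - Dg).
Proof. by move=> fD gD; apply: hasdD => //; exact: hasdN. Qed.

Lemma hasd_bilin {U V1 V2 W : normedModType R} (B : blin V1 (blin V2 W))
    (f : U -> V1) (g : U -> V2) x Df Dg :
  hasd f x Df -> hasd g x Dg ->
  hasd (fun y => B (f y) (g y)) x
    (blin_flip (blin_comp B Df) (g x) + blin_comp (B (f x)) Dg).
Proof.
move=> fD gD e e0.
have [r r0 fr] := hasd_lip fD.
set K := `|Df| + 1 in fr; have K0 : 0 < K by rewrite ltr_wpDl.
have [r' r'0 gr] := hasd_lip gD.
set L := `|Dg| + 1 in gr; have L0 : 0 < L by rewrite ltr_wpDl.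
set b := `|B| + 1; have b0 : 0 < b by rewrite ltr_wpDl.
set G := `|g x| + 1; have G0 : 0 < G by rewrite ltr_wpDl.
set F := `|f x| + 1; have F0 : 0 < F by rewrite ltr_wpDl.
have e3 : 0 < e / 3 by rewrite divr_gt0.
have [d d0 fd] := fD _ (divr_gt0 e3 (mulr_gt0 b0 G0)).
have [d' d'0 gd] := gD _ (divr_gt0 e3 (mulr_gt0 b0 F0)).
(* Below this radius the product of the two increments, at most b K L |h|^2, is at most e/3 |h|. *)
have s0 : 0 < e / 3 / (b * K * L) by rewrite divr_gt0// !mulr_gt0.
exists (Num.min (Num.min (Num.min d d') (Num.min r r')) (e / 3 / (b * K * L))).
  by rewrite !lt_min d0 d'0 r0 r'0 s0.
move=> h; rewrite !lt_min => /andP[/andP[/andP[hd hd'] /andP[hr hr']] hs].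
have Bb u v : `|B u v| <= b * `|u| * `|v|.
  rewrite (le_trans (ler_blin _ _))// ler_wpM2r//.
  by apply: ler_blin2; rewrite lerDl.
have -> : B (f (x + h)) (g (x + h)) - B (f x) (g x) -
   (blin_flip (blin_comp B Df) (g x) + blin_comp (B (f x)) Dg) h =
   (B (f (x + h) - f x - Df h) (g x) + B (f x) (g (x + h) - g x - Dg h)) +
   B (f (x + h) - f x) (g (x + h) - g x).
  have BB1 u1 u2 v : B (u1 - u2) v = B u1 v - B u2 v by rewrite linearB.
  have BB2 u v1 v2 : B u (v1 - v2) = B u v1 - B u v2 by rewrite linearB.
  by rewrite blinD /= !(BB1, BB2); zmodl.
have h0 := normr_ge0 h.
rewrite (le_trans (ler_normD _ _))//.
have -> : e * `|h| = e / 3 * `|h| + e / 3 * `|h| + e / 3 * `|h| by field.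
apply: lerD; first (apply: (le_trans (ler_normD _ _)); apply: lerD).
- rewrite (le_trans (Bb _ _))//.
  have G1 : `|g x| <= G by rewrite lerDl.
  rewrite (le_trans (ler_wpM2l _ G1)) ?mulr_ge0 ?(ltW b0)//.
  have := ler_wpM2l (ltW (mulr_gt0 b0 G0)) (fd h hd).
  have -> : b * G * (e / 3 / (b * G) * `|h|) = e / 3 * `|h|.
    by field; rewrite !gt_eqF.
  by rewrite mulrAC.
- rewrite (le_trans (Bb _ _))//.
  have F1 : `|f x| <= F by rewrite lerDl.
  have := ler_wpM2l (ltW (mulr_gt0 b0 F0)) (gd h hd').
  have -> : b * F * (e / 3 / (b * F) * `|h|) = e / 3 * `|h|.
    by field; rewrite !gt_eqF.
  by apply: le_trans; rewrite ler_wpM2r// ler_wpM2l// ltW.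
- rewrite (le_trans (Bb _ _))//.
  have p1 := fr h hr; have p2 := gr h hr'.
  have p3 : b * `|f (x + h) - f x| * `|g (x + h) - g x| <=
      b * (K * `|h|) * (L * `|h|).
    apply: ler_pM => //; first by rewrite mulr_ge0// ltW.
    by rewrite ler_wpM2l// ltW.
  rewrite (le_trans p3)// mulrA ler_wpM2r//.
  move: hs; rewrite ltr_pdivlMr ?mulr_gt0// => /ltW; apply: le_trans.
  by rewrite le_eqVlt; apply/orP; left; apply/eqP; ring.
Qed.

End Derivatives.

(** * Mean value inequalities *)

Section MeanValue.
Context {R : realType}.

(** Takes the place of compactness of [a, b]. With t the supremum of the points up to which [P]
    holds throughout, the first implication carries [P] from the left onto t, the second from t to
    the right of it. *)
Lemma real_induction (P : R -> Prop) (a b : R) : a <= b -> P a ->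
  (forall t, a <= t <= b -> exists2 d : R, 0 < d &
     forall s, a <= s <= b -> `|s - t| < d ->
       (s <= t -> P s -> P t) /\ (t <= s -> P t -> P s)) ->
  P b.
Proof.
move=> ab Pa step.
pose S := [set t | a <= t <= b /\ forall s, a <= s <= t -> P s].
have Sa : S a.
  split; first by rewrite lexx.
  by move=> s; rewrite -eq_le => /eqP <-.
have Ssup : has_sup S.
  by split; [exists a|exists b => t [/andP[]]].
have ac : a <= sup S by exact: (sup_upper_bound Ssup).
have cb : sup S <= b by apply: ge_sup; [exists a|move=> t [/andP[]]].
have /step[d d0 dP] : a <= sup S <= b by rewrite ac.
have [s [/andP[sa sb] sP] sc] := sup_adherent d0 Ssup.
have sS : s <= sup S.
  by apply: (sup_upper_bound Ssup); split=> //; rewrite sa.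
have near_s r : s <= r -> r <= sup S -> `|r - sup S| < d.
  by move=> sr rc; rewrite ltr_norml; apply/andP; split; lra.
have Pc : P (sup S).
  have sab : a <= s <= b by rewrite sa.
  have [+ _] := dP s sab (near_s s (lexx _) sS).
  by apply => //; apply: sP; rewrite sa lexx.
have Pr r : a <= r <= b -> r < sup S + d -> P r.
  move=> /andP[ar rb] rd.
  have [rs|sr] := leP r s; first by apply: sP; rewrite ar.
  have [cr|rc] := leP (sup S) r.
    have rS : `|r - sup S| < d by rewrite ltr_norml; apply/andP; split; lra.
    have rab : a <= r <= b by rewrite ar.
    by have [_] := dP r rab rS; apply.
  have rc' : 0 < sup S - r by rewrite subr_gt0.
  have [t [/andP[ta tb] tP] tc] := sup_adherent rc' Ssup.
  by apply: tP; apply/andP; split; lra.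
have [bd|db] := ltP b (sup S + d); first by apply: Pr => //; rewrite ab lexx.
(* If [sup S + d] did not exceed [b], the set would reach beyond its supremum. *)
have : S (sup S + d / 2).
  split; first by apply/andP; split; lra.
  by move=> r /andP[ar rd]; apply: Pr; [apply/andP; split; lra|lra].
by move/(sup_upper_bound Ssup); lra.
Qed.

(** A real majorant [p] instead of a constant rate allows [p] to be a primitive of |du|, which turns
    the inequality into a bound by an integral. *)
Lemma mean_value_le {V : normedModType R} (u du : R -> V) (p dp : R -> R) (a b : R) :
  a <= b ->
  (forall t, a <= t <= b -> hasdc u t (du t)) ->
  (forall t, a <= t <= b -> hasdc p t (dp t)) ->
  (forall t, a <= t <= b -> `|du t| <= dp t) ->
  `|u b - u a| <= p b - p a.
Proof.
move=> ab hu hp up; apply/ler_addgt0Pr => e e0.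
have c0 : 0 < e / (b - a + 1) by rewrite divr_gt0//; lra.
(* The slack c (t - a) absorbs the errors c/2 |s - t| of the difference quotients of [u] and [p];
   adding 1 keeps the denominator positive when a = b. *)
set c := e / (b - a + 1) in c0.
suff : `|u b - u a| <= p b - p a + c * (b - a).
  move/le_trans; apply; rewrite lerD2l /c mulrAC ler_pdivrMr; last lra.
  by rewrite ler_wpM2l ?(ltW e0)//; lra.
apply: (@real_induction (fun t => `|u t - u a| <= p t - p a + c * (t - a)) a b) => //.
  by rewrite !subrr normr0 mulr0 addr0.
move=> t tab.
have c2 : 0 < c / 2 by rewrite divr_gt0.
have [d d0 ud] := hu t tab _ c2; have [d' d'0 pd] := hp t tab _ c2.
exists (Num.min d d'); first by rewrite lt_min d0.
move=> s sab; rewrite lt_min => /andP[sd sd'].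
have := ud _ sd; have := pd _ sd'; rewrite [t + _]addrC subrK.
set k := s - t; rewrite -[_ *: _]/(k * dp t) => h1 h2.
have u3 := up t tab.
have us : `|u s - u t| <= `|k| * dp t + c / 2 * `|k|.
  rewrite -[u s - u t](subrK (k *: du t)) (le_trans (ler_normD _ _))//.
  by rewrite addrC lerD// normrZ ler_wpM2l.
move: h1; rewrite ler_norml => /andP[h1 h1'].
have tri : `|u t - u a| <= `|u s - u t| + `|u s - u a|.
  by rewrite distrC (_ : u a - u t = (u s - u t) - (u s - u a)) ?ler_normB//; zmodl.
have tri' : `|u s - u a| <= `|u s - u t| + `|u t - u a|.
  by rewrite (_ : u s - u a = (u s - u t) + (u t - u a)) ?ler_normD//; zmodl.
split=> [st|ts] P.
- have kE : `|k| = - k by rewrite ler0_norm// subr_le0.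
  by move: us h1 h1'; rewrite kE /k => *; nra.
- have kE : `|k| = k by rewrite ger0_norm// subr_ge0.
  by move: us h1 h1'; rewrite kE /k => *; nra.
Qed.

Lemma hasdc_cst {V : normedModType R} (v : V) (t : R) : hasdc (fun=> v) t 0.
Proof.
by move=> e e0; exists 1 => // h _; rewrite scaler0 !subr0 subrr normr0 mulr_ge0// ltW.
Qed.

Lemma hasdc_scale {V : normedModType R} (v : V) (t : R) : hasdc (fun s => s *: v) t v.
Proof.
move=> e e0; exists 1 => // h _.
have -> : (t + h) *: v - t *: v - h *: v = 0 by rewrite scalerDl; zmodl.
by rewrite normr0 mulr_ge0// ltW.
Qed.

Lemma blin_scale_subproof {V : normedModType R} (v : V) :
  linear (fun h : R => h *: v) /\ forall h : R, `|h *: v| <= `|v| * `|h|.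
Proof.
split=> [a h1 h2|h]; last by rewrite normrZ mulrC.
by rewrite scalerDl scalerA.
Qed.

Definition blin_scale {V : normedModType R} (v : V) : blin R V :=
  mk_blin (proj1 (blin_scale_subproof v)) (proj2 (blin_scale_subproof v)).

Lemma hasdcD {V : normedModType R} (u v : R -> V) t du dv :
  hasdc u t du -> hasdc v t dv -> hasdc (fun s => u s + v s) t (du + dv).
Proof.
move=> hu hv; have := @hasdD _ _ _ u v t (blin_scale du) (blin_scale dv) hu hv.
by move=> huv e e0; have [d d0 hd] := huv e e0; exists d => // h /hd;
  rewrite blinD /= -scalerDr.
Qed.

Lemma hasdc_postcomp {V W : normedModType R} (B : blin V W) (u : R -> V) t du :
  hasdc u t du -> hasdc (fun s => B (u s)) t (B du).
Proof.
move=> hu; have := @hasd_postcomp _ _ _ _ B u t (blin_scale du) hu.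
by move=> hBu e e0; have [d d0 hd] := hBu e e0; exists d => // h /hd /=;
  rewrite linearZ.
Qed.

Lemma hasdcN {V : normedModType R} (u : R -> V) t du :
  hasdc u t du -> hasdc (fun s => - u s) t (- du).
Proof. exact: (@hasdc_postcomp _ _ (- blin_id V)). Qed.

Lemma hasdcB {V : normedModType R} (u v : R -> V) t du dv :
  hasdc u t du -> hasdc v t dv -> hasdc (fun s => u s - v s) t (du - dv).
Proof. by move=> hu hv; apply: hasdcD => //; exact: hasdcN. Qed.

Lemma hasdcZ {V : normedModType R} (a : R) (u : R -> V) t du :
  hasdc u t du -> hasdc (fun s => a *: u s) t (a *: du).
Proof. exact: (@hasdc_postcomp _ _ (a *: blin_id V)). Qed.

Lemma mean_value_cst {V : normedModType R} (u du : R -> V) (K a b : R) :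
  a <= b ->
  (forall t, a <= t <= b -> hasdc u t (du t)) ->
  (forall t, a <= t <= b -> `|du t| <= K) ->
  `|u b - u a| <= K * (b - a).
Proof.
move=> ab hu uK.
have := @mean_value_le _ u du (fun t => t * K) (fun=> K) a b ab hu.
rewrite -mulrBl [_ * K]mulrC; apply=> // t _; exact: hasdc_scale.
Qed.

Definition cvxset {U : normedModType R} (S : set U) :=
  forall p q, S p -> S q -> forall s : R, 0 <= s <= 1 -> S (p + s *: (q - p)).

Lemma hasd_segment {U V : normedModType R} (f : U -> V) (p v : U) (t : R) D :
  hasd f (p + t *: v) D -> hasdc (fun s => f (p + s *: v)) t (D v).
Proof.
move=> fD e e0.
have v1 : 0 < `|v| + 1 by rewrite ltr_wpDl.
have [d d0 fd] := fD _ (divr_gt0 e0 v1).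
exists (d / (`|v| + 1)); first exact: divr_gt0.
move=> h; rewrite ltr_pdivlMr// => hd.
have hv : `|h *: v| <= `|h| * (`|v| + 1) by rewrite normrZ ler_wpM2l// lerDl.
have := fd (h *: v) (le_lt_trans hv hd).
rewrite scalerDl addrA linearZ /= => /le_trans; apply.
have := ler_wpM2l (ltW (divr_gt0 e0 v1)) hv; move=> /le_trans; apply.
by rewrite mulrCA divfK ?gt_eqF// mulrC.
Qed.

Lemma mean_value_cvx {U V : normedModType R} (S : set U) (f : U -> V) (K : R) :
  cvxset S -> (forall p, S p -> differentiable f p) ->
  (forall p, S p -> `|fderiv f p| <= K) ->
  forall p q, S p -> S q -> `|f q - f p| <= K * `|q - p|.
Proof.
move=> Sc df dK p q Sp Sq.
have := @mean_value_cst V (fun s => f (p + s *: (q - p)))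
  (fun s => fderiv f (p + s *: (q - p)) (q - p)) (K * `|q - p|) 0 1 ler01.
rewrite scale1r scale0r addr0 subr0 mulr1 [p + (q - p)]addrC subrK; apply=> t t01.
- by apply: hasd_segment; apply: diff_hasd; apply: df; exact: Sc.
- by apply: ler_blin2; apply: dK; exact: Sc.
Qed.

End MeanValue.

(** * Families with uniformly weighted derivatives *)

Section SmoothFamilies.
Context {R : realType} {I : Type}.

Definition bndw {U V : normedModType R} (S : set U) (w : I -> R)
    (g : I -> U -> V) :=
  exists2 K : R, 0 <= K & forall t p, S p -> `|g t p| <= K * w t.

Definition lipw {U V : normedModType R} (S : set U) (w : I -> R)
    (g : I -> U -> V) :=
  exists2 K : R, 0 <= K &
    forall t p q, S p -> S q -> `|g t p - g t q| <= K * w t * `|p - q|.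

(* The derivatives of [g t] of orders [1] to [n] are [O(w t)] on [S], uniformly
   in [t], and if [b] then the last one is also Lipschitz with constant
   [O(w t)]; nothing is asked of the size of [g t] itself. *)
Fixpoint dcls {U : normedModType R} (S : set U) (w : I -> R) (b : bool)
    (n : nat) : forall V : normedModType R, (I -> U -> V) -> Prop :=
  if n is n'.+1 then fun V g =>
    [/\ forall t p, S p -> differentiable (g t) p,
        bndw S w (fun t => fderiv (g t)) &
        dcls S w b n' (fun t => fderiv (g t))]
  else fun V g => b -> lipw S w g.
Arguments dcls {U} S w b n {V} g.

Definition cls {U V : normedModType R} (S : set U) (w : I -> R) (b : bool)
    (n : nat) (g : I -> U -> V) :=
  bndw S w g /\ dcls S w b n g.

Definition one : I -> R := fun=> 1.

Section Fixed.
Context {U : normedModType R} (S : set U) (w : I -> R).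
Hypotheses (oS : open S) (cS : cvxset S) (w_ge0 : forall t, 0 <= w t).

Lemma bndw_ext {V : normedModType R} (g g' : I -> U -> V) :
  (forall t p, S p -> g t p = g' t p) -> bndw S w g -> bndw S w g'.
Proof. by move=> gg' [K K0 gK]; exists K => // t p Sp; rewrite -gg'// gK. Qed.

Lemma open_near (P : U -> Prop) p : (forall q, S q -> P q) -> S p ->
  \forall q \near p, P q.
Proof. by move=> SP Sp; apply: filterS SP _; exact: open_nbhs_nbhs. Qed.

Lemma fderiv_ext_near {V : normedModType R} (g g' : U -> V) p :
  (\forall q \near p, g q = g' q) -> differentiable g p ->
  differentiable g' p /\ fderiv g' p = fderiv g p.
Proof. by move=> gg' /diff_hasd/(hasd_ext gg')/hasdP. Qed.

Lemma dcls_ext b n {V : normedModType R} (g g' : I -> U -> V) :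
  (forall t p, S p -> g t p = g' t p) -> dcls S w b n g -> dcls S w b n g'.
Proof.
elim: n => [|n IH] in V g g' * => gg'.
  move=> gL bT; have [K K0 gK] := gL bT; exists K => // t p q Sp Sq.
  by rewrite -!gg'// gK.
have near_gg' t p : S p -> \forall q \near p, g t q = g' t q.
  by move=> Sp; apply: open_near => // q; exact: gg'.
move=> [dg bg cg].
have E t p : S p -> fderiv (g t) p = fderiv (g' t) p.
  by move=> Sp; have [_ ->] := fderiv_ext_near (near_gg' t p Sp) (dg t p Sp).
split=> [t p Sp||].
- by have [] := fderiv_ext_near (near_gg' t p Sp) (dg t p Sp).
- exact: bndw_ext bg.
- exact: IH cg.
Qed.

Lemma cls_ext b n {V : normedModType R} (g g' : I -> U -> V) :
  (forall t p, S p -> g t p = g' t p) -> cls S w b n g -> cls S w b n g'.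
Proof. by move=> gg' [bg dg]; split; [exact: bndw_ext bg|exact: dcls_ext dg]. Qed.

Lemma dcls_intro b n {V : normedModType R} (g : I -> U -> V)
    (Dg : I -> U -> blin U V) :
  (forall t p, S p -> hasd (g t) p (Dg t p)) -> cls S w b n Dg ->
  dcls S w b n.+1 g.
Proof.
move=> gD [bD dD].
have E t p : S p -> Dg t p = fderiv (g t) p by move=> /(gD t)/hasd_fderiv.
split=> [t p Sp||]; first exact: hasd_diff (gD t p Sp).
  exact: bndw_ext bD.
exact: dcls_ext dD.
Qed.

Lemma cls_intro b n {V : normedModType R} (g : I -> U -> V)
    (Dg : I -> U -> blin U V) : bndw S w g ->
  (forall t p, S p -> hasd (g t) p (Dg t p)) -> cls S w b n Dg ->
  cls S w b n.+1 g.
Proof. by move=> bg gD cD; split=> //; exact: dcls_intro cD. Qed.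

Lemma dcls_hasd b n {V : normedModType R} (g : I -> U -> V) :
  dcls S w b n.+1 g ->
  (forall t p, S p -> hasd (g t) p (fderiv (g t) p)) /\
  cls S w b n (fun t => fderiv (g t)).
Proof. by move=> [dg bg cg]; split=> // t p Sp; apply: diff_hasd; exact: dg. Qed.

Lemma bnd_lipw {V : normedModType R} (g : I -> U -> V) :
  (forall t p, S p -> differentiable (g t) p) ->
  bndw S w (fun t => fderiv (g t)) -> lipw S w g.
Proof.
move=> dg [K K0 gK]; exists K => // t p q Sp Sq.
by apply: (mean_value_cvx cS) => //; [exact: dg|exact: gK].
Qed.

Lemma dcls_lip n {V : normedModType R} (g : I -> U -> V) :
  dcls S w true n g -> lipw S w g.
Proof. by case: n => [/(_ isT)|n [dg bg _]]//; exact: bnd_lipw. Qed.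

Lemma dcls_pred b n {V : normedModType R} (g : I -> U -> V) :
  dcls S w b n.+1 g -> dcls S w b n g.
Proof.
elim: n => [|n IH] in V g * => -[dg bg cg]; first by move=> _; exact: bnd_lipw.
by split=> //; exact: IH.
Qed.

Lemma cls_pred b n {V : normedModType R} (g : I -> U -> V) :
  cls S w b n.+1 g -> cls S w b n g.
Proof. by move=> [bg dg]; split=> //; exact: dcls_pred. Qed.

(** The mean value inequality on the convex [S] trades the bound of order n + 1 for a Lipschitz
    bound of order n. *)
Lemma dcls_true n {V : normedModType R} (g : I -> U -> V) :
  dcls S w false n.+1 g -> dcls S w true n g.
Proof.
elim: n => [|n IH] in V g * => -[dg bg cg]; first by move=> _; exact: bnd_lipw.
by split=> //; exact: IH.
Qed.

Lemma cls_true n {V : normedModType R} (g : I -> U -> V) :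
  cls S w false n.+1 g -> cls S w true n g.
Proof. by move=> [bg dg]; split=> //; exact: dcls_true. Qed.

Lemma bndwD {V : normedModType R} (g h : I -> U -> V) :
  bndw S w g -> bndw S w h -> bndw S w (fun t p => g t p + h t p).
Proof.
move=> [K K0 gK] [L L0 hL]; exists (K + L); first exact: addr_ge0.
by move=> t p Sp; rewrite mulrDl (le_trans (ler_normD _ _))// lerD ?gK ?hL.
Qed.

Lemma dclsD b n {V : normedModType R} (g h : I -> U -> V) :
  dcls S w b n g -> dcls S w b n h -> dcls S w b n (fun t p => g t p + h t p).
Proof.
elim: n => [|n IH] in V g h *.
  move=> gL hL bT; have [K K0 gK] := gL bT; have [L L0 hK] := hL bT.
  exists (K + L); first exact: addr_ge0.
  move=> t p q Sp Sq.
  rewrite (_ : _ - _ = (g t p - g t q) + (h t p - h t q)); last by zmodl.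
  by rewrite !mulrDl (le_trans (ler_normD _ _))// lerD ?gK ?hK.
move=> /dcls_hasd[gD [bg cg]] /dcls_hasd[hD [bh ch]].
apply: (@dcls_intro _ _ _ _ (fun t p => fderiv (g t) p + fderiv (h t) p)).
  by move=> t p Sp; apply: hasdD; [exact: gD|exact: hD].
split; first exact: (bndwD bg bh).
exact: (IH _ _ _ cg ch).
Qed.

Lemma clsD b n {V : normedModType R} (g h : I -> U -> V) :
  cls S w b n g -> cls S w b n h -> cls S w b n (fun t p => g t p + h t p).
Proof. by move=> [? ?] [? ?]; split; [exact: (@bndwD _ g h)|exact: (@dclsD _ _ _ g h)]. Qed.

Lemma bndw_postcomp {V W : normedModType R} (B : blin V W) (g : I -> U -> V) :
  bndw S w g -> bndw S w (fun t p => B (g t p)).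
Proof.
move=> [K K0 gK]; exists (`|B| * K); first exact: mulr_ge0.
by move=> t p Sp; rewrite (le_trans (ler_blin _ _))// -mulrA ler_wpM2l ?gK.
Qed.

Lemma dcls_postcomp b n {V W : normedModType R} (B : blin V W) (g : I -> U -> V) :
  dcls S w b n g -> dcls S w b n (fun t p => B (g t p)).
Proof.
elim: n => [|n IH] in V W B g *.
  move=> gL bT; have [K K0 gK] := gL bT.
  exists (`|B| * K); first exact: mulr_ge0.
  move=> t p q Sp Sq; rewrite -linearB (le_trans (ler_blin _ _))//.
  by rewrite -!mulrA ler_wpM2l// mulrA gK.
move=> /dcls_hasd[gD [bg cg]].
apply: (@dcls_intro _ _ _ _ (fun t p => blin_postcomp B (fderiv (g t) p))).
  by move=> t p Sp; apply: hasd_postcomp; exact: gD.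
split; first exact: (bndw_postcomp (blin_postcomp B) bg).
exact: (IH _ _ (blin_postcomp B) _ cg).
Qed.

Lemma cls_postcomp b n {V W : normedModType R} (B : blin V W) (g : I -> U -> V) :
  cls S w b n g -> cls S w b n (fun t p => B (g t p)).
Proof. by move=> [? ?]; split; [exact: (bndw_postcomp B)|exact: (dcls_postcomp B)]. Qed.

Lemma clsB b n {V : normedModType R} (g h : I -> U -> V) :
  cls S w b n g -> cls S w b n h -> cls S w b n (fun t p => g t p - h t p).
Proof.
move=> cg ch; apply: (@clsD _ _ _ g (fun t p => - h t p)) => //.
exact: (@cls_postcomp _ _ _ _ (- blin_id V) h).
Qed.

(** As [dcls] does not measure the maps themselves, [v] may be unbounded in t and [S] may be
    unbounded. *)
Lemma dcls_affine b n {V : normedModType R} (B : blin U V) (v : I -> V) :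
  (forall t, w t = 1) -> dcls S w b n (fun t p => v t + B p).
Proof.
move=> w1.
have dcst m (W : normedModType R) (c : W) : cls S w b m (fun _ _ => c).
  elim: m => [|m IH] in W c *; split.
  - by exists `|c| => // t p _; rewrite w1 mulr1.
  - by move=> _; exists 0 => // t p q _ _; rewrite subrr normr0 !mul0r.
  - by exists `|c| => // t p _; rewrite w1 mulr1.
  - by apply: dcls_intro (IH _ 0) => t p _; exact: hasd_cst.
case: n => [_|n].
  exists `|B| => // t p q _ _.
  rewrite (_ : _ - _ = B (p - q)); last by rewrite linearB /=; zmodl.
  by rewrite w1 mulr1 ler_blin.
apply: dcls_intro (dcst n _ B) => t p _.
by rewrite -[B in hasd _ _ B]add0r; apply: hasdD; [exact: hasd_cst|exact: hasd_blin].
Qed.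

Lemma bndw_bilin {V1 V2 W : normedModType R} (B : blin V1 (blin V2 W))
    (g1 : I -> U -> V1) (g2 : I -> U -> V2) :
  bndw S w g1 -> bndw S one g2 -> bndw S w (fun t p => B (g1 t p) (g2 t p)).
Proof.
move=> [K K0 gK] [L L0 gL]; exists (`|B| * K * L); first by rewrite !mulr_ge0.
move=> t p Sp; rewrite (le_trans (ler_blin _ _))//.
rewrite [leRHS]mulrAC ler_pM//; last by rewrite (le_trans (gL t p Sp))// mulr1.
by rewrite (le_trans (ler_blin _ _))// -mulrA ler_wpM2l// gK.
Qed.

End Fixed.

(** * Products and composites of weighted families *)

Section Products.
Context {U : normedModType R} (S : set U) (w : I -> R).
Hypotheses (oS : open S) (cS : cvxset S) (w_ge0 : forall t, 0 <= w t).

Let one_ge0 : forall t, 0 <= one t. Proof. by move=> t; rewrite /one. Qed.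

(** One factor carries the weight and the other is uniformly bounded, so the product has the weight
    only once. The derivative is a sum of two products of the same kind, for bilinear maps built
    from [B]; hence the quantification over all [B] and all spaces in the induction. *)
Lemma cls_bilin b n {V1 V2 W : normedModType R} (B : blin V1 (blin V2 W))
    (g1 : I -> U -> V1) (g2 : I -> U -> V2) :
  cls S w b n g1 -> cls S one b n g2 ->
  cls S w b n (fun t p => B (g1 t p) (g2 t p)).
Proof.
elim: n => [|n IH] in V1 V2 W B g1 g2 *.
  move=> [b1 d1] [b2 d2]; split; first exact: (bndw_bilin B b1 b2).
  move=> bT; have [K1 K10 L1] := d1 bT; have [K2 K20 L2] := d2 bT.
  have [M1 M10 h1] := b1; have [M2 M20 h2] := b2.
  exists (`|B| * (K1 * M2 + M1 * K2)); first by rewrite !(mulr_ge0, addr_ge0).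
  move=> t p q Sp Sq.
  have BB u v : `|B u v| <= `|B| * `|u| * `|v|.
    by rewrite (le_trans (ler_blin _ _))// ler_wpM2r// ler_blin.
  have -> : B (g1 t p) (g2 t p) - B (g1 t q) (g2 t q) =
    B (g1 t p - g1 t q) (g2 t p) + B (g1 t q) (g2 t p - g2 t q).
    have -> : B (g1 t p - g1 t q) (g2 t p) = B (g1 t p) (g2 t p) - B (g1 t q) (g2 t p).
      by rewrite linearB.
    by rewrite [B _ (_ - _)]linearB /=; zmodl.
  rewrite (le_trans (ler_normD _ _))// mulrDr !mulrDl lerD//.
  - rewrite (le_trans (BB _ _))// -[leRHS]mulrA -[leLHS]mulrA -[leRHS]mulrA.
    rewrite ler_wpM2l//.
    have := ler_pM (normr_ge0 _) (normr_ge0 _) (L1 t p q Sp Sq) (h2 t p Sp).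
    by move=> /le_trans; apply; rewrite /one mulr1 le_eqVlt; apply/orP; left; apply/eqP; ring.
  - rewrite (le_trans (BB _ _))// -[leRHS]mulrA -[leLHS]mulrA -[leRHS]mulrA.
    rewrite ler_wpM2l//.
    have := ler_pM (normr_ge0 _) (normr_ge0 _) (h1 t q Sq) (L2 t p q Sp Sq).
    by move=> /le_trans; apply; rewrite /one mulr1 le_eqVlt; apply/orP; left; apply/eqP; ring.
move=> c1 c2; have [b1 d1] := c1; have [b2 d2] := c2.
have [D1 cD1] := dcls_hasd d1; have [D2 cD2] := dcls_hasd d2.
apply: (@cls_intro _ _ _ oS _ _ _ _ (fun t p =>
   blin_comp (blin_flipL U V2 W) (blin_postcomp B) (fderiv (g1 t) p) (g2 t p) +
   blin_comp (blin_compL U V2 W) B (g1 t p) (fderiv (g2 t) p))).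
- exact: (bndw_bilin B b1 b2).
- by move=> t p Sp; apply: hasd_bilin; [exact: D1|exact: D2].
- apply: (@clsD _ _ _ oS _ _ _ (fun t p =>
     blin_comp (blin_flipL U V2 W) (blin_postcomp B) (fderiv (g1 t) p) (g2 t p))
    (fun t p => blin_comp (blin_compL U V2 W) B (g1 t p) (fderiv (g2 t) p))).
    exact: (IH _ _ _ _ _ _ cD1 (cls_pred cS c2)).
  exact: (IH _ _ _ _ _ _ (cls_pred cS c1) cD2).
Qed.

(** The derivative is the product, under composition of operators, of [fderiv (g t)] along [f] and
    of [fderiv (f t)]: the first factor falls under the induction hypothesis and [cls_bilin]
    multiplies. The size of [f] never enters, so [dcls] is enough for it. *)
Lemma cls_chain b n {U' V : normedModType R} (S' : set U') (oS' : open S')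
    (cS' : cvxset S') (g : I -> U' -> V) (f : I -> U -> U') :
  (forall t p, S p -> S' (f t p)) ->
  cls S' w b n g -> dcls S one b n f ->
  cls S w b n (fun t p => g t (f t p)).
Proof.
move=> SS'; elim: n => [|n IH] in V g *.
  move=> [[K K0 gK] dg] df; split; first by exists K => // t p Sp; apply/gK/SS'.
  move=> bT; have [L L0 gL] := dg bT; have [M M0 fM] := df bT.
  exists (L * M); first exact: mulr_ge0.
  move=> t p q Sp Sq; rewrite (le_trans (gL t _ _ (SS' _ _ Sp) (SS' _ _ Sq)))//.
  have := ler_wpM2l (mulr_ge0 L0 (w_ge0 t)) (fM t p q Sp Sq).
  by move=> /le_trans; apply; rewrite /one mulr1 le_eqVlt; apply/orP; left; apply/eqP; ring.
move=> cg df; have [[K K0 gK] dg] := cg.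
have [Dg cDg] := dcls_hasd dg; have [Df cDf] := dcls_hasd df.
apply: (@cls_intro _ _ _ oS _ _ _ _ (fun t p =>
   blin_compL U U' V (fderiv (g t) (f t p)) (fderiv (f t) p))).
- by exists K => // t p Sp; apply/gK/SS'.
- by move=> t p Sp; apply: (hasd_comp (Dg t _ (SS' _ _ Sp)) (Df t p Sp)).
- apply: (@cls_bilin b n _ _ _ (blin_compL U U' V)
      (fun t p => fderiv (g t) (f t p)) (fun t p => fderiv (f t) p) _ cDf).
  exact: (IH _ _ cDg (dcls_pred cS df)).
Qed.

(** Without a bound on [g] the composite has none, but its derivative is still covered by
    [cls_chain]. *)
Lemma dcls_chain b n {U' V : normedModType R} (S' : set U') (oS' : open S')
    (cS' : cvxset S') (g : I -> U' -> V) (f : I -> U -> U') :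
  (forall t p, S p -> S' (f t p)) ->
  dcls S' w b n g -> dcls S one b n f ->
  dcls S w b n (fun t p => g t (f t p)).
Proof.
move=> SS'; case: n => [|n] dg df.
  move=> bT; have [L L0 gL] := dg bT; have [M M0 fM] := df bT.
  exists (L * M); first exact: mulr_ge0.
  move=> t p q Sp Sq; rewrite (le_trans (gL t _ _ (SS' _ _ Sp) (SS' _ _ Sq)))//.
  have := ler_wpM2l (mulr_ge0 L0 (w_ge0 t)) (fM t p q Sp Sq).
  by move=> /le_trans; apply; rewrite /one mulr1 le_eqVlt; apply/orP; left; apply/eqP; ring.
have [Dg cDg] := dcls_hasd dg; have [Df cDf] := dcls_hasd df.
apply: (@dcls_intro _ _ _ oS _ _ _ _ (fun t p =>
   blin_compL U U' V (fderiv (g t) (f t p)) (fderiv (f t) p))).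
  by move=> t p Sp; apply: (hasd_comp (Dg t _ (SS' _ _ Sp)) (Df t p Sp)).
apply: (@cls_bilin b n _ _ _ (blin_compL U U' V)
    (fun t p => fderiv (g t) (f t p)) (fun t p => fderiv (f t) p) _ cDf).
exact: (cls_chain oS' cS' SS' cDg (dcls_pred cS df)).
Qed.

End Products.

Lemma cls_sub {U V : normedModType R} (S S' : set U) (w : I -> R) b n
    (g : I -> U -> V) : (S' `<=` S) -> cls S w b n g -> cls S' w b n g.
Proof.
move=> SS'.
have bs (V' : normedModType R) (h : I -> U -> V') : bndw S w h -> bndw S' w h.
  by move=> [K K0 hK]; exists K => // t p /SS'; exact: hK.
move=> [bg dg]; split; first exact: bs.
elim: n => [|n IH] in V g bg dg *.
  move=> bT; have [K K0 gK] := dg bT; exists K => // t p q /SS' Sp /SS' Sq.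
  exact: gK.
have [d1 d2 d3] := dg; split=> [t p /SS'||]; first exact: d1.
  exact: bs.
exact: IH.
Qed.

Lemma cls_weight {U V : normedModType R} (S : set U) (w w' : I -> R) b n
    (g : I -> U -> V) : (forall t, w t <= w' t) ->
  cls S w b n g -> cls S w' b n g.
Proof.
move=> ww'.
have bs (V' : normedModType R) (h : I -> U -> V') : bndw S w h -> bndw S w' h.
  move=> [K K0 hK]; exists K => // t p Sp; rewrite (le_trans (hK t p Sp))//.
  exact: ler_wpM2l.
move=> [bg dg]; split; first exact: bs.
elim: n => [|n IH] in V g bg dg *.
  move=> bT; have [K K0 gK] := dg bT; exists K => // t p q Sp Sq.
  by rewrite (le_trans (gK t p q Sp Sq))// ler_wpM2r// ler_wpM2l.
have [d1 d2 d3] := dg; split=> //; first exact: bs.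
exact: IH.
Qed.

End SmoothFamilies.
Arguments dcls {R I U} S w b n {V} g.

(** * Iterated derivatives *)

Section IteratedDerivatives.
Context {R : realType}.
Implicit Types U V W : normedModType R.

(* [mlin n U (blin U V)] and [mlin n.+1 U V] are the same space up to the
   bracketing of the arguments; [curryS] is the identification. *)
Fixpoint curryS U V n : blin (mlin n U (blin U V)) (mlin n.+1 U V) :=
  if n is n'.+1 then blin_postcomp (curryS U V n') else blin_id (blin U V).

Fixpoint uncurryS U V n : blin (mlin n.+1 U V) (mlin n U (blin U V)) :=
  if n is n'.+1 then blin_postcomp (uncurryS U V n') else blin_id (blin U V).

Lemma currySK U V n : cancel (curryS U V n) (uncurryS U V n).
Proof. by elim: n => [//|n IH] m; apply/blin_eqP => u /=; exact: IH. Qed.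

Lemma blin_id_le U : `|blin_id U| <= 1.
Proof. by apply: blin_le => // u; rewrite mul1r. Qed.

Lemma uncurryS_le U V n m : `|uncurryS U V n m| <= `|m|.
Proof.
suff: `|uncurryS U V n| <= 1 by move=> /(ler_blin2 m); rewrite mul1r.
elim: n {m} => [|n IH] /=; first exact: blin_id_le.
exact: le_trans (blin_postcomp_le _) IH.
Qed.

Definition diffn {U V} (n : nat) (S : set U) (g : U -> V) :=
  forall j p, (j < n)%N -> S p -> differentiable (fderivn j g) p.

Lemma diffn_le {U V} n m (S : set U) (g : U -> V) : (m <= n)%N ->
  diffn n S g -> diffn m S g.
Proof. by move=> mn gn j p jm; apply: gn; exact: leq_trans mn. Qed.

(** [fderivn] adds derivatives on the outside while [dcls] recurses on [fderiv g]; this and [diffnS]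
    translate between the two. *)
Lemma fderivnS_curry {U V} n (S : set U) (g : U -> V) : open S ->
  diffn n S (fderiv g) ->
  forall p, S p -> fderivn n.+1 g p = curryS U V n (fderivn n (fderiv g) p).
Proof.
move=> oS; elim: n => [_ p _//|n IH] gn p Sp.
have near_eq : \forall q \near p,
    curryS U V n (fderivn n (fderiv g) q) = fderivn n.+1 g q.
  apply: (open_near oS) => // q Sq; rewrite IH//.
  exact: diffn_le gn.
have := hasd_postcomp (curryS U V n) (diff_hasd (gn n p (ltnSn n) Sp)).
by move=> /(hasd_ext near_eq)/hasd_fderiv.
Qed.

Lemma diffnS {U V} n (S : set U) (g : U -> V) : open S ->
  diffn n.+1 S g <->
  (forall p, S p -> differentiable g p) /\ diffn n S (fderiv g).
Proof.
move=> oS; split=> [gn|[dg gn] [|j] p jn Sp].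
- split=> [p Sp|]; first exact: (gn 0%N).
  move=> j; elim/ltn_ind: j => j IH p jn Sp.
  have gj : diffn j S (fderiv g).
    by move=> i q ij Sq; apply: IH => //; exact: ltn_trans jn.
  have near_eq : \forall q \near p,
      uncurryS U V j (fderivn j.+1 g q) = fderivn j (fderiv g) q.
    apply: (open_near oS) => // q Sq.
    by rewrite (fderivnS_curry oS gj)// currySK.
  have := hasd_postcomp (uncurryS U V j) (diff_hasd (gn j.+1 p jn Sp)).
  by move=> /(hasd_ext near_eq)/hasd_diff.
- exact: dg.
- have near_eq : \forall q \near p,
      curryS U V j (fderivn j (fderiv g) q) = fderivn j.+1 g q.
    apply: (open_near oS) => // q Sq.
    by rewrite (fderivnS_curry oS (diffn_le (@ltnW j n jn) gn)).
  have := hasd_postcomp (curryS U V j) (diff_hasd (gn j p jn Sp)).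
  by move=> /(hasd_ext near_eq)/hasd_diff.
Qed.

(** The same [K] survives the recursion because [uncurryS] has norm at most 1. *)
Lemma dcls_of_bounds {I : Type} {U V} (S : set U) (w : I -> R) n
    (g : I -> U -> V) (K : R) : open S -> 0 <= K ->
  (forall t, diffn n S (g t)) ->
  (forall j t p, (1 <= j <= n)%N -> S p -> `|fderivn j (g t) p| <= K * w t) ->
  dcls S w false n g.
Proof.
move=> oS K0; elim: n => [//|n IH] in V g * => gn gK.
have dn t := proj1 (diffnS n (g t) oS) (gn t).
split=> [t p Sp||].
- exact: (proj1 (dn t)).
- by exists K => // t p Sp; apply: (gK 1%N).
- apply: IH => [t|j t p /andP[j1 jn] Sp]; first exact: (proj2 (dn t)).
  have := fderivnS_curry oS (diffn_le jn (proj2 (dn t))) Sp.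
  move=> /(congr1 (uncurryS U V j)); rewrite currySK => <-.
  by rewrite (le_trans (uncurryS_le _))// gK.
Qed.

Lemma dcls_diffn {I : Type} {U V} (S : set U) (w : I -> R) b n
    (g : I -> U -> V) t : open S -> dcls S w b n g -> diffn n S (g t).
Proof.
move=> oS; elim: n => [//|n IH] in V g * => -[dg _ cg].
by apply/(diffnS _ _ oS); split=> [p|]; [exact: dg|exact: IH cg].
Qed.

Lemma dcls_fderivn_lip {I : Type} {U V} (S : set U) (w : I -> R) n
    (g : I -> U -> V) t : open S -> dcls S w true n g ->
  exists2 K : R, 0 <= K & forall p q, S p -> S q ->
    `|fderivn n (g t) p - fderivn n (g t) q| <= K * w t * `|p - q|.
Proof.
move=> oS; elim: n => [|n IH] in V g *.
  by move=> /(_ isT)[K K0 gK]; exists K => // p q; exact: gK.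
move=> [dg _ cg]; have [K K0 gK] := IH _ _ cg.
exists (`|curryS U V n| * K); first exact: mulr_ge0.
have gn := dcls_diffn t oS cg.
move=> p q Sp Sq; rewrite !(fderivnS_curry oS gn)// -linearB.
rewrite (le_trans (ler_blin _ _))// -!mulrA ler_wpM2l// mulrA; exact: gK.
Qed.

Lemma lip_continuous {U V} (S : set U) (f : U -> V) (K : R) p : open S ->
  0 <= K -> (forall p q, S p -> S q -> `|f p - f q| <= K * `|p - q|) ->
  S p -> {for p, continuous f}.
Proof.
move=> oS K0 fK Sp; apply/cvgrPdist_le => e e0.
have K1 : 0 < K + 1 by rewrite ltr_wpDl.
have : \forall q \near p, S q /\ `|p - q| < e / (K + 1).
  apply: filterI; first exact: open_nbhs_nbhs.
  by apply: cvgr_dist_lt; [exact: cvg_id|exact: divr_gt0].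
apply: filterS => q [Sq pq]; rewrite (le_trans (fK _ _ Sp Sq))//.
move: pq; rewrite ltr_pdivlMr// => /ltW pq; apply: le_trans pq.
by rewrite mulrC ler_wpM2l// lerDl.
Qed.

(** Continuity of the last derivative comes from its Lipschitz bound, the purpose of the flag
    [true]. *)
Lemma dcls_Ck {I : Type} {U V} (S : set U) (w : I -> R) n
    (g : I -> U -> V) t : open S -> (forall t, 0 <= w t) ->
  dcls S w true n g -> Ck n S (g t).
Proof.
move=> oS w0 cg; split=> [i p ik Sp|p Sp].
  exact: (dcls_diffn t oS cg).
have [K K0 gK] := dcls_fderivn_lip t oS cg.
exact: (lip_continuous oS (mulr_ge0 K0 (w0 t)) gK).
Qed.

Lemma fderivnD {U V} n (S : set U) (g h : U -> V) : open S ->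
  diffn n S g -> diffn n S h ->
  diffn n S (fun q => g q + h q) /\
  forall p, S p -> fderivn n (fun q => g q + h q) p = fderivn n g p + fderivn n h p.
Proof.
move=> oS; elim: n => [//|n IH] gn hn.
have [ghn E] := IH (diffn_le (leqnSn n) gn) (diffn_le (leqnSn n) hn).
have D p : S p -> hasd (fderivn n (fun q => g q + h q)) p
    (fderivn n.+1 g p + fderivn n.+1 h p).
  move=> Sp; apply: (@hasd_ext _ _ _ (fun q => fderivn n g q + fderivn n h q)).
    by apply: (open_near oS) => // q Sq; rewrite E.
  by apply: hasdD; apply: diff_hasd; [exact: gn|exact: hn].
split=> [j p|p Sp]; last exact: hasd_fderiv (D p Sp).
rewrite ltnS leq_eqVlt => /predU1P[->|jn] Sp; first exact: hasd_diff (D p Sp).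
exact: ghn.
Qed.

Lemma fderivn_postcomp {U V W} n (S : set U) (B : blin V W) (g : U -> V) :
  open S -> diffn n S g ->
  diffn n S (fun q => B (g q)) /\
  forall p, S p -> fderivn n (fun q => B (g q)) p = mlin_comp n B (fderivn n g p).
Proof.
move=> oS; elim: n => [//|n IH] gn.
have [ghn E] := IH (diffn_le (leqnSn n) gn).
have D p : S p -> hasd (fderivn n (fun q => B (g q))) p
    (mlin_comp n.+1 B (fderivn n.+1 g p)).
  move=> Sp; apply: (@hasd_ext _ _ _ (fun q => mlin_comp n B (fderivn n g q))).
    by apply: (open_near oS) => // q Sq; rewrite E.
  by apply: hasd_postcomp; apply: diff_hasd; exact: gn.
split=> [j p|p Sp]; last exact: hasd_fderiv (D p Sp).
rewrite ltnS leq_eqVlt => /predU1P[->|jn] Sp; first exact: hasd_diff (D p Sp).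
exact: ghn.
Qed.

Lemma mlin_compN {U V} n (m : mlin n U V) : mlin_comp n (- blin_id V) m = - m.
Proof. by elim: n m => [//|n IH] m; apply/blin_eqP => u /=; rewrite IH. Qed.

Lemma fderivnB {U V} n (S : set U) (g h : U -> V) : open S ->
  diffn n S g -> diffn n S h ->
  diffn n S (fun q => g q - h q) /\
  forall p, S p -> fderivn n (fun q => g q - h q) p = fderivn n g p - fderivn n h p.
Proof.
move=> oS gn hn; have [kn E] := fderivn_postcomp (- blin_id V) oS hn.
have [ghn E'] := fderivnD oS gn kn; split=> // p Sp.
by rewrite [LHS]E'// E// mlin_compN.
Qed.

Lemma Ck_diffn {U V} n (S : set U) (g : U -> V) : Ck n S g -> diffn n S g.
Proof. by move=> [gn _] j p; exact: gn. Qed.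

Lemma Ck_le {U V} n m (S : set U) (g : U -> V) : (m <= n)%N ->
  Ck n S g -> Ck m S g.
Proof.
rewrite leq_eqVlt => /predU1P[->//|mn] [gn gc]; split=> [i p im|p Sp].
  by apply: gn; exact: ltn_trans mn.
exact/differentiable_continuous/gn.
Qed.

Lemma CkD {U V} n (S : set U) (g h : U -> V) : open S ->
  Ck n S g -> Ck n S h -> Ck n S (fun q => g q + h q).
Proof.
move=> oS cg ch; have [dgh E] := fderivnD oS (Ck_diffn cg) (Ck_diffn ch).
split=> [i p ik|p Sp]; first exact: dgh.
apply: (@cvg_trans _ ((fun q => fderivn n g q + fderivn n h q) @ p)).
  apply: near_eq_cvg.
  by apply: (open_near oS) => // q Sq; rewrite E.
by rewrite E//; apply: cvgD; [exact: (proj2 cg)|exact: (proj2 ch)].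
Qed.

Lemma Ck_sub {U V} n (S S' : set U) (g : U -> V) : S' `<=` S ->
  Ck n S g -> Ck n S' g.
Proof. by move=> SS' [gn gc]; split=> [i p ik /SS'|p /SS']; [exact: gn|exact: gc]. Qed.

Lemma ball_cvx {U} (p : U) (r : R) : cvxset (ball p r).
Proof.
rewrite -ball_normE => x y /= px py s /andP[s0 s1].
have -> : p - (x + s *: (y - x)) = (1 - s) *: (p - x) + s *: (p - y).
  by rewrite scalerBl scale1r !scalerBr; zmodl.
rewrite (le_lt_trans (ler_normD _ _))// !normrZ !ger0_norm ?subr_ge0//.
have [->|sn] := eqVneq s 0; first by rewrite subr0 mul1r mul0r addr0.
have sp : 0 < s by rewrite lt_neqAle eq_sym sn.
have h1 : (1 - s) * `|p - x| <= (1 - s) * r by rewrite ler_wpM2l ?subr_ge0// ltW.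
have h2 : s * `|p - y| < s * r by rewrite ltr_pM2l.
lra.
Qed.

(** Continuous derivatives are bounded near a point. Families indexed by [unit] make the composition
    lemmas for classes available for a single map. *)
Lemma Ck_local {U V} n (S : set U) (g : U -> V) p : open S -> Ck n S g -> S p ->
  exists2 r : R, 0 < r &
    ball p r `<=` S /\ cls (ball p r) one false n (fun _ : unit => g).
Proof.
move=> oS cg Sp.
have ctn j : (j <= n)%N -> {for p, continuous (fderivn j g)}.
  by move=> jn; have [_ /(_ p Sp)] := Ck_le jn cg.
have : \forall q \near p, S q /\
    forall j : 'I_n.+1, `|fderivn j g q| < `|fderivn j g p| + 1.
  apply: filterI; first exact: open_nbhs_nbhs.
  apply: filter_forall => j.
  apply: (cvgr_lt (`|fderivn j g p|)); last by rewrite ltrDl.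
  by apply: cvg_norm; exact: (ctn j (ltn_ord j)).
move=> /nbhs_ballP[r /= r0 rP]; exists r => //.
have rS : ball p r `<=` S by move=> q /rP[].
pose K := \sum_(j < n.+1) (`|fderivn j g p| + 1).
have K0 : 0 <= K by apply: sumr_ge0 => j _; rewrite addr_ge0.
have gK j q : (j <= n)%N -> ball p r q -> `|fderivn j g q| <= K * one tt.
  move=> jn /rP[_ /(_ (inord j))]; rewrite inordK ?ltnS// => /ltW/le_trans; apply.
  rewrite /one mulr1 /K (bigD1 (inord j))//= inordK ?ltnS// lerDl.
  by apply: sumr_ge0 => i _; rewrite addr_ge0.
split=> //; split; first by exists K => // -[] q; exact: (gK 0%N).
have ob : open (ball p r) by exact: ball_open.
apply: (@dcls_of_bounds unit U V _ one n (fun=> g) K ob K0) => [_ j q jn /rS|j [] q /andP[_ jn]].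
  exact: (Ck_diffn cg).
exact: gK.
Qed.

End IteratedDerivatives.

(** * Symmetry of derivatives *)

Section Schwarz.
Context {R : realType} {U V : normedModType R}.

(** The quantity to estimate is [m 1 - m 0], where [m] moves both base points along s v. In the
    derivative of [m] the expansions of [fderiv g] at the two points differ by exactly [D (s *: u)],
    so only two remainders are left. *)
Lemma second_difference (g : U -> V) (p u v : U) (e d s : R) :
  0 < s -> s * (`|u| + `|v|) < d ->
  (forall k, `|k| < d -> differentiable g (p + k)) ->
  (forall k, `|k| < d ->
     `|fderiv g (p + k) - fderiv g p - fderiv (fderiv g) p k| <= e * `|k|) ->
  0 < e ->
  `|g (p + s *: u + s *: v) - g (p + s *: u) - g (p + s *: v) + g p
    - s ^+ 2 *: fderiv (fderiv g) p u v|
    <= 2 * e * s ^+ 2 * (`|u| + `|v|) ^+ 2.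
Proof.
move=> s0 sd dg gd e0; set D := fderiv (fderiv g) p.
pose m (r : R) := g (p + s *: u + r *: (s *: v)) - g (p + r *: (s *: v))
   - r *: (s ^+ 2 *: D u v).
pose dm (r : R) := fderiv g (p + s *: u + r *: (s *: v)) (s *: v)
   - fderiv g (p + r *: (s *: v)) (s *: v) - s ^+ 2 *: D u v.
have nk (r : R) : 0 <= r <= 1 -> `|s *: u + r *: (s *: v)| <= s * (`|u| + `|v|) /\
    `|r *: (s *: v)| <= s * (`|u| + `|v|).
  move=> /andP[r0 r1].
  have rv : `|r *: (s *: v)| <= s * `|v|.
    by rewrite !normrZ !ger0_norm ?(ltW s0)// ler_piMl// mulr_ge0// ltW.
  have su : `|s *: u| = s * `|u| by rewrite normrZ gtr0_norm.
  rewrite mulrDr; split; last by rewrite (le_trans rv)// lerDr mulr_ge0// ltW.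
  by rewrite (le_trans (ler_normD _ _))// su lerD.
have hm (r : R) : 0 <= r <= 1 -> hasdc m r (dm r).
  move=> r01; have [k1 k2] := nk r r01.
  apply: hasdcB; last exact: hasdc_scale.
  apply: hasdcB; apply: hasd_segment; apply: diff_hasd.
    by rewrite -addrA; apply: dg; exact: le_lt_trans k1 sd.
  by apply: dg; exact: le_lt_trans k2 sd.
have dmK (r : R) : 0 <= r <= 1 -> `|dm r| <= 2 * e * s ^+ 2 * (`|u| + `|v|) ^+ 2.
  move=> r01; have [] := nk r r01; rewrite /dm -[p + s *: u + _]addrA.
  set k1 := s *: u + _; set k2 := r *: _ => k1s k2s.
  have h1 := gd k1 (le_lt_trans k1s sd); have h2 := gd k2 (le_lt_trans k2s sd).
  have -> : fderiv g (p + k1) (s *: v) - fderiv g (p + k2) (s *: v) - s ^+ 2 *: D u v =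
    (fderiv g (p + k1) - fderiv g p - D k1) (s *: v) -
    (fderiv g (p + k2) - fderiv g p - D k2) (s *: v).
    rewrite !blinB.
    have -> : D k1 (s *: v) = s ^+ 2 *: D u v + D k2 (s *: v).
      have DD w : D k1 w = D (s *: u) w + D k2 w by rewrite /k1 linearD.
      have DZ w : D (s *: u) w = s *: D u w by rewrite linearZ.
      by rewrite DD DZ [D u _]linearZ /= scalerA.
    by zmodl.
  have sv : `|s *: v| <= s * (`|u| + `|v|).
    by rewrite normrZ gtr0_norm// ler_wpM2l ?(ltW s0)// lerDr.
  set N := s * (`|u| + `|v|) in k1s k2s sv *.
  have N0 : 0 <= N by rewrite mulr_ge0 ?addr_ge0// ltW.
  have hh (k : U) (w : blin U V) : `|k| <= N -> `|w| <= e * `|k| -> `|w (s *: v)| <= e * N * N.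
    move=> kN wk; rewrite (le_trans (ler_blin _ _))// ler_pM//.
    by rewrite (le_trans wk)// ler_wpM2l// ltW.
  rewrite (le_trans (ler_normB _ _))//.
  have := lerD (hh _ _ k1s h1) (hh _ _ k2s h2).
  by move=> /le_trans; apply; rewrite /N le_eqVlt; apply/orP; left; apply/eqP; ring.
have := mean_value_cst ler01 hm dmK.
rewrite subr0 mulr1 /m !scale1r !scale0r !addr0 subr0.
by apply: le_trans; rewrite le_eqVlt; apply/orP; left; apply/eqP; congr (`|_|); zmodl.
Qed.

(** The second difference of [g] is symmetric in u and v, and both [D u v] and [D v u] approximate
    it divided by s^2. *)
Lemma fderiv2C (g : U -> V) (p u v : U) :
  (\forall q \near p, differentiable g q) -> differentiable (fderiv g) p ->
  fderiv (fderiv g) p u v = fderiv (fderiv g) p v u.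
Proof.
move=> dg d2g; set D := fderiv (fderiv g) p.
apply/eqP; rewrite -subr_eq0 -normr_le0; apply/ler_addgt0Pl => e e0; rewrite addr0.
set N := `|u| + `|v|; have N0 : 0 <= N by rewrite addr_ge0.
have c0 : 0 < e / (4 * N ^+ 2 + 1) by rewrite divr_gt0// ltr_wpDl// mulr_ge0// sqr_ge0.
(* Chosen so that 4 c N^2 is at most e, the total error once s^2 cancels. *)
set c := e / _ in c0.
have [d d0 gd] := diff_hasd d2g c0.
move: dg => /nbhs_normP[r /= r0 dg].
pose s := Num.min d r / (N + 1) / 2.
have dr0 : 0 < Num.min d r by rewrite lt_min d0.
have s0 : 0 < s by rewrite !divr_gt0// ltr_wpDl.
have sN : s * N < Num.min d r.
  have -> : s * N = Num.min d r * (N / (N + 1) / 2) by rewrite /s; ring.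
  rewrite gtr_pMr// -mulrA -invfM ltr_pdivrMr ?mul1r; last by rewrite mulr_gt0// ltr_wpDl.
  by lra.
have dg' k : `|k| < Num.min d r -> differentiable g (p + k).
  rewrite lt_min => /andP[_ kr]; apply: dg => /=.
  by rewrite opprD addNKr normrN.
have gd' k : `|k| < Num.min d r ->
   `|fderiv g (p + k) - fderiv g p - D k| <= c * `|k|.
  by rewrite lt_min => /andP[kd _]; exact: gd.
have sN' : s * (`|v| + `|u|) < Num.min d r by rewrite [`|v| + _]addrC.
have h1 := second_difference s0 sN dg' gd' c0.
have h2 := second_difference s0 sN' dg' gd' c0.
rewrite -/D in h1 h2.
have s2 : 0 < s ^+ 2 by rewrite exprn_gt0.
have : `|s ^+ 2 *: (D u v - D v u)| <= 4 * c * s ^+ 2 * N ^+ 2.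
  have -> : s ^+ 2 *: (D u v - D v u) =
    (g (p + s *: v + s *: u) - g (p + s *: v) - g (p + s *: u) + g p - s ^+ 2 *: D v u)
    - (g (p + s *: u + s *: v) - g (p + s *: u) - g (p + s *: v) + g p - s ^+ 2 *: D u v).
    have -> : s ^+ 2 *: (D u v - D v u) = s ^+ 2 *: D u v - s ^+ 2 *: D v u.
      exact: scalerBr.
    have -> : p + s *: v + s *: u = p + s *: u + s *: v by exact: addrAC.
    by zmodl.
  rewrite (le_trans (ler_normB _ _))// (le_trans (lerD h2 h1))//.
  by rewrite [`|v| + _]addrC -/N le_eqVlt; apply/orP; left; apply/eqP; ring.
rewrite normrZ gtr0_norm//.
have -> : 4 * c * s ^+ 2 * N ^+ 2 = s ^+ 2 * (4 * N ^+ 2 * c) by ring.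
rewrite ler_pM2l// => /le_trans; apply.
rewrite /c mulrCA ler_piMr ?(ltW e0)// ler_pdivrMr ?mul1r ?lerDl//.
by rewrite ltr_wpDl// mulr_ge0// sqr_ge0.
Qed.

End Schwarz.

(** * Permuting the arguments of iterated derivatives *)

Section MultilinearEvaluation.
Context {R : realType}.
Implicit Types U V : normedModType R.

Fixpoint mlin_ev U V n (us : seq U) : blin (mlin n U V) V :=
  if n is n'.+1 then
    blin_comp (mlin_ev V n' (behead us)) (blin_ev (mlin n' U V) (head 0 us))
  else blin_id V.

Lemma mlin_ev_le U V n (us : seq U) m : size us = n ->
  `|mlin_ev V n us m| <= `|m| * \prod_(u <- us) `|u|.
Proof.
elim: n us m => [|n IH] [|u us] m//=; first by rewrite big_nil mulr1.
move=> [sz]; rewrite big_cons mulrA (le_trans (IH us _ sz))//.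
by rewrite ler_wpM2r// ?prodr_ge0// ler_blin.
Qed.

Lemma hasd_mlin_ev U V n (S : set U) (g : U -> V) p (us : seq U) :
  diffn n.+1 S g -> S p ->
  hasd (fun q => mlin_ev V n us (fderivn n g q)) p
    (blin_comp (mlin_ev V n us) (fderivn n.+1 g p)).
Proof.
move=> gn Sp; apply: hasd_postcomp; apply: diff_hasd.
exact: (gn n p (ltnSn n)).
Qed.

(** Two kinds of permutations suffice: those fixing the first vector, by differentiating the
    identity of order n - 1, and the swap of the first two vectors, by Schwarz's theorem. *)
Lemma fderivn_perm U V n (S : set U) (g : U -> V) : open S -> diffn n S g ->
  forall p (us vs : seq U), S p -> size us = n -> perm_eq us vs ->
  mlin_ev V n us (fderivn n g p) = mlin_ev V n vs (fderivn n g p).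
Proof.
move=> oS; elim: n => [//|n IH] gn p us vs Sp szu uv.
have eq_head x (us' vs' : seq U) : size us' = n -> perm_eq us' vs' ->
    mlin_ev V n.+1 (x :: us') (fderivn n.+1 g p) =
    mlin_ev V n.+1 (x :: vs') (fderivn n.+1 g p).
  move=> sz' uv'.
  have hu := hasd_mlin_ev us' gn Sp.
  have : hasd (fun q => mlin_ev V n us' (fderivn n g q)) p
      (blin_comp (mlin_ev V n vs') (fderivn n.+1 g p)).
    apply: (hasd_ext _ (hasd_mlin_ev vs' gn Sp)).
    apply: (open_near oS) => // q Sq; apply/esym.
    exact: (IH (diffn_le (leqnSn n) gn)).
  move=> /hasd_fderiv; rewrite (hasd_fderiv hu) => E.
  exact: (congr1 (fun B : blin U V => B x) E).
case: us vs szu uv => [|x us] [|y vs]// [szu] uv.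
  by move/perm_size: uv.
have [xy|xy] := eqVneq x y.
  by rewrite -xy; apply: (eq_head x) => //; move: uv; rewrite xy perm_cons.
have yus : y \in us.
  by move: (perm_mem uv y); rewrite !inE eqxx eq_sym (negbTE xy).
case: n => [|n] in IH gn szu eq_head *; first by case: us szu yus {uv}.
(* The head [y] of the target list is brought to second place, swapped with [x], and the tail is
   then rearranged. *)
have usE := perm_to_rem yus; set z := rem y us in usE.
have szz : size z = n by move/perm_size: usE; rewrite szu => -[].
have vsE : perm_eq (x :: z) vs.
  rewrite -(perm_cons y); apply: perm_trans uv.
  have /perm_trans -> // : perm_eq [:: y, x & z] [:: x, y & z].
    by have := perm_catCA [:: y] [:: x] z => /= ->.
  by rewrite perm_cons perm_sym.
rewrite (eq_head x us (y :: z))//.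
rewrite -(eq_head y (x :: z) vs)//=; last by rewrite szz.
(* Freezing the remaining vectors [z] makes the swap the symmetry of the second derivative of
   [h]. *)
pose h q := mlin_ev V n z (fderivn n g q).
have gn1 := diffn_le (leqnSn n.+1) gn.
have hD q : S q -> hasd h q (blin_postcomp (mlin_ev V n z) (fderivn n.+1 g q)).
  exact: (hasd_mlin_ev z gn1).
have hD2 : hasd (fderiv h) p (blin_comp (blin_postcomp (mlin_ev V n z))
     (fderivn n.+2 g p)).
  apply: (@hasd_ext _ _ _ (fun q => blin_postcomp (mlin_ev V n z) (fderivn n.+1 g q))).
    by apply: (open_near oS) => // q Sq; rewrite (hasd_fderiv (hD q Sq)).
  apply: hasd_postcomp; apply: diff_hasd; exact: (gn n.+1 p).
have := @fderiv2C _ _ _ h p x y _ (hasd_diff hD2).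
rewrite (hasd_fderiv hD2); apply.
by apply: (open_near oS) => // q Sq; exact: hasd_diff (hD q Sq).
Qed.

End MultilinearEvaluation.

(** * Partial derivatives *)

Lemma open_setX {T T' : topologicalType} (A : set T) (B : set T') :
  open A -> open B -> open (A `*` B).
Proof.
rewrite !openE => oA oB [a b] [/= Aa Bb]; exists (A, B) => //.
by split; [exact: oA|exact: oB].
Qed.

Section PartialDerivatives.
Context {R : realType} {E X : normedModType R}.
Local Notation U := (E * X)%type.

(** On vectors lying in one of the two factors the derivatives of a map on E x X are mixed partial
    derivatives. *)
Definition axial (u : U) := (u.1 == 0) || (u.2 == 0).

(** Each argument is a sum of two axial vectors of no larger norm, which costs a factor 2 per
    argument. *)
Lemma axial_bound V n (m : mlin n U V) (K : R) : 0 <= K ->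
  (forall us : seq U, size us = n -> all axial us ->
     `|mlin_ev V n us m| <= K * \prod_(u <- us) `|u|) ->
  `|m| <= 2 ^+ n * K.
Proof.
elim: n m K => [|n IH] m K K0 mK.
  by have := mK [::] erefl isT; rewrite big_nil mulr1 expr0 mul1r.
have ax u : axial u -> `|m u| <= 2 ^+ n * (K * `|u|).
  move=> au; apply: IH => [|us szu aus]; first exact: mulr_ge0.
  by have := mK (u :: us); rewrite /= szu au aus big_cons mulrA; apply.
apply: blin_le => [|u]; first by rewrite mulr_ge0// exprn_ge0.
have uE : u = (u.1, 0) + (0, u.2).
  by apply: injective_projections; rewrite /= ?addr0 ?add0r.
have a1 : axial (u.1, 0) by rewrite /axial /= eqxx orbT.
have a2 : axial (0, u.2) by rewrite /axial /= eqxx.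
have n1 : `|(u.1, 0 : X)| <= `|u| by rewrite prod_norm_le /= normr0 normr_ge0 prod_norm_fst.
have n2 : `|(0 : E, u.2)| <= `|u| by rewrite prod_norm_le /= normr0 normr_ge0 prod_norm_snd.
have -> : m u = m (u.1, 0) + m (0, u.2) by rewrite [in LHS]uE linearD.
rewrite (le_trans (ler_normD _ _))// exprS mulr2n.
have c0 : 0 <= 2 ^+ n :> R by rewrite exprn_ge0.
have b1 := le_trans (ax _ a1) (ler_wpM2l c0 (ler_wpM2l K0 n1)).
have b2 := le_trans (ax _ a2) (ler_wpM2l c0 (ler_wpM2l K0 n2)).
by rewrite (le_trans (lerD b1 b2))// le_eqVlt; apply/orP; left; apply/eqP; ring.
Qed.

Fixpoint restr_snd V j : blin (mlin j U V) (mlin j X V) :=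
  if j is j'.+1 then
    blin_comp (blin_precomp (blin_inr E X)) (blin_postcomp (restr_snd V j'))
  else blin_id V.

(** The first m arguments are restricted to E and the last j to X: [partialn] differentiates in l
    last, so the outermost arguments belong to l. *)
Fixpoint restr V m j : blin (mlin (m + j) U V) (mlin m E (mlin j X V)) :=
  match m return blin (mlin (m + j) U V) (mlin m E (mlin j X V)) with
  | m'.+1 =>
    blin_comp (blin_precomp (blin_inl E X)) (blin_postcomp (restr V m' j))
  | 0 => restr_snd V j
  end.

Lemma hasd_inl (l : E) (x : X) : hasd (fun l' : E => (l', x)) l (blin_inl E X).
Proof.
move=> e e0; exists 1 => // h _.
have -> : (l + h, x) - (l, x) - blin_inl E X h = 0.
  by apply: injective_projections => /=; zmodl.
by rewrite normr0 mulr_ge0// ltW.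
Qed.

Lemma hasd_inr (l : E) (x : X) : hasd (fun x' : X => (l, x')) x (blin_inr E X).
Proof.
move=> e e0; exists 1 => // h _.
have -> : (l, x + h) - (l, x) - blin_inr E X h = 0.
  by apply: injective_projections => /=; zmodl.
by rewrite normr0 mulr_ge0// ltW.
Qed.

Section Restriction.
Context {V : normedModType R} (S : set E) (g : E -> X -> V).
Hypothesis oS : open S.
Let G (p : U) : V := g p.1 p.2.
Let SX : set U := S `*` [set: X].

Lemma fderivn_snd j l x : diffn j SX G -> S l ->
  fderivn j (g l) x = restr_snd V j (fderivn j G (l, x)).
Proof.
move=> + Sl; elim: j x => [//|j IH] x gj.
have hD : hasd (fderivn j (g l)) x
    (blin_comp (restr_snd V j) (blin_comp (fderivn j.+1 G (l, x)) (blin_inr E X))).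
  have -> : fderivn j (g l) = fun x' => restr_snd V j (fderivn j G (l, x')).
    by apply/funext => x'; rewrite IH//; exact: diffn_le gj.
  apply: hasd_postcomp; apply: (hasd_comp _ (hasd_inr l x)).
  by apply: diff_hasd; exact: (gj j (l, x)).
by rewrite [LHS](hasd_fderiv hD); apply/blin_eqP.
Qed.

Lemma partialnE m j l x : diffn (m + j) SX G -> S l ->
  partialn m j g l x = restr V m j (fderivn (m + j) G (l, x)).
Proof.
rewrite /partialn; elim: m l => [|m IH] l gm Sl; first exact: fderivn_snd.
have hD : hasd (fderivn m (fun l' => fderivn j (g l') x)) l
    (blin_comp (restr V m j) (blin_comp (fderivn (m + j).+1 G (l, x)) (blin_inl E X))).
  apply: (@hasd_ext _ _ _ (fun l' => restr V m j (fderivn (m + j) G (l', x)))).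
    apply: (open_near oS) => // q Sq; rewrite IH//.
    by apply: diffn_le gm; rewrite addSn.
  apply: hasd_postcomp; apply: (hasd_comp _ (hasd_inl l x)).
  by apply: diff_hasd; exact: (gm (m + j)%N (l, x)).
by rewrite [LHS](hasd_fderiv hD); apply/blin_eqP.
Qed.

End Restriction.

Lemma mlin_ev_restr V m j (hs : seq E) (vs : seq X) (M : mlin (m + j) U V) :
  size hs = m -> size vs = j ->
  mlin_ev V j vs (mlin_ev (mlin j X V) m hs (restr V m j M)) =
  mlin_ev V (m + j) (map (blin_inl E X) hs ++ map (blin_inr E X) vs) M.
Proof.
move=> szh szv; elim: m hs M szh => [|m IH] [|h hs]//= M => [_|[szh]].
  by elim: j vs M szv => [|j IH] [|v vs]//= M [szv]; rewrite -IH.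
by rewrite -IH.
Qed.

(** Symmetry is needed because [partialn] controls only the arrangement with the E-vectors in front:
    axial arguments are permuted into it, and [axial_bound] does the rest. *)
Lemma fderivn_le_partialn {V : normedModType R} (S : set E) (g : E -> X -> V)
    (n : nat) (K : R) l x : open S ->
  diffn n (S `*` [set: X]) (fun p : U => g p.1 p.2) -> S l -> 0 <= K ->
  (forall j, (j <= n)%N -> `|partialn (n - j) j g l x| <= K) ->
  `|fderivn n (fun p : U => g p.1 p.2) (l, x)| <= 2 ^+ n * K.
Proof.
move=> oS gn Sl K0 gK; apply: axial_bound => // us szu aus.
have oSX : open (S `*` [set: X]) by by apply: open_setX => //; exact: openT.
have Slx : (S `*` [set: X]) (l, x) by [].
(* Zero vectors count as E-vectors, so each remaining axial vector has a vanishing first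
   component. *)
set A := [seq u <- us | u.2 == 0]; set B := [seq u <- us | u.2 != 0].
have usE : perm_eq us (A ++ B) by rewrite perm_sym perm_filterC.
have AE : A = map (blin_inl E X) (map fst A).
  rewrite -map_comp -[LHS]map_id; apply/eq_in_map => u.
  rewrite mem_filter => /andP[/eqP u2 _] /=.
  by apply: injective_projections.
have BE : B = map (blin_inr E X) (map snd B).
  rewrite -map_comp -[LHS]map_id; apply/eq_in_map => u.
  rewrite mem_filter => /andP[u2 /(allP aus)]; rewrite /axial (negbTE u2) orbF.
  by move=> /eqP u1 /=; apply: injective_projections.
have szAB : size us = (size A + size B)%N by rewrite (perm_size usE) size_cat.
rewrite (fderivn_perm oSX gn Slx szu usE) (perm_big _ usE)/= {usE}.
move: szAB; rewrite szu AE BE !size_map; set hs := map fst A; set vs := map snd B.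
rewrite -[size A](size_map fst) -[size B](size_map snd) -/hs -/vs => nE.
move: gn gK; rewrite {szu}nE => gn gK.
rewrite -mlin_ev_restr// -(@partialnE _ S g oS (size hs) (size vs) l x gn Sl).
rewrite (le_trans (mlin_ev_le _ _))// big_cat /= mulrA !big_map.
apply: ler_pM; rewrite ?prodr_ge0//; last first.
  apply: ler_prod => u _; rewrite normr_ge0/=.
  by rewrite prod_normE1 /= normr0 le_max lexx orbT.
rewrite (le_trans (mlin_ev_le _ _))//.
apply: ler_pM; rewrite ?prodr_ge0//.
  by have := gK (size vs) (leq_addl _ _); rewrite addnK.
rewrite /hs big_map; apply: ler_prod => u _; rewrite normr_ge0/=.
by rewrite prod_normE1 /= normr0 le_max lexx.
Qed.

End PartialDerivatives.

(** * Primitives of vector-valued curves *)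

Section Primitives.
Context {R : realType}.

Lemma hasdc_affine {V : normedModType R} (u : R -> V) (a b t : R) v :
  hasdc u (a * t + b) v -> hasdc (fun s => u (a * s + b)) t (a *: v).
Proof.
move=> hu e e0.
have a1 : 0 < `|a| + 1 by rewrite ltr_wpDl.
have [d d0 ud] := hu _ (divr_gt0 e0 a1).
exists (d / (`|a| + 1)); first exact: divr_gt0.
move=> h; rewrite ltr_pdivlMr// => hd.
have ah : `|a * h| <= `|h| * (`|a| + 1).
  by rewrite normrM mulrC ler_wpM2l// lerDl.
have := ud _ (le_lt_trans ah hd).
rewrite scalerA [h * a]mulrC (_ : a * (t + h) + b = a * t + b + a * h); last by ring.
move=> /le_trans; apply.
have := ler_wpM2l (ltW (divr_gt0 e0 a1)) ah; move=> /le_trans; apply.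
by rewrite mulrCA divfK ?gt_eqF// mulrC.
Qed.

Definition clamp (a b s : R) : R := Num.max a (Num.min s b).

Lemma clamp_bound a b s : a <= b -> a <= clamp a b s <= b.
Proof.
by move=> ab; rewrite /clamp le_max lexx/= ge_max ab ge_min lexx orbT.
Qed.

Lemma clamp_id a b s : a <= s <= b -> clamp a b s = s.
Proof. by move=> /andP[a1 b1]; rewrite /clamp min_l// max_r. Qed.

Definition clamp01_prim (s : R) : R :=
  if s <= 0 then 0 else if s <= 1 then s ^+ 2 / 2 else s - 1 / 2.

Lemma clamp01E s : clamp 0 1 s = if s <= 0 then 0 else if s <= 1 then s else 1.
Proof.
rewrite /clamp; have [s0|s0] := leP s 0.
  by rewrite min_l ?max_l// (le_trans s0).
have [s1|s1] := leP s 1; first by rewrite max_r// ltW.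
by rewrite max_r.
Qed.

(** The clamp is 1-Lipschitz, so the first order error of its primitive is at most h^2. *)
Lemma hasdc_clamp01 s : hasdc clamp01_prim s (clamp 0 1 s).
Proof.
move=> e e0; exists e => // h he.
suff : `|clamp01_prim (s + h) - clamp01_prim s - h * clamp 0 1 s| <= h ^+ 2.
  move/le_trans; apply.
  by rewrite -real_normK ?num_real// expr2 ler_wpM2r// ltW.
rewrite clamp01E /clamp01_prim ler_norml.
have [s0|s0] := leP s 0; have [s1|s1] := leP s 1;
  have [h0|h0] := leP (s + h) 0; have [h1|h1] := leP (s + h) 1;
  apply/andP; split; nra.
Qed.

Definition hasprim {V : normedModType R} (g : R -> V) :=
  exists u : R -> V, forall t, hasdc u t (g t).

Lemma hasprim_pw {V : normedModType R} (g : R -> V) (a eta : R) N (v : V) : 0 < eta ->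
  hasprim g -> hasprim (fun t => g t + clamp 0 1 ((t - a) / eta - N%:R) *: v).
Proof.
move=> eta0 [u hu].
exists (fun t => u t + blin_scale v (eta * clamp01_prim (eta^-1 * t + (- a / eta - N%:R)))).
move=> t; apply: hasdcD => //.
have E : clamp 0 1 ((t - a) / eta - N%:R) *: v =
    blin_scale v (eta *: (eta^-1 *: clamp 0 1 (eta^-1 * t + (- a / eta - N%:R)))).
  rewrite /= [eta *: _]mulrA mulfV ?gt_eqF// mul1r; congr (clamp _ _ _ *: v).
  by ring.
rewrite E; apply: hasdc_postcomp; apply: hasdcZ.
by apply: hasdc_affine; exact: hasdc_clamp01.
Qed.

(** Piecewise linear interpolation of [g] at the nodes a + i eta, written as [g a] plus one ramp per
    step; each ramp has an explicit primitive. *)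
Fixpoint interp {V : normedModType R} (g : R -> V) (a eta : R) (N : nat) (t : R) : V :=
  if N is N'.+1 then
    interp g a eta N' t + clamp 0 1 ((t - a) / eta - N'%:R)
      *: (g (a + N%:R * eta) - g (a + N'%:R * eta))
  else g a.

Lemma hasprim_interp {V : normedModType R} (g : R -> V) a eta N : 0 < eta ->
  hasprim (interp g a eta N).
Proof.
move=> eta0; elim: N => [|N IH] /=; last exact: hasprim_pw.
by exists (fun t => t *: g a) => t; exact: hasdc_scale.
Qed.

Lemma interp_right {V : normedModType R} (g : R -> V) a eta N t : 0 < eta ->
  a + N%:R * eta <= t -> interp g a eta N t = g (a + N%:R * eta).
Proof.
move=> eta0; elim: N => [|N IH] Nt /=; first by rewrite mul0r addr0.
have Nt' : (N.+1)%:R <= (t - a) / eta by rewrite ler_pdivlMr//; lra.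
rewrite IH; last first.
  by apply: le_trans Nt; rewrite lerD2l ler_wpM2r ?(ltW eta0)// ler_nat.
have -> : clamp 0 1 ((t - a) / eta - N%:R) = 1.
  by rewrite /clamp min_r ?max_r// lerBrDl natr1.
by rewrite scale1r addrC subrK.
Qed.

Lemma interp_left {V : normedModType R} (g : R -> V) a eta N t : 0 < eta ->
  t <= a -> interp g a eta N t = g a.
Proof.
move=> eta0 ta; elim: N => [//|N /= ->].
have -> : clamp 0 1 ((t - a) / eta - N%:R) = 0.
  have h0 : (t - a) / eta <= 0 by rewrite ler_pdivrMr// mul0r subr_le0.
  have hN : 0 <= N%:R :> R by [].
  by rewrite clamp01E ifT//; lra.
by rewrite scale0r addr0.
Qed.

Lemma interp_close {V : normedModType R} (g : R -> V) a eta N e t : 0 < eta ->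
  0 <= e ->
  (forall i s, (i < N)%N -> a + i%:R * eta <= s <= a + i.+1%:R * eta ->
     `|g s - g (a + i%:R * eta)| <= e) ->
  a <= t <= a + N%:R * eta -> `|interp g a eta N t - g t| <= e + e.
Proof.
move=> eta0 e0; elim: N => [|N IH] ge /andP[at_ tN].
  have -> : t = a by apply/eqP; rewrite eq_le at_ andbT; move: tN; rewrite mul0r addr0.
  by rewrite /= subrr normr0 addr_ge0.
have ge' i s : (i < N)%N -> a + i%:R * eta <= s <= a + i.+1%:R * eta ->
    `|g s - g (a + i%:R * eta)| <= e.
  by move=> iN; apply: ge; exact: ltnW.
have N0 : a + N%:R * eta <= a + N.+1%:R * eta.
  by rewrite lerD2l ler_wpM2r ?(ltW eta0)// ler_nat.
have [tN'|Nt] := leP t (a + N%:R * eta).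
  have tN2 : (t - a) / eta <= N%:R by rewrite ler_pdivrMr// lerBlDl.
  rewrite /= clamp01E ifT ?subr_le0// scale0r addr0.
  by apply: IH => //; rewrite at_.
rewrite /= interp_right ?(ltW Nt)//.
have -> : g (a + N%:R * eta) + clamp 0 1 ((t - a) / eta - N%:R) *:
    (g (a + N.+1%:R * eta) - g (a + N%:R * eta)) - g t =
   clamp 0 1 ((t - a) / eta - N%:R) *:
    (g (a + N.+1%:R * eta) - g (a + N%:R * eta)) - (g t - g (a + N%:R * eta)).
  by zmodl.
rewrite (le_trans (ler_normB _ _))// lerD//; last by apply: ge => //; rewrite ltW.
have /andP[c0 c1] := @clamp_bound 0 1 ((t - a) / eta - N%:R) ler01.
rewrite normrZ ger0_norm// (le_trans (ler_piMl _ c1))//.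
by apply: ge => //; rewrite lexx andbT.
Qed.

(** Real induction on the right end of the segment: near t0 continuity handles pairs of points close
    to t0, and a d below half the local radius leaves no mixed pairs. *)
Lemma unif_cont_segment {V : normedModType R} (g : R -> V) (a b e : R) :
  continuous g -> a <= b -> 0 < e ->
  exists2 d : R, 0 < d & forall s t, a <= s <= b -> a <= t <= b ->
    `|s - t| < d -> `|g s - g t| <= e.
Proof.
move=> cg ab e0.
apply: (@real_induction _ (fun c => exists2 d : R, 0 < d & forall s t,
   a <= s <= c -> a <= t <= c -> `|s - t| < d -> `|g s - g t| <= e) a b ab).
  exists 1 => // s t; rewrite -!eq_le => /eqP<- /eqP<- _.
  by rewrite subrr normr0 ltW.
move=> t0 t0ab.
have e2 : 0 < e / 2 by rewrite divr_gt0.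
have /cvgrPdist_le/(_ _ e2)/nbhs_normP[d /= d0 gd] := cg t0.
have near s t : `|s - t0| < d -> `|t - t0| < d -> `|g s - g t| <= e.
  move=> sd td; have h1 := gd s; have h2 := gd t.
  rewrite /= distrC in h1; rewrite /= distrC in h2.
  rewrite (_ : g s - g t = (g t0 - g t) - (g t0 - g s)); last by zmodl.
  by rewrite (le_trans (ler_normB _ _))// [e]splitr lerD ?h1 ?h2.
have ext c c' : c <= c' -> `|c - t0| < d / 2 -> `|c' - t0| < d / 2 ->
   (exists2 d : R, 0 < d & forall s t,
     a <= s <= c -> a <= t <= c -> `|s - t| < d -> `|g s - g t| <= e) ->
   exists2 d : R, 0 < d & forall s t,
     a <= s <= c' -> a <= t <= c' -> `|s - t| < d -> `|g s - g t| <= e.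
  move=> cc' cd cd' [r r0 gr]; exists (Num.min r (d / 2)).
    by rewrite lt_min r0 divr_gt0.
  move=> s t /andP[as_ sc] /andP[at_ tc]; rewrite lt_min => /andP[st1 st2].
  move: cd cd'; rewrite !ltr_norml => /andP[? ?] /andP[? ?].
  have [sc'|cs] := leP s c; have [tc'|ct] := leP t c.
  - by apply: gr => //; rewrite ?as_ ?at_.
  - by move: st2; rewrite ltr_norml => /andP[? ?]; apply: near;
      rewrite ltr_norml; apply/andP; split; lra.
  - by move: st2; rewrite ltr_norml => /andP[? ?]; apply: near;
      rewrite ltr_norml; apply/andP; split; lra.
  - by apply: near; rewrite ltr_norml; apply/andP; split; lra.
have t0d : `|t0 - t0| < d / 2 by rewrite subrr normr0 divr_gt0.
exists (d / 2); first exact: divr_gt0.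
by move=> s sab sd; split=> st; apply: ext.
Qed.

Section Complete.
Context {V : completeNormedModType R}.

(** Primitives normalised to vanish at 0 differ by maps whose Lipschitz constants tend to 0, so they
    converge pointwise, and their difference quotients converge uniformly. *)
Lemma hasprim_lim (g : R -> V) :
  (forall e : R, 0 < e -> exists2 h : R -> V, hasprim h & forall t, `|h t - g t| <= e) ->
  hasprim g.
Proof.
move=> gh.
have e_gt0 n : 0 < n.+1%:R^-1 :> R by rewrite invr_gt0.
have /choice[h hP] : forall n, exists h : R -> V,
    hasprim h /\ forall t, `|h t - g t| <= n.+1%:R^-1.
  by move=> n; have [h ? ?] := gh _ (e_gt0 n); exists h.
have /choice[u uP] : forall n, exists u : R -> V, u 0 = 0 /\ forall t, hasdc u t (h n t).
  move=> n; have [[u uh] _] := hP n; exists (fun t => u t - u 0); split.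
    by rewrite subrr.
  by move=> t; rewrite -[h n t]subr0; apply: hasdcB => //; exact: hasdc_cst.
have hh n m t : `|h n t - h m t| <= n.+1%:R^-1 + m.+1%:R^-1.
  rewrite (_ : _ - _ = (h n t - g t) - (h m t - g t)); last by zmodl.
  by rewrite (le_trans (ler_normB _ _))// lerD// (proj2 (hP _)).
have umn n m s t : `|(u n t - u m t) - (u n s - u m s)| <=
    (n.+1%:R^-1 + m.+1%:R^-1) * `|t - s|.
  wlog st : s t / s <= t => [W|].
    have [/W//|/ltW ts] := leP s t.
    by rewrite distrC [`|t - s|]distrC; exact: W.
  rewrite [`|t - s|]ger0_norm ?subr_ge0//.
  apply: (@mean_value_cst _ _ (fun r => u n r - u m r) (fun r => h n r - h m r)) => //.
  by move=> r _; apply: hasdcB; apply: (proj2 (uP _)).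
have normE n : `|0 - n.+1%:R^-1| = n.+1%:R^-1 :> R by rewrite sub0r normrN gtr0_norm.
have inv0 : (fun n => n.+1%:R^-1 : R) @ \oo --> 0 by exact: cvg_harmonic.
have ucvg t : cvgn (u ^~ t).
  apply/cauchy_cvgP/cauchy_exP => e e0.
  have c0 : 0 < e / (`|t| + 1) / 2 by rewrite !divr_gt0// ltr_wpDl.
  have /cvgrPdist_lt/(_ _ c0)[n0 _ n0P] := inv0.
  exists (u n0 t); rewrite -ball_normE; exists n0 => // n /= nn0.
  have := umn n0 n 0 t; rewrite !(proj1 (uP _)) !subr0 => /le_lt_trans; apply.
  have h1 := n0P n0 (leqnn _); have h2 := n0P n nn0.
  rewrite /= normE in h1; rewrite /= normE in h2.
  have t1 : 0 < `|t| + 1 by rewrite ltr_wpDl.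
  apply: (@le_lt_trans _ _ ((n0.+1%:R^-1 + n.+1%:R^-1) * (`|t| + 1))).
    by rewrite ler_wpM2l ?lerDl ?addr_ge0.
  by rewrite -ltr_pdivlMr// [ltRHS]splitr; exact: ltrD.
pose w t := limn (u ^~ t).
have wu n s t : `|(w t - w s) - (u n t - u n s)| <= n.+1%:R^-1 * `|t - s|.
  have cv : (fun m => `|(u m t - u m s) - (u n t - u n s)|) @ \oo -->
      `|(w t - w s) - (u n t - u n s)|.
    apply: cvg_norm; apply: cvgB; last exact: cvg_cst.
    by apply: cvgB; exact: ucvg.
  have cv2 : (fun m => (m.+1%:R^-1 + n.+1%:R^-1) * `|t - s|) @ \oo -->
      (0 + n.+1%:R^-1) * `|t - s|.
    by apply: cvgMl; apply: cvgD => //; exact: cvg_cst.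
  rewrite -[n.+1%:R^-1]add0r; apply: (ler_cvg_to cv cv2).
  apply: nearW => m /=.
  rewrite (_ : u m t - u m s - (u n t - u n s) =
    u m t - u n t - (u m s - u n s)); last first.
    by zmodl.
  exact: umn.
exists w => t e e0.
have e3 : 0 < e / 3 by rewrite divr_gt0.
have /cvgrPdist_lt/(_ _ e3)[n0 _ /(_ n0 (leqnn _))] := inv0.
rewrite normE => n0e.
have [d d0 ud] := proj2 (uP n0) t _ e3.
exists d => // k kd; have k0 := normr_ge0 k.
have -> : w (t + k) - w t - k *: g t =
   ((w (t + k) - w t) - (u n0 (t + k) - u n0 t)) +
   (u n0 (t + k) - u n0 t - k *: h n0 t) + k *: (h n0 t - g t).
  have -> : k *: (h n0 t - g t) = k *: h n0 t - k *: g t by exact: scalerBr.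
  by zmodl.
have h1 := wu n0 t (t + k); have h2 := ud k kd; have h3 := proj2 (hP n0) t.
rewrite (le_trans (ler_normD _ _))//.
have h4 : `|k *: (h n0 t - g t)| <= `|k| * n0.+1%:R^-1 by rewrite normrZ ler_wpM2l.
have h5 := le_trans (ler_normD _ _) (lerD h1 h2).
apply: (le_trans (lerD h5 h4)).
have h6 : n0.+1%:R^-1 * `|k| <= e / 3 * `|k| by rewrite ler_wpM2r// ltW.
have -> : e * `|k| = e / 3 * `|k| + e / 3 * `|k| + e / 3 * `|k| by field.
rewrite [`|k| * _]mulrC (_ : `|t + k - t| = `|k|); last by congr (`|_|); ring.
by rewrite !lerD.
Qed.

(** Freezing [g] outside [a, b] makes interpolation with finitely many nodes uniformly close on the
    whole line. *)
Lemma hasprim_clamp (g : R -> V) (a b : R) : a < b -> continuous g ->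
  hasprim (fun t => g (clamp a b t)).
Proof.
move=> ab cg; apply: hasprim_lim => e e0.
have e2 : 0 < e / 2 by rewrite divr_gt0.
have [d d0 gd] := unif_cont_segment cg (ltW ab) e2.
have ba : 0 < b - a by rewrite subr_gt0.
pose N := (Num.truncn ((b - a) / d)).+1.
have N0 : 0 < N%:R :> R by rewrite ltr0n.
have Nd : (b - a) / d < N%:R by exact: truncnS_gt.
pose eta := (b - a) / N%:R; have eta0 : 0 < eta by rewrite divr_gt0.
have etad : eta < d.
  by rewrite /eta ltr_pdivrMr// mulrC -ltr_pdivrMr.
have NE : a + N%:R * eta = b by rewrite /eta mulrCA mulfV ?gt_eqF// mulr1; ring.
exists (interp g a eta N); first exact: hasprim_interp.
have ge i s : (i < N)%N -> a + i%:R * eta <= s <= a + i.+1%:R * eta ->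
     `|g s - g (a + i%:R * eta)| <= e / 2.
  move=> iN /andP[s1 s2].
  have i0 : 0 <= i%:R * eta by rewrite mulr_ge0// ltW.
  have iN' : i.+1%:R * eta <= N%:R * eta by rewrite ler_wpM2r ?(ltW eta0)// ler_nat.
  have iS : i.+1%:R * eta = i%:R * eta + eta by rewrite -natr1 mulrDl mul1r.
  apply: gd; [by apply/andP; split; lra|by apply/andP; split; lra|].
  by rewrite ger0_norm ?subr_ge0//; lra.
move=> t; rewrite [e]splitr.
have [at_|ta] := leP a t; last first.
  rewrite interp_left ?(ltW ta)// /clamp min_l ?max_l ?(ltW ta)//; last by lra.
  by rewrite subrr normr0 addr_ge0// ltW.
have [tb|bt] := leP t b.
  by rewrite clamp_id ?at_// interp_close ?NE ?at_ ?(ltW e2).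
rewrite interp_right ?NE ?(ltW bt)// /clamp min_r ?(ltW bt)// max_r ?(ltW ab)//.
by rewrite subrr normr0 addr_ge0// ltW.
Qed.

(** Primitives take the place of vector-valued integrals in Green's operator. Those obtained on the
    segments [-n - 1, n + 1] agree on overlaps, since they vanish at 0 and have the same
    derivative. *)
Lemma continuous_hasprim (g : R -> V) : continuous g -> hasprim g.
Proof.
move=> cg.
have /choice[u uP] : forall n : nat, exists u : R -> V, u 0 = 0 /\
    forall t, `|t| <= n.+1%:R -> hasdc u t (g t).
  move=> n; have n0 : - n.+1%:R < n.+1%:R :> R by rewrite gtrN.
  have [u uh] := hasprim_clamp n0 cg; exists (fun t => u t - u 0).
  split=> [|t]; first by rewrite subrr.
  rewrite ler_norml => tn; rewrite -[g t]subr0; apply: hasdcB; last exact: hasdc_cst.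
  by have := uh t; rewrite clamp_id.
have uE n m t : `|t| <= n.+1%:R -> `|t| <= m.+1%:R -> u n t = u m t.
  move=> tn tm; apply/eqP; rewrite -subr_eq0 -normr_le0.
  have hd r : `|r| <= `|t| -> hasdc (fun s => u n s - u m s) r 0.
    move=> rt; rewrite -(subrr (g r)).
    by apply: hasdcB; apply: (proj2 (uP _)); exact: le_trans rt _.
  have [t0|t0] := leP 0 t.
    have := @mean_value_cst _ _ (fun s => u n s - u m s) (fun=> 0) 0 0 t t0.
    rewrite !(proj1 (uP _)) !subr0 mul0r normr0; apply=> // r /andP[r0 rt].
    by apply: hd; rewrite !ger0_norm.
  have := @mean_value_cst _ _ (fun s => u n s - u m s) (fun=> 0) 0 t 0 (ltW t0).
  rewrite !(proj1 (uP _)) subr0 sub0r normrN mul0r normr0; apply=> // r /andP[tr r0].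
  by apply: hd; rewrite !ler0_norm ?(ltW t0)// lerN2.
pose N (t : R) := Num.truncn `|t|.
have NP t : `|t| <= (N t).+1%:R by rewrite ltW// truncnS_gt.
exists (fun t => u (N t) t) => t.
(* One segment further than [t] requires, so that it contains all points within distance 1 of
   [t]. *)
pose m := (N t).+1.
have tm : `|t| + 1 <= m.+1%:R by rewrite -natr1 lerD2r.
have : hasdc (u m) t (g t).
  by apply: (proj2 (uP m)); rewrite (le_trans _ tm)// lerDl.
move=> hm e e0; have [d d0 ud] := hm e e0.
exists (Num.min d 1); first by rewrite lt_min d0 ltr01.
move=> k; rewrite lt_min => /andP[kd k1].
rewrite (uE _ m)//; last first.
  by rewrite (le_trans (ler_normD _ _))// (le_trans _ tm)// lerD2l ltW.
by rewrite (uE _ m t)//; [exact: ud|rewrite (le_trans _ tm)// lerDl].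
Qed.

End Complete.
End Primitives.

(** * Evolution families *)

Section Continuity.
Context {R : realType}.

Lemma mean_value_sym {V : normedModType R} (u du : R -> V) (K a b : R) :
  (forall t, Num.min a b <= t <= Num.max a b -> hasdc u t (du t)) ->
  (forall t, Num.min a b <= t <= Num.max a b -> `|du t| <= K) ->
  `|u b - u a| <= K * `|b - a|.
Proof.
have [ab|/ltW ba] := leP a b => hu uK.
  by rewrite (ger0_norm (_ : 0 <= b - a)) ?subr_ge0//; exact: mean_value_cst hu uK.
rewrite distrC [`|b - a|]distrC (ger0_norm (_ : 0 <= a - b)) ?subr_ge0//.
exact: mean_value_cst hu uK.
Qed.

Lemma bilin_continuous {T : topologicalType} {V1 V2 W : normedModType R}
    (B : blin V1 (blin V2 W)) (f : T -> V1) (g : T -> V2) (t : T) :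
  {for t, continuous f} -> {for t, continuous g} ->
  {for t, continuous (fun s => B (f s) (g s))}.
Proof.
move=> cf cg.
have hB := hasd_bilin B (hasd_blin (blin_fst V1 V2) (f t, g t))
                        (hasd_blin (blin_snd V1 V2) (f t, g t)).
exact: (@cvg_comp _ _ _ (fun s => (f s, g s)) _ _ _ _ (cvg_pair cf cg) (hasd_cvg hB)).
Qed.

Lemma blin_app_continuous {T : topologicalType} {V W : normedModType R}
    (B : T -> blin V W) (u : T -> V) (t : T) :
  {for t, continuous B} -> {for t, continuous u} ->
  {for t, continuous (fun s => B s (u s))}.
Proof.
move=> cB cu.
exact: (@bilin_continuous _ _ _ _ (blin_id (blin V W)) B u t cB cu).
Qed.

Lemma blin_comp_continuous {T : topologicalType} {U V W : normedModType R}
    (B : T -> blin V W) (C : T -> blin U V) (t : T) :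
  {for t, continuous B} -> {for t, continuous C} ->
  {for t, continuous (fun s => blin_comp (B s) (C s))}.
Proof.
move=> cB cC.
exact: (@bilin_continuous _ _ _ _ (blin_compL U V W) B C t cB cC).
Qed.

Lemma hasdc_continuous {V : normedModType R} (u : R -> V) t v :
  hasdc u t v -> {for t, continuous u}.
Proof. move=> hu; exact: (@hasd_cvg _ _ _ u t (blin_scale v) hu). Qed.

End Continuity.

(** * Bounding curves by Lebesgue integrals of their speed *)

Section VectorIntegral.
Context {R : realType}.
Notation mu := (@lebesgue_measure R).

Lemma integral_prim (p f : R -> R) (a b : R) : a < b -> continuous f ->
  (forall t, hasdc p t (f t)) ->
  (\int[mu]_(s in `[a, b]) (f s)%:E = (p b - p a)%:E)%E.
Proof.
move=> ab cf pf; rewrite EFinB.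
have pd t : derivable p t 1 by have /hasdcP[] := pf t.
have pc t : {for t, continuous p} by apply: hasdc_continuous (pf t).
apply: continuous_FTC2 => //.
- exact: continuous_subspaceT.
- split.
  + by move=> t _; exact: pd.
  + exact: cvg_at_right_filter (pc a).
  + exact: cvg_at_left_filter (pc b).
- by move=> t _; rewrite derive1E; have /hasdcP[_ ->] := pf t.
Qed.

Lemma norm_le_integral {V : normedModType R} (u du : R -> V) (a b : R) :
  a <= b -> continuous du -> (forall t, hasdc u t (du t)) ->
  (`|u b - u a|%:E <= \int[mu]_(s in `[a, b]) `|du s|%:E)%E.
Proof.
move=> ab cdu hu.
have cn : continuous (fun s => `|du s|) by move=> s; apply: cvg_norm; exact: cdu.
have [p hp] := @continuous_hasprim R R _ cn.
move: ab; rewrite le_eqVlt => /predU1P[->|ab].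
  by rewrite subrr normr0; apply: integral_ge0 => s _; rewrite lee_fin.
rewrite (integral_prim ab cn hp) lee_fin.
exact: (mean_value_le (ltW ab) (fun t _ => hu t) (fun t _ => hp t)).
Qed.

(* [p] is a primitive of [|du|]; along [tau] it is monotone and bounded, so
   [u] is Cauchy along [tau]. *)
Lemma prim_cvg {V : completeNormedModType R} (u du : R -> V) (p : R -> R)
    (tau : nat -> R) (C : R) :
  (forall t, hasdc u t (du t)) -> (forall t, hasdc p t `|du t|) ->
  (forall n m, (n <= m)%N -> tau n <= tau m) \/
  (forall n m, (n <= m)%N -> tau m <= tau n) ->
  (forall n, `|p (tau n)| <= C) -> cvgn (u \o tau).
Proof.
move=> hu hp tauM pC.
have pM a b : a <= b -> p a <= p b.
  move=> ab; rewrite -subr_ge0.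
  have := @mean_value_le _ R (fun=> 0) (fun=> 0) p (fun t => `|du t|) a b ab.
  rewrite subrr normr0; apply=> t _; [exact: hasdc_cst|exact: hp|].
  exact: normr_ge0.
have up a b : `|u a - u b| <= `|p a - p b|.
  wlog ab : a b / b <= a => [W|].
    by have [/W//|/ltW/W] := leP b a; rewrite distrC [`|p _ - _|]distrC.
  rewrite [`|p a - _|]ger0_norm ?subr_ge0 ?pM//.
  exact: (mean_value_le ab (fun t _ => hu t) (fun t _ => hp t)).
have pcvg : cvgn (p \o tau).
  case: tauM => tauM.
  - apply: nondecreasing_is_cvgn; first by move=> n m nm; apply: pM; exact: tauM.
    by exists C => _ [n _ <-]; exact: le_trans (ler_norm _) (pC n).
  - apply: nonincreasing_is_cvgn; first by move=> n m nm; apply: pM; exact: tauM.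
    exists (- C) => _ [n _ <-].
    by have := pC n; rewrite ler_norml => /andP[].
apply/cauchy_cvgP/cauchy_ballP => e e0.
have /cvg_cauchy/cauchy_ballP/(_ e e0) := pcvg; rewrite !near_map2.
apply: filterS => -[a b] /=; rewrite -!ball_normE /=.
exact: le_lt_trans (up _ _).
Qed.

End VectorIntegral.

(** * Norm regularity of the evolution family and variation of constants *)

Section Evolution.
Context {R : realType} {X : completeNormedModType R}.
Context (A : R -> blin X X) (T : R -> R -> blin X X).
Hypotheses (contA : continuous A) (TA : evolution_family A T).

Lemma evol_solution s v t : hasdc (fun r => T r s v) t (A t (T t s v)).
Proof. by have [_ /(_ (fun _ => erefl))[h _]] := @TA s v (T^~ s ^~ v); apply/hasdcP. Qed.

Lemma evol_id s v : T s s v = v.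
Proof. by have [_ /(_ (fun _ => erefl))[]] := @TA s v (T^~ s ^~ v). Qed.

Lemma evol_unique (x : R -> X) s t :
  (forall r, hasdc x r (A r (x r))) -> x t = T t s (x s).
Proof.
by move=> hx; have [h _] := @TA s (x s) x; apply: h; split=> // r; apply/hasdcP.
Qed.

Lemma evol_comp t s r v : T t s (T s r v) = T t r v.
Proof.
by rewrite [RHS](@evol_unique (fun t => T t r v) s)// => q; exact: evol_solution.
Qed.

(** [evolution_family] speaks of single vectors; the bound uniform in the vector comes from the
    point [r0] where |T(r, s) v| is maximal between s and s': there |x r0| is at most |v| + 1/2 |x
    r0|. *)
Lemma evol_near t0 : exists2 a : R, 0 < a & exists2 d : R, 0 < d &
  forall s s', `|s - t0| < d -> `|s' - t0| < d ->
    `|T s' s - blin_id X| <= a * `|s' - s|.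
Proof.
have /cvgrPdist_le/(_ 1 ltr01)/nbhs_normP[d1 /= d10 Ad] := @contA t0.
set a := `|A t0| + 1; have a0 : 0 < a by rewrite ltr_wpDl.
exists (2 * a); first by rewrite mulr_gt0.
(* Two points within 1/(4a) of t0 satisfy a |s' - s| <= 1/2, which makes the maximum at most 2
   |v|. *)
exists (Num.min d1 (1 / (4 * a))).
  by rewrite lt_min d10 divr_gt0// mulr_gt0.
move=> s s'; rewrite !lt_min => /andP[sd sa] /andP[s'd s'a].
have As r : Num.min s s' <= r <= Num.max s s' -> `|A r| <= a.
  rewrite ge_min le_max => rs.
  have rd : `|t0 - r| < d1.
    move: sd s'd rs; rewrite !ltr_norml => /andP[? ?] /andP[? ?].
    by move=> /andP[/orP[] ? /orP[] ?]; apply/andP; split; lra.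
  have := Ad r rd => /= h; rewrite -[A r](subKr (A t0)).
  by rewrite (le_trans (ler_normB _ _))// lerD.
have ss : a * `|s' - s| <= 1 / 2.
  have : `|s' - s| <= 1 / (4 * a) + 1 / (4 * a).
    rewrite (_ : s' - s = (s' - t0) - (s - t0)); last by ring.
    by rewrite (le_trans (ler_normB _ _))// lerD// ltW.
  rewrite -(ler_pM2l a0) => /le_trans; apply.
  by rewrite le_eqVlt; apply/orP; left; apply/eqP; field; rewrite gt_eqF.
apply: blin_le => [|v]; first by rewrite mulr_ge0// mulr_ge0// ltW.
rewrite blinB /=.
pose x r := T r s v.
have xc : continuous (fun r => `|x r|).
  by move=> r; apply: cvg_norm; apply: hasdc_continuous (evol_solution s v r).
have mM : Num.min s s' <= Num.max s s' by rewrite ge_min le_max lexx.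
have [r0 r0ss xmax] := EVT_max mM (continuous_subspaceT xc).
rewrite in_itv/= in r0ss.
have xle r : Num.min s s' <= r <= Num.max s s' -> `|x r - v| <= a * `|x r0| * `|r - s|.
  move=> rss; rewrite -[v in _ - v](evol_id s).
  have sub q : Num.min s r <= q <= Num.max s r -> Num.min s s' <= q <= Num.max s s'.
    move: rss; rewrite !ge_min !le_max.
    by move=> /andP[/orP[] ? /orP[] ?] /andP[/orP[] ? /orP[] ?];
      apply/andP; split; apply/orP; ((left; lra) || (right; lra)).
  apply: (@mean_value_sym _ _ x (fun q => A q (x q))) => q /sub qss.
    exact: evol_solution.
  rewrite (le_trans (ler_blin _ _))// ler_pM//; first exact: As.
  by apply: xmax; rewrite in_itv.
have rs : `|r0 - s| <= `|s' - s|.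
  move: r0ss; rewrite ge_min le_max.
  have n1 := ler_norm (s' - s); have n2 := ler_norm (s - s'); rewrite distrC in n2.
  by rewrite ler_norml => /andP[/orP[] ? /orP[] ?]; apply/andP; split; lra.
have x2 : `|x r0| <= 2 * `|v|.
  have h1 : `|x r0| <= `|v| + `|x r0 - v|.
    by rewrite -[X in `|X| <= _](subrK v) addrC ler_normD.
  have h2 := xle r0 r0ss.
  have h3 : a * `|x r0| * `|r0 - s| <= 1 / 2 * `|x r0|.
    rewrite mulrAC ler_wpM2r// (le_trans _ ss)// ler_wpM2l// ltW//.
  by lra.
have s'ss : Num.min s s' <= s' <= Num.max s s' by rewrite ge_min le_max lexx !orbT.
rewrite (le_trans (xle s' s'ss))// [leRHS]mulrAC ler_wpM2r//.
by have := ler_wpM2l (ltW a0) x2; lra.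
Qed.

(** By the cocycle identity the increment is T(t, s0) (Id - T(s0, s)). Measurability of the Green
    kernel rests on this continuity in s. *)
Lemma evol_continuous t : continuous (fun s => T t s).
Proof.
move=> s0; have [a a0 [d d0 Td]] := evol_near s0.
apply/cvgrPdist_le => e e0.
have c0 : 0 < e / ((`|T t s0| + 1) * a) by rewrite divr_gt0// mulr_gt0// ltr_wpDl.
apply/(@nbhs_normP _ R^o); exists (Num.min d (e / ((`|T t s0| + 1) * a))).
  by rewrite /= lt_min d0.
move=> s /=; rewrite lt_min => /andP[sd se].
have -> : T t s0 - T t s = blin_comp (T t s0) (blin_id X - T s0 s).
  by apply/blin_eqP => v; rewrite blinB /= linearB /= evol_comp.
rewrite (le_trans (blin_comp_le _ _))// [`|blin_id X - _|]distrC.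
have h : `|T s0 s - blin_id X| <= a * `|s0 - s|.
  by apply: Td; [rewrite distrC|rewrite subrr normr0].
rewrite (le_trans (ler_wpM2l _ h))//.
apply: (@le_trans _ _ ((`|T t s0| + 1) * a * `|s0 - s|)).
  by rewrite mulrA ler_wpM2r// ler_wpM2r ?(ltW a0)// lerDl.
by rewrite -ler_pdivlMl ?mulr_gt0// ?ltr_wpDl// mulrC ltW.
Qed.

(** Variation of constants. Rebasing at t writes the curve as T(r, t) applied to [x r]; since T(r,
    t) is Id + O(r - t) in norm, the mixed term of the product rule is quadratic. *)
Lemma hasdc_evol (chi : R -> X) t v : hasdc chi t (T 0 t v) ->
  hasdc (fun r => T r 0 (chi r)) t (A t (T t 0 (chi t)) + v).
Proof.
move=> hchi; pose x r := T t 0 (chi r).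
have hx : hasdc x t v.
  by have := hasdc_postcomp (T t 0) hchi; rewrite evol_comp evol_id.
have TE r : T r 0 (chi r) = T r t (x r) by rewrite /x evol_comp.
have hT := evol_solution t (x t) t; rewrite evol_id in hT.
have [a a0 [d d0 Td]] := evol_near t.
move=> e e0; have e3 : 0 < e / 3 by rewrite divr_gt0.
have [d1 d10 h1] := hT _ e3; have [d2 d20 h2] := hx _ e3.
have [d3 d30 h3] := hx _ ltr01.
have c0 : 0 < e / 3 / (a * (`|v| + 1)) by rewrite divr_gt0// mulr_gt0// ltr_wpDl.
exists (Num.min (Num.min d d1) (Num.min (Num.min d2 d3) (e / 3 / (a * (`|v| + 1))))).
  by rewrite !lt_min d0 d10 d20 d30.
move=> h; rewrite !lt_min => /andP[/andP[hd hd1] /andP[/andP[hd2 hd3] hc]].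
have h0 := normr_ge0 h.
rewrite (TE (t + h)) -/(x t).
have -> : T (t + h) t (x (t + h)) - x t - h *: (A t (x t) + v) =
  (T (t + h) t (x t) - T t t (x t) - h *: A t (x t)) +
  (T (t + h) t - blin_id X) (x (t + h) - x t) + (x (t + h) - x t - h *: v).
  have -> : (T (t + h) t - blin_id X) (x (t + h) - x t) =
    T (t + h) t (x (t + h)) - T (t + h) t (x t) - (x (t + h) - x t).
    by rewrite blinB /= linearB.
  have -> : h *: (A t (x t) + v) = h *: A t (x t) + h *: v by exact: scalerDr.
  by rewrite evol_id; zmodl.
have k1 := h1 h hd1; have k2 := h2 h hd2.
have k3 : `|x (t + h) - x t| <= (`|v| + 1) * `|h|.
  rewrite -[X in `|X| <= _](subrK (h *: v)) (le_trans (ler_normD _ _))//.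
  by rewrite normrZ addrC mulrDl lerD// ?h3// mulrC.
have k4 : `|(T (t + h) t - blin_id X) (x (t + h) - x t)| <= e / 3 * `|h|.
  have := Td t (t + h); rewrite subrr normr0 addrAC subrr add0r => /(_ d0 hd) Th.
  rewrite (le_trans (ler_blin _ _))// (le_trans (ler_pM _ _ Th k3))//.
  move: hc; rewrite ltr_pdivlMr; last by rewrite mulr_gt0// ltr_wpDl.
  move=> /ltW hc.
  have -> : a * `|h| * ((`|v| + 1) * `|h|) = `|h| * (a * (`|v| + 1)) * `|h| by ring.
  by rewrite ler_wpM2r.
have -> : e * `|h| = e / 3 * `|h| + e / 3 * `|h| + e / 3 * `|h| by field.
by rewrite (le_trans (ler_normD _ _))// lerD// (le_trans (ler_normD _ _))// lerD.
Qed.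

End Evolution.

(** * Green's operator *)

Section GreenOperator.
Context {R : realType} {X : completeNormedModType R}.
Context (A : R -> blin X X) (T : R -> R -> blin X X) (P : R -> blin X X).
Hypotheses (contA : continuous A) (TA : evolution_family A T)
  (contP : continuous P).
Context (w : R -> R) (Lam : R).
Hypotheses (contw : continuous w) (w_ge0 : forall t, 0 <= w t).
Notation mu := (@lebesgue_measure R).
Notation G := (green T P).
Hypothesis w_int : forall t,
  (\int[mu]_s (w s * `|G t s|)%:E <= Lam%:E)%E.

Lemma greenE t s : `|G t s| =
  if s <= t then `|blin_comp (T t s) (P s)| else `|blin_comp (T t s) (blin_id X - P s)|.
Proof. by rewrite /green; case: ifP => //; rewrite normrN. Qed.

Lemma green_measurable t : measurable_fun [set: R] (fun s => `|G t s|).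
Proof.
have cT : continuous (fun s => T t s) by exact: evol_continuous contA TA t.
under eq_fun do rewrite greenE.
apply: measurable_fun_ifT.
- exact: measurable_fun_ler.
- apply: continuous_measurable_fun => s; apply: cvg_norm.
  by apply: blin_comp_continuous; [exact: cT|exact: contP].
- apply: continuous_measurable_fun => s; apply: cvg_norm.
  apply: (@blin_comp_continuous _ _ _ _ _ (fun s => T t s) (fun s => blin_id X - P s)).
    exact: cT.
  by apply: cvgB; [exact: cvg_cst|exact: contP].
Qed.

Lemma green_integrand_measurable t (h : R -> R) D : measurable D ->
  continuous h -> measurable_fun D (fun s => (h s * `|G t s|)%:E).
Proof.
move=> mD ch; apply: measurable_funTS; apply/measurable_EFinP.
apply: measurable_funM; first exact: continuous_measurable_fun.
exact: green_measurable.
Qed.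

Section Source.
Context (g : R -> X) (K : R).
Hypotheses (contg : continuous g) (K_ge0 : 0 <= K)
  (gK : forall t, `|g t| <= K * w t).
Let h t s : \bar R := (`|g s| * `|G t s|)%:E.

Let contgn : continuous (fun s => `|g s|).
Proof. by move=> s; apply: cvg_norm; exact: contg. Qed.

Let h_ge0 t s : (0 <= h t s)%E.
Proof. by rewrite lee_fin mulr_ge0. Qed.

Let mh t D : measurable D -> measurable_fun D (h t).
Proof. by move=> mD; exact: green_integrand_measurable. Qed.

Lemma green_source_le t : (\int[mu]_s h t s <= (K * Lam)%:E)%E.
Proof.
apply: (@le_trans _ _ (\int[mu]_s (K%:E * (w s * `|G t s|)%:E))%E).
  apply: ge0_le_integral => //.
  - exact: mh.
  - apply: measurable_funeM; exact: green_integrand_measurable.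
  - by move=> s _; rewrite -EFinM lee_fin mulrA ler_wpM2r.
rewrite ge0_integralZl_EFin//.
- by rewrite EFinM lee_wpmul2l// lee_fin.
- by move=> s _; rewrite lee_fin mulr_ge0.
- exact: green_integrand_measurable.
Qed.

(** [left_piece] and [right_piece] are the integrands of Green's formula for s before and after t,
    the second without its minus sign. At equal arguments they add up to T(t, s) g(s). *)
Let left_piece t s := T t s (P s (g s)).
Let right_piece t s := T t s (g s - P s (g s)).

Let cont_left t : continuous (left_piece t).
Proof.
move=> s; apply: (@blin_app_continuous _ _ _ _ (fun s => T t s) (fun s => P s (g s))).
  exact: evol_continuous contA TA t s.
by apply: (@blin_app_continuous _ _ _ _ P g); [exact: contP|exact: contg].
Qed.

Let cont_right t : continuous (right_piece t).
Proof.
move=> s; apply: (@blin_app_continuous _ _ _ _ (fun s => T t s)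
  (fun s => g s - P s (g s))); first exact: evol_continuous contA TA t s.
apply: cvgB; first exact: contg.
by apply: (@blin_app_continuous _ _ _ _ P g); [exact: contP|exact: contg].
Qed.

Let left_int t a b : a <= b -> b <= t ->
  (\int[mu]_(s in `[a, b]) `|left_piece t s|%:E <= \int[mu]_(s in `]-oo, t]) h t s)%E.
Proof.
move=> ab bt.
apply: (@le_trans _ _ (\int[mu]_(s in `[a, b]) h t s)%E).
  apply: ge0_le_integral => //.
  - apply: measurable_funTS; apply/measurable_EFinP.
    by apply: continuous_measurable_fun => s; apply: cvg_norm; exact: cont_left.
  - exact: mh.
  - move=> s; rewrite /= in_itv/= => /andP[_ sb].
    rewrite lee_fin greenE (le_trans sb bt) mulrC.
    exact: (ler_blin (blin_comp (T t s) (P s)) (g s)).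
apply: ge0_subset_integral => //; first exact: mh.
by move=> s; rewrite /= !in_itv/= => /andP[_ sb]; exact: le_trans bt.
Qed.

Let right_int t a b : a < b -> t <= a ->
  (\int[mu]_(s in `[a, b]) `|right_piece t s|%:E
     <= \int[mu]_(s in ~` `]-oo, t]) h t s)%E.
Proof.
move=> ab ta.
have mr : measurable_fun [set: R] (fun s => `|right_piece t s|).
  by apply: continuous_measurable_fun => s; apply: cvg_norm; exact: cont_right.
(* Without the endpoint [a] every s exceeds t, also when a = t, which selects the branch of [green]
   with Id - P. *)
rewrite -integral_itv_obnd_cbnd; last first.
  by apply: measurable_funTS; exact/measurable_EFinP.
apply: (@le_trans _ _ (\int[mu]_(s in `]a, b]) h t s)%E).
  apply: ge0_le_integral => //.
  - by apply: measurable_funTS; apply/measurable_EFinP.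
  - exact: mh.
  - move=> s; rewrite /= in_itv/= => /andP[as_ _].
    rewrite lee_fin greenE (lt_geF (le_lt_trans ta as_)) mulrC.
    exact: (ler_blin (blin_comp (T t s) (blin_id X - P s)) (g s)).
apply: ge0_subset_integral => //; first by exact: measurableC.
- by apply: mh; exact: measurableC.
- move=> s; rewrite /= !in_itv/= => /andP[as_ _].
  by apply/negP; rewrite -ltNge (le_lt_trans ta).
Qed.

Let split_int t : (\int[mu]_s h t s =
  \int[mu]_(s in `]-oo, t]) h t s + \int[mu]_(s in ~` `]-oo, t]) h t s)%E.
Proof.
rewrite -ge0_integral_setU ?setUv//.
- exact: measurableC.
- exact: mh.
- by rewrite disj_set2E setICr.
Qed.

(** The solution is T(t, 0) applied to the integral of T(0, s) P(s) g(s) up to t minus that of T(0,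
    s) (Id - P(s)) g(s) from t on. Both are limits of primitives, which exist because the Green
    integral at t = 0 is finite. *)
Lemma green_solution : exists u : R -> X,
  (forall t, hasdc u t (A t (u t) + g t)) /\
  forall t, (`|u t|%:E <= \int[mu]_s h t s)%E.
Proof.
have KL0 : 0 <= K * Lam.
  have := green_source_le 0; rewrite -lee_fin; apply: le_trans.
  by apply: integral_ge0 => s _.
have [Phi hPhi] := continuous_hasprim (@cont_left 0).
have [Psi hPsi] := continuous_hasprim (@cont_right 0).
have cln : continuous (fun s => `|left_piece 0 s|).
  by move=> s; apply: cvg_norm; exact: cont_left.
have crn : continuous (fun s => `|right_piece 0 s|).
  by move=> s; apply: cvg_norm; exact: cont_right.
have [p hp] := @continuous_hasprim R R _ cln.
have [r hr] := @continuous_hasprim R R _ crn.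
have i1 t : (0 <= \int[mu]_(s in `]-oo, t]) h t s)%E by exact: integral_ge0.
have i2 t : (0 <= \int[mu]_(s in ~` `]-oo, t]) h t s)%E by exact: integral_ge0.
have le1 t : (\int[mu]_(s in `]-oo, t]) h t s <= (K * Lam)%:E)%E.
  by apply: le_trans (green_source_le t); rewrite split_int leeDl.
have le2 t : (\int[mu]_(s in ~` `]-oo, t]) h t s <= (K * Lam)%:E)%E.
  by apply: le_trans (green_source_le t); rewrite split_int leeDr.
have prim_mono (q f : R -> R) a b : (forall s, hasdc q s `|f s|) -> a <= b -> q a <= q b.
  move=> hq ab; rewrite -subr_ge0.
  have := @mean_value_le _ R (fun=> 0) (fun=> 0) q (fun t => `|f t|) a b ab.
  rewrite subrr normr0; apply=> s _; [exact: hasdc_cst|exact: hq|exact: normr_ge0].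
have [l1 Phil1] : exists l : X, (fun n : nat => Phi (- n%:R)) @ \oo --> l.
  apply/(@cvg_ex X); apply: (@prim_cvg _ _ Phi (left_piece 0) p (fun n => - n%:R) (`|p 0| + K * Lam) hPhi hp).
    by right=> n m nm; rewrite lerN2 ler_nat.
  move=> n; rewrite -[p (- _)](subKr (p 0)) (le_trans (ler_normB _ _))// lerD2l.
  case: n => [|n]; first by rewrite oppr0 subrr normr0.
  have n0 : - n.+1%:R < 0 :> R by rewrite oppr_lt0.
  rewrite ger0_norm; last first.
    by rewrite subr_ge0; apply: (prim_mono p (fun s => `|left_piece 0 s|));
      [move=> s; rewrite normr_id|exact: ltW].
  rewrite -lee_fin -(integral_prim n0 cln hp).
  by apply: le_trans (le1 0); apply: left_int => //; exact: ltW.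
have [l2 Psil2] : exists l : X, (fun n : nat => Psi n%:R) @ \oo --> l.
  apply/(@cvg_ex X); apply: (@prim_cvg _ _ Psi (right_piece 0) r (fun n => n%:R) (`|r 0| + K * Lam) hPsi hr).
    by left=> n m nm; rewrite ler_nat.
  move=> n; rewrite -[r _](subrK (r 0)) addrC (le_trans (ler_normD _ _))// lerD2l.
  case: n => [|n]; first by rewrite subrr normr0.
  have n0 : 0 < n.+1%:R :> R by [].
  rewrite ger0_norm; last first.
    by rewrite subr_ge0; apply: (prim_mono r (fun s => `|right_piece 0 s|));
      [move=> s; rewrite normr_id|exact: ltW].
  rewrite -lee_fin -(integral_prim n0 crn hr).
  by apply: le_trans (le2 0); exact: right_int.
(* [l1] and [l2] are the limits of [Phi] at minus infinity and of [Psi] at plus infinity;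
   [Psi t - l2] is minus the integral over s > t. *)
pose chi t := (Phi t - l1) + (Psi t - l2).
exists (fun t => T t 0 (chi t)); split=> t.
  apply: (hasdc_evol contA TA).
  have -> : T 0 t (g t) = (left_piece 0 t - 0) + (right_piece 0 t - 0).
    by rewrite !subr0 /left_piece /right_piece -linearD; congr (T 0 t _); zmodl.
  by apply: hasdcD; apply: hasdcB => //; exact: hasdc_cst.
have fin1 : (\int[mu]_(s in `]-oo, t]) h t s)%E \is a fin_num.
  by rewrite ge0_fin_numE// (le_lt_trans (le1 t))// ltry.
have fin2 : (\int[mu]_(s in ~` `]-oo, t]) h t s)%E \is a fin_num.
  by rewrite ge0_fin_numE// (le_lt_trans (le2 t))// ltry.
(* Moving T(t, 0) inside the primitive is what yields the kernel at t, not at 0, in the final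
   bound. *)
have hl s : hasdc (fun s => T t 0 (Phi s)) s (left_piece t s).
  have := hasdc_postcomp (T t 0) (hPhi s).
  by rewrite /left_piece (evol_comp TA).
have hrr s : hasdc (fun s => T t 0 (Psi s)) s (right_piece t s).
  have := hasdc_postcomp (T t 0) (hPsi s).
  by rewrite /right_piece (evol_comp TA).
have b1 : `|T t 0 (Phi t - l1)| <= fine (\int[mu]_(s in `]-oo, t]) h t s)%E.
  have cv : (fun n : nat => `|T t 0 (Phi t - Phi (- n%:R))|) @ \oo -->
      `|T t 0 (Phi t - l1)|.
    apply: cvg_norm; apply: cvg_comp; last exact: blin_continuous.
    by apply: cvgB => //; exact: cvg_cst.
  apply: (@ler_cvg_to _ _ _ _ _ _ _ _ cv (cvg_cst _)).
  near=> n.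
  have nt : - n%:R <= t by rewrite lerNl; near: n; exact: nbhs_infty_ger.
  rewrite -lee_fin fineK// linearB /=.
  apply: le_trans (norm_le_integral nt (@cont_left t) hl) _.
  exact: left_int.
have b2 : `|T t 0 (Psi t - l2)| <= fine (\int[mu]_(s in ~` `]-oo, t]) h t s)%E.
  have cv : (fun n : nat => `|T t 0 (Psi t - Psi n%:R)|) @ \oo -->
      `|T t 0 (Psi t - l2)|.
    apply: cvg_norm; apply: cvg_comp; last exact: blin_continuous.
    by apply: cvgB => //; exact: cvg_cst.
  apply: (@ler_cvg_to _ _ _ _ _ _ _ _ cv (cvg_cst _)).
  near=> n.
  have nt : t < n%:R by near: n; exact: nbhs_infty_gtr.
  rewrite -lee_fin fineK// linearB /= distrC.
  apply: le_trans (norm_le_integral (ltW nt) (@cont_right t) hrr) _.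
  exact: right_int.
rewrite split_int -(fineK fin1) -(fineK fin2) -EFinD lee_fin /chi linearD /=.
by rewrite (le_trans (ler_normD _ _))// lerD.
Unshelve. all: by end_near. Qed.

End Source.

End GreenOperator.

(** * Smooth dependence of fixed points on parameters *)

Section Calculus.
Context {R : realType}.

Lemma hasd_dir_le {U V : normedModType R} (f : U -> V) p D v (M : R) :
  hasd f p D ->
  (exists2 d : R, 0 < d & forall s, 0 < s < d -> `|f (p + s *: v) - f p| <= M * s) ->
  `|D v| <= M.
Proof.
move=> fD [d d0 fd]; apply/ler_addgt0Pr => e e0.
have v1 : 0 < `|v| + 1 by rewrite ltr_wpDl.
have [r r0 fr] := fD _ (divr_gt0 e0 v1).
pose s := Num.min d (r / (`|v| + 1)) / 2.
have m0 : 0 < Num.min d (r / (`|v| + 1)) by rewrite lt_min d0 divr_gt0.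
have s0 : 0 < s by rewrite divr_gt0.
have : s < Num.min d (r / (`|v| + 1)) by rewrite /s; lra.
rewrite lt_min => /andP[sd]; rewrite ltr_pdivlMr// => sr.
have nsv : `|s *: v| <= s * (`|v| + 1).
  by rewrite normrZ gtr0_norm// ler_wpM2l ?(ltW s0)// lerDl.
have h1 := fr (s *: v) (le_lt_trans nsv sr).
have h2 := fd s (introT andP (conj s0 sd)).
have h3 : `|D (s *: v)| <= M * s + e * s.
  have -> : D (s *: v) = (f (p + s *: v) - f p) - (f (p + s *: v) - f p - D (s *: v)).
    by zmodl.
  rewrite (le_trans (ler_normB _ _))// lerD// (le_trans h1)//.
  have := ler_wpM2l (ltW (divr_gt0 e0 v1)) nsv; move=> /le_trans; apply.
  by rewrite mulrCA divfK ?gt_eqF// mulrC.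
move: h3; rewrite linearZ /= normrZ gtr0_norm// -mulrDl mulrC.
by rewrite ler_pM2r.
Qed.

Lemma taylor1 {U V : normedModType R} (S : set U) (f : U -> V) (L : R) p q :
  cvxset S -> 0 <= L -> S p -> S q -> (forall x, S x -> differentiable f x) ->
  (forall x, S x -> `|fderiv f x - fderiv f p| <= L * `|x - p|) ->
  `|f q - f p - fderiv f p (q - p)| <= L * `|q - p| ^+ 2.
Proof.
move=> cS L0 Sp Sq df fL.
have := @mean_value_cst _ V (fun s => f (p + s *: (q - p)) - s *: fderiv f p (q - p))
  (fun s => fderiv f (p + s *: (q - p)) (q - p) - fderiv f p (q - p))
  (L * `|q - p| ^+ 2) 0 1 ler01.
rewrite !scale1r !scale0r addr0 !subr0 mulr1 [p + (q - p)]addrC subrK.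
rewrite addrAC; apply=> s s01.
- apply: hasdcB; last exact: hasdc_scale.
  by apply: hasd_segment; apply: diff_hasd; apply: df; exact: cS.
- rewrite -blinB (le_trans (ler_blin _ _))// expr2 mulrA ler_wpM2r//.
  rewrite (le_trans (fL _ (cS _ _ Sp Sq _ s01)))// ler_wpM2l//.
  rewrite addrAC subrr add0r normrZ; case/andP: s01 => s0 s1.
  by rewrite ger0_norm// ler_piMl.
Qed.

Lemma cvxX {U V : normedModType R} (A : set U) (B : set V) :
  cvxset A -> cvxset B -> cvxset (A `*` B).
Proof.
move=> cA cB [a b] [a' b'] [/= Aa Bb] [/= Aa' Bb'] s s01.
by split; [exact: (cA a a')|exact: (cB b b')].
Qed.

Lemma pair_inlr {U V : normedModType R} (u : U) (v : V) :
  (u, v) = blin_inl U V u + blin_inr U V v.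
Proof. by apply: injective_projections; rewrite /= ?addr0 ?add0r. Qed.

End Calculus.

(** * Parameter dependence for an abstract linear solution relation *)

Section SolutionOperator.
Context {R : realType} {X : completeNormedModType R}.
Context (Sol : (R -> X) -> (R -> X) -> Prop) (c w : R -> R) (q Lam : R).
Hypotheses
  (Sol_lin : forall a g1 u1 g2 u2, Sol g1 u1 -> Sol g2 u2 ->
     Sol (fun t => a *: g1 t + g2 t) (fun t => a *: u1 t + u2 t))
  (Sol_bound : forall g u a b, Sol g u -> 0 <= a -> 0 <= b ->
     (forall t, `|g t| <= a * c t + b * w t) -> forall t, `|u t| <= a * q + b * Lam)
  (Sol_ex : forall g K, continuous g -> 0 <= K -> (forall t, `|g t| <= K * w t) ->
     exists u, Sol g u)
  (Sol_cont : forall g u, Sol g u -> continuous u)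
  (q_ge0 : 0 <= q) (q_lt1 : q < 1) (Lam_ge0 : 0 <= Lam)
  (c_ge0 : forall t, 0 <= c t) (c_le_w : forall t, c t <= w t)
  (contw : continuous w).

Let w_ge0 t : 0 <= w t. Proof. exact: le_trans (c_ge0 t) (c_le_w t). Qed.

Let q1_gt0 : 0 < 1 - q. Proof. by rewrite subr_gt0. Qed.

(* A Banach space of [X]-valued maps is handled through the functionals in
   [Th]: only their compositions with a curve [R -> Y] need to be continuous
   or to solve the equation. *)
Section Level.
Context {Y : completeNormedModType R} (Th : set (blin Y X)).

Definition scont (g : R -> Y) := forall th, Th th -> continuous (fun t => th (g t)).

Definition SolY (g u : R -> Y) :=
  forall th, Th th -> Sol (fun t => th (g t)) (fun t => th (u t)).

Definition norming := forall (y : Y) (M : R), 0 <= M ->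
  (forall th, Th th -> `|th y| <= M * `|th|) -> `|y| <= M.

Definition solvable := forall (g : R -> Y) (K : R), scont g -> 0 <= K ->
  (forall t, `|g t| <= K * w t) -> exists u, SolY g u.

Lemma SolY_scont g u : SolY g u -> scont u.
Proof. by move=> gu th Thth; exact: Sol_cont (gu th Thth). Qed.

Lemma SolY_lin a g1 u1 g2 u2 : SolY g1 u1 -> SolY g2 u2 ->
  SolY (fun t => a *: g1 t + g2 t) (fun t => a *: u1 t + u2 t).
Proof.
move=> h1 h2 th Thth; have := Sol_lin a (h1 th Thth) (h2 th Thth).
by congr Sol; apply/funext => t; rewrite linearP.
Qed.

Lemma SolYB g1 u1 g2 u2 : SolY g1 u1 -> SolY g2 u2 ->
  SolY (fun t => g1 t - g2 t) (fun t => u1 t - u2 t).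
Proof.
move=> h1 h2; have := SolY_lin (-1) h2 h1.
by congr SolY; apply/funext => t; rewrite scaleN1r addrC.
Qed.

Lemma scontD f g : scont f -> scont g -> scont (fun t => f t + g t).
Proof.
move=> cf cg th Thth t.
rewrite (_ : (fun t => _) = (fun t => th (f t) + th (g t))); last first.
  by apply/funext => s; rewrite linearD.
by apply: cvgD; [exact: cf|exact: cg].
Qed.

Lemma scontZ a f : scont f -> scont (fun t => a *: f t).
Proof.
move=> cf th Thth t.
rewrite (_ : (fun t => _) = (fun t => a *: th (f t))); last first.
  by apply/funext => s; rewrite linearZ.
by apply: cvgZr; exact: cf.
Qed.

Lemma scontB f g : scont f -> scont g -> scont (fun t => f t - g t).
Proof.
move=> cf cg; have := scontD cf (@scontZ (-1) g cg).
by congr scont; apply/funext => t; rewrite scaleN1r.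
Qed.

Hypothesis Thn : norming.

Lemma SolY_bound g u a b : SolY g u -> 0 <= a -> 0 <= b ->
  (forall t, `|g t| <= a * c t + b * w t) -> forall t, `|u t| <= a * q + b * Lam.
Proof.
move=> gu a0 b0 gab t.
apply: Thn; first by rewrite addr_ge0// mulr_ge0.
move=> th Thth.
have := @Sol_bound _ _ (`|th| * a) (`|th| * b) (gu th Thth).
rewrite !mulr_ge0// => /(_ isT isT) h.
rewrite mulrC mulrDr !mulrA; apply: h => {}t.
by rewrite (le_trans (ler_blin _ _))// -!mulrA -mulrDr ler_wpM2l.
Qed.

(** The supremum N of |u|, finite thanks to [M], satisfies N <= N q + b Lam; the value of [M] drops
    out. *)
Lemma SolY_self_bound g u b M : SolY g u -> 0 <= b -> (forall t, `|u t| <= M) ->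
  (forall t, `|g t| <= c t * `|u t| + b * w t) ->
  forall t, `|u t| <= b * Lam / (1 - q).
Proof.
move=> gu b0 uM gub.
pose N := sup [set `|u t| | t in [set: R]].
have hs : has_sup [set `|u t| | t in [set: R]].
  by split; [exists `|u 0|, 0|exists M => _ [t _ <-]].
have uN t : `|u t| <= N by apply: (sup_upper_bound hs); exists t.
have N0 : 0 <= N by exact: le_trans (normr_ge0 (u 0)) (uN 0).
have hb := SolY_bound gu N0 b0.
have NN : N <= N * q + b * Lam.
  apply: ge_sup; first by case: hs.
  move=> _ [t _ <-]; apply: hb => {}t.
  by rewrite (le_trans (gub t))// lerD2r mulrC ler_wpM2r.
move=> t; rewrite (le_trans (uN t))// ler_pdivlMr//; lra.
Qed.

Lemma scont_limit (un : nat -> R -> Y) (u : R -> Y) (D : nat -> R) :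
  (forall n, scont (un n)) -> D @ \oo --> 0 ->
  (forall n t, `|u t - un n t| <= D n) -> scont u.
Proof.
move=> cun D0 unD th Thth t0; apply/cvgrPdist_le => e e0.
have t1 : 0 < `|th| + 1 by rewrite ltr_wpDl.
have e3 : 0 < e / 3 / (`|th| + 1) by rewrite !divr_gt0.
have /cvgrPdist_lt/(_ _ e3)[n0 _ /(_ n0 (leqnn _))] := D0.
rewrite sub0r normrN => Dn.
have th3 t : `|th (u t - un n0 t)| <= e / 3.
  rewrite (le_trans (ler_blin _ _))//.
  apply: (@le_trans _ _ ((`|th| + 1) * `|u t - un n0 t|)).
    by rewrite ler_wpM2r// lerDl.
  rewrite mulrC -ler_pdivlMr// (le_trans (unD n0 t))//.
  by rewrite (le_trans (ler_norm _))// ltW.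
have e3' : 0 < e / 3 by rewrite divr_gt0.
have /cvgrPdist_le/(_ _ e3') := cun n0 th Thth t0.
apply: filterS => t ht.
have -> : th (u t0) - th (u t) = th (u t0 - un n0 t0) + (th (un n0 t0) - th (un n0 t))
   - th (u t - un n0 t) by rewrite !linearB /=; zmodl.
rewrite (_ : e = e / 3 + e / 3 + e / 3); last by field.
rewrite (le_trans (ler_normB _ _))// lerD// (le_trans (ler_normD _ _))// lerD//.
Qed.

Hypothesis Ths : solvable.

Section FixedPoint.
Context (F : R -> Y -> Y) (K : R).
Hypotheses (K_ge0 : 0 <= K)
  (F_lip : forall t u v, `|F t u - F t v| <= c t * `|u - v|)
  (F_0 : forall t, `|F t 0| <= K * w t)
  (F_cont : forall u M, scont u -> (forall t, `|u t| <= M) -> scont (fun t => F t (u t))).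

Let good (u : R -> Y) := scont u /\ exists M, forall t, `|u t| <= M.

Let FP_next u : good u -> exists2 v, SolY (fun t => F t (u t)) v & good v.
Proof.
move=> [cu [M uM]].
have M0 : 0 <= M by exact: le_trans (normr_ge0 _) (uM 0).
have FM t : `|F t (u t)| <= M * c t + K * w t.
  rewrite -[F t (u t)](subrK (F t 0)) (le_trans (ler_normD _ _))// lerD//.
  by rewrite (le_trans (F_lip _ _ _))// subr0 mulrC ler_wpM2r.
have FMw t : `|F t (u t)| <= (M + K) * w t.
  by rewrite (le_trans (FM t))// mulrDl lerD2r ler_wpM2l.
have [v hv] := Ths (F_cont cu uM) (addr_ge0 M0 K_ge0) FMw.
exists v => //; split; first exact: SolY_scont hv.
by exists (M * q + K * Lam); exact: SolY_bound hv M0 K_ge0 FM.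
Qed.

Let FP_contr u v u' v' D : SolY (fun t => F t (u t)) u' ->
  SolY (fun t => F t (v t)) v' -> 0 <= D -> (forall t, `|u t - v t| <= D) ->
  forall t, `|u' t - v' t| <= D * q.
Proof.
move=> hu hv D0 uvD t.
have := @SolY_bound _ _ D 0 (SolYB hu hv) D0 (lexx 0).
rewrite mul0r addr0; apply=> s; rewrite mul0r addr0.
by rewrite (le_trans (F_lip _ _ _))// mulrC ler_wpM2r.
Qed.

(** Picard iteration from 0 in the sup norm: sources that differ by at most D c have solutions that
    differ by at most D q. The uniform limit is still bounded and continuous under the functionals,
    so [F] along it is an admissible source. *)
Lemma fixed_point : exists2 u, SolY (fun t => F t (u t)) u &
  exists M, forall t, `|u t| <= M.
Proof.
have /choice[Psi PsiP] : forall u : R -> Y, exists v, good u ->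
    SolY (fun t => F t (u t)) v /\ good v.
  move=> u; have [gu|ngu] := pselect (good u); last by exists u.
  by have [v hv gv] := FP_next gu; exists v.
pose un n := iter n Psi (fun=> 0).
have un_good n : good (un n).
  elim: n => [|n IH]; last by have [] := PsiP _ IH.
  split; last by exists 0 => t; rewrite normr0.
  by move=> th Thth t; rewrite /un /=; exact: cvg_cst.
have un_sol n : SolY (fun t => F t (un n t)) (un n.+1).
  by have [] := PsiP _ (un_good n).
have [_ [D uD]] := un_good 1%N.
have D0 : 0 <= D by exact: le_trans (normr_ge0 _) (uD 0).
have qn n : 0 <= q ^+ n by rewrite exprn_ge0.
have succ n t : `|un n.+1 t - un n t| <= D * q ^+ n.
  elim: n t => [|n IH] t; first by rewrite expr0 mulr1 subr0.
  by rewrite exprSr mulrA; apply: (FP_contr (un_sol n.+1) (un_sol n)) => //; exact: mulr_ge0.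
(* The tail of the geometric series D q^n. *)
pose Dn n := D / (1 - q) * q ^+ n.
have DE n : Dn n = D * q ^+ n + Dn n.+1.
  by rewrite /Dn exprS; field; rewrite gt_eqF.
have D1 : 0 <= D / (1 - q) by rewrite divr_ge0// ltW.
have Dn_ge0 n : 0 <= Dn n by exact: mulr_ge0.
have tail n m t : `|un (n + m)%N t - un n t| <= Dn n.
  elim: m n => [|m IH] n; first by rewrite addn0 subrr normr0.
  rewrite addnS -addSn -[X in `|X|](subrKA (un n.+1 t)) DE [leRHS]addrC.
  by rewrite (le_trans (ler_normD _ _))//; apply: lerD; [exact: IH|exact: succ].
have Dn0 : Dn @ \oo --> 0.
  rewrite -[0](mulr0 (D / (1 - q))); apply: cvgMr.
  by apply: cvg_expr; rewrite ger0_norm.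
have ucvg t : cvgn (fun n => un n t).
  apply/cauchy_cvgP/cauchy_exP => e e0.
  have /cvgrPdist_lt/(_ _ e0)[n0 _ /(_ n0 (leqnn _))] := Dn0.
  rewrite sub0r normrN ger0_norm// => Dn0e.
  exists (un n0 t); rewrite -ball_normE; exists n0 => // n /= nn0.
  by rewrite distrC -(subnKC nn0) (le_lt_trans (tail _ _ _)).
pose u t := limn (fun n => un n t).
have u_un n t : `|u t - un n t| <= Dn n.
  have cv : (fun m => `|un m t - un n t|) @ \oo --> `|u t - un n t|.
    by apply: cvg_norm; apply: cvgB; [exact: ucvg|exact: cvg_cst].
  apply: (@ler_cvg_to _ _ _ _ _ _ _ _ cv (cvg_cst _)).
  exists n => // m /= nm; by rewrite -(subnKC nm) tail.
have u_good : good u.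
  split; first by apply: (scont_limit _ Dn0 u_un) => n; case: (un_good n).
  exists (Dn 0%N) => t; have := u_un 0%N t.
  by rewrite /un /= subr0.
have [v hv _] := FP_next u_good.
suff uv : u = v by exists u; [rewrite {2}uv|case: u_good].
apply/funext => t; apply/eqP; rewrite -subr_eq0 -normr_le0.
have vb n : `|u t - v t| <= Dn n.+1 + Dn n * q.
  rewrite -(subrKA (un n.+1 t)) (le_trans (ler_normD _ _))// lerD//.
  rewrite distrC; apply: (FP_contr hv (un_sol n)) => //.
have cv : (fun n => Dn n.+1 + Dn n * q) @ \oo --> 0 + 0 * q.
  apply: cvgD; last exact: cvgMl.
  by rewrite (cvg_shiftS Dn).
rewrite -[0](addr0 0) -{2}(mul0r q).
by apply: (@ler_cvg_to _ _ _ _ _ _ _ _ (cvg_cst _) cv); exact: nearW.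
Qed.

End FixedPoint.

End Level.

Arguments SolY {Y} Th g u.
Arguments scont {Y} Th g.
Arguments norming {Y} Th.
Arguments solvable {Y} Th.

Lemma SolY_unique {Y : completeNormedModType R} (Th : set (blin Y X)) g u g' u' :
  norming Th -> SolY Th g u -> SolY Th g' u' -> (forall t, g t = g' t) ->
  forall t, u t = u' t.
Proof.
move=> Thn gu gu' gg' t; apply/eqP; rewrite -subr_eq0 -normr_le0.
have := @SolY_bound _ _ Thn _ _ 0 0 (SolYB gu gu') (lexx 0) (lexx 0).
rewrite !mul0r addr0; apply=> s.
by rewrite gg' subrr normr0 !mul0r addr0.
Qed.

Lemma SolY_eq0 {Y : completeNormedModType R} (Th : set (blin Y X)) g u M :
  norming Th -> SolY Th g u -> (forall t, `|u t| <= M) ->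
  (forall t, `|g t| <= c t * `|u t|) -> forall t, u t = 0.
Proof.
move=> Thn gu uM gcu t; apply/eqP; rewrite -normr_le0.
have := @SolY_self_bound _ _ Thn _ _ 0 M gu (lexx 0) uM.
rewrite !mul0r; apply=> s; rewrite mul0r addr0; exact: gcu.
Qed.

(** * Passing from Y to B(E, Y) *)

Section Lift.
Context {E : normedModType R} {Y : completeNormedModType R} (Th : set (blin Y X)).

(** Evaluation at a vector followed by a functional on Y: continuity under these functionals is
    strong continuity of an operator-valued curve. *)
Definition lift_th : set (blin (blin E Y) X) :=
  [set z | exists2 th, Th th & exists h, z = blin_comp th (blin_ev Y h)].

Lemma lift_norming : norming Th -> norming lift_th.
Proof.
move=> Thn y M M0 yM; apply: blin_le => // h; apply: Thn; first exact: mulr_ge0.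
move=> th Thth.
have /yM : lift_th (blin_comp th (blin_ev Y h)) by exists th => //; exists h.
move=> /le_trans; apply; rewrite -mulrA ler_wpM2l//.
rewrite (le_trans (blin_comp_le _ _))// mulrC ler_wpM2r//; exact: blin_ev_le.
Qed.

Lemma lift_scont (g : R -> blin E Y) :
  scont lift_th g <-> forall h, scont Th (fun t => g t h).
Proof.
split=> [cg h th Thth|cg _ [th Thth [h ->]]]; last exact: cg Thth.
by apply: (cg (blin_comp th (blin_ev Y h))); exists th => //; exists h.
Qed.

Lemma lift_SolY (g u : R -> blin E Y) :
  SolY lift_th g u <-> forall h, SolY Th (fun t => g t h) (fun t => u t h).
Proof.
split=> [gu h th Thth|gu _ [th Thth [h ->]]]; last exact: gu Thth.
by apply: (gu (blin_comp th (blin_ev Y h))); exists th => //; exists h.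
Qed.

(* Solving for each [h] separately gives an operator in [h] by uniqueness. *)
Lemma lift_solutions (g : E -> R -> Y) (u : E -> R -> Y) (C : R) :
  (forall h, SolY Th (g h) (u h)) ->
  (forall a h k t, u (a *: h + k) t = a *: u h t + u k t) ->
  (forall h t, `|u h t| <= C * `|h|) ->
  exists2 v : R -> blin E Y, forall h t, v t h = u h t &
    forall t, `|v t| <= `|C|.
Proof.
move=> gu ulin uC.
have lin t : linear (u ^~ t) by move=> a h k; exact: ulin.
exists (fun t => mk_blin (lin t) (uC ^~ t)) => // t.
apply: blin_le => // h; rewrite (le_trans (uC h t))// ler_wpM2r//.
exact: ler_norm.
Qed.

Lemma lift_solvable : norming Th -> solvable Th -> solvable lift_th.
Proof.
move=> Thn Ths g K /lift_scont cg K0 gK.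
have gh h t : `|g t h| <= (K * `|h|) * w t.
  by rewrite (le_trans (ler_blin _ _))// mulrAC ler_wpM2r.
have /choice[u uP] : forall h, exists u, SolY Th (fun t => g t h) u.
  by move=> h; apply: Ths (cg h) _ (gh h); exact: mulr_ge0.
have [//|a h k t|h t|v vu _] := @lift_solutions (fun h t => g t h) u (K * Lam).
- apply: (SolY_unique Thn (uP _) (SolY_lin a (uP h) (uP k))) => s.
  by rewrite linearP.
- have := @SolY_bound _ _ Thn _ _ 0 (K * `|h|) (uP h) (lexx 0) (mulr_ge0 K0 (normr_ge0 h)).
  rewrite mul0r add0r mulrAC; apply=> s; rewrite mul0r add0r; exact: gh.
exists v; apply/lift_SolY => h.
by have := uP h; congr SolY; apply/funext => t.
Qed.

End Lift.

Section Smooth.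
Context {E : completeNormedModType R} (B : set E).
Hypotheses (oB : open B) (cB : cvxset B).

Section Step.
Context {Y : completeNormedModType R} (Th : set (blin Y X)).
Hypotheses (Thn : norming Th) (Ths : solvable Th).
Context (F : R -> E * Y -> Y) (z : E -> R -> Y) (rho rho' : R).
Let S : set (E * Y) := B `*` ball (0 : Y) rho'.
Hypotheses (rho_ge0 : 0 <= rho) (rho_lt : rho < rho')
  (z_le : forall l t, B l -> `|z l t| <= rho)
  (z_sol : forall l, B l -> SolY Th (fun t => F t (l, z l t)) (z l))
  (F_lip : forall t l u v, B l -> `|u| < rho' -> `|v| < rho' ->
     `|F t (l, u) - F t (l, v)| <= c t * `|u - v|)
  (F_cont : forall l u r, B l -> r < rho' -> scont Th u -> (forall t, `|u t| <= r) ->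
     scont Th (fun t => F t (l, u t))).

Let rho'_gt0 : 0 < rho'. Proof. exact: le_lt_trans rho_lt. Qed.

Let oS : open S. Proof. by apply: open_setX oB _; exact: ball_open. Qed.

Let cS : cvxset S. Proof. exact: cvxX cB (@ball_cvx _ _ _ _). Qed.

Let SP l u : B l -> `|u| < rho' -> S (l, u).
Proof. by move=> Bl ur; split=> //=; rewrite -ball_normE /= sub0r normrN. Qed.

Let Sz l t : B l -> S (l, z l t).
Proof. by move=> Bl; apply: SP => //; exact: le_lt_trans (z_le t Bl) rho_lt. Qed.

Let z_lt l t : B l -> `|z l t| < rho'.
Proof. by move=> Bl; exact: le_lt_trans (z_le t Bl) rho_lt. Qed.

(** The sources for l and m are compared through F(l, z_m): one difference is at most c |z_l - z_m|,
    the other O(w) |l - m|, and [SolY_self_bound] closes the estimate. *)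
Lemma solution_lip : lipw S w F -> lipw B one (fun t l => z l t).
Proof.
move=> [K K0 FK]; exists (K * Lam / (1 - q)).
  by rewrite divr_ge0// ?mulr_ge0// ltW.
move=> t l m Bl Bm; rewrite /one mulr1.
have := @SolY_self_bound _ _ Thn _ _ (K * `|l - m|) (rho + rho)
  (SolYB (z_sol Bl) (z_sol Bm)) (mulr_ge0 K0 (normr_ge0 _)).
rewrite (_ : K * `|l - m| * Lam / (1 - q) = K * Lam / (1 - q) * `|l - m|); last by ring.
apply=> s; first by rewrite (le_trans (ler_normB _ _))// lerD// z_le.
rewrite -(subrKA (F s (l, z m s))) (le_trans (ler_normD _ _))// lerD//.
  by apply: F_lip => //; exact: z_lt.
have := FK s (l, z m s) (m, z m s) (SP Bl (z_lt s Bm)) (Sz s Bm).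
rewrite (_ : (l, z m s) - (m, z m s) = (l - m, 0)); last first.
  by apply: injective_projections => //=; rewrite subrr.
by rewrite prod_normE1 /= normr0 max_l// mulrAC.
Qed.

Context (KF LF Lz : R).
Hypotheses (KF_ge0 : 0 <= KF) (LF_ge0 : 0 <= LF) (Lz_ge0 : 0 <= Lz)
  (F_diff : forall t p, S p -> differentiable (F t) p)
  (dF_le : forall t p, S p -> `|fderiv (F t) p| <= KF * w t)
  (dF_lip : forall t p p', S p -> S p' ->
     `|fderiv (F t) p - fderiv (F t) p'| <= LF * w t * `|p - p'|)
  (z_lip : forall t l m, B l -> B m -> `|z l t - z m t| <= Lz * `|l - m|).

Lemma taylorF t p p' : S p -> S p' ->
  `|F t p' - F t p - fderiv (F t) p (p' - p)| <= LF * w t * `|p' - p| ^+ 2.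
Proof.
move=> Sp Sp'; apply: (@taylor1 _ _ _ S) => //.
- by rewrite mulr_ge0.
- by move=> x; exact: F_diff.
- by move=> x Sx; exact: dF_lip.
Qed.

(** No factor is lost with respect to the Lipschitz constant [c t], so the variational equation is a
    contraction with the same q. *)
Lemma dF_snd t l u k : B l -> `|u| < rho' -> `|fderiv (F t) (l, u) (0, k)| <= c t * `|k|.
Proof.
move=> Bl ur; apply: hasd_dir_le (diff_hasd (F_diff t (SP Bl ur))) _.
have k1 : 0 < `|k| + 1 by rewrite ltr_wpDl.
exists ((rho' - `|u|) / (`|k| + 1)); first by rewrite divr_gt0// subr_gt0.
move=> s /andP[s0]; rewrite ltr_pdivlMr// => sk.
have -> : (l, u) + s *: (0, k) = (l, u + s *: k).
  by apply: injective_projections; rewrite /= ?scaler0 ?addr0.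
have nsk : `|s *: k| <= s * (`|k| + 1).
  by rewrite normrZ gtr0_norm// ler_wpM2l ?(ltW s0)// lerDl.
rewrite (le_trans (F_lip t Bl _ ur))//.
  by rewrite (le_lt_trans (ler_normD _ _))//; lra.
rewrite (_ : u + s *: k - u = s *: k); last by rewrite addrAC subrr add0r.
by rewrite normrZ gtr0_norm// mulrCA mulrC.
Qed.

(** Continuity in t is known for [F] along curves only. The derivative inherits it as a limit of
    difference quotients, locally uniform in t because the quadratic remainder carries the
    continuous weight [w]. *)
Lemma dF_scont l h u M : B l -> scont Th u -> (forall t, `|u t| <= M) ->
  scont Th (fun t => fderiv (F t) (l, z l t) (h, u t)).
Proof.
move=> Bl cu uM.
have M0 : 0 <= M by exact: le_trans (normr_ge0 _) (uM 0).
(* A positive bound for the norm of (h, u t); a step s with s N below r and rho' - rho stays in the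
   domain of [F]. *)
pose N := `|h| + M + 1; have N0 : 0 < N by rewrite ltr_wpDl// addr_ge0.
have /nbhs_normP[r /= r0 Br] : \forall m \near l, B m by exact: open_nbhs_nbhs.
pose quot s t := s^-1 *: (F t (l + s *: h, z l t + s *: u t) - F t (l, z l t)).
have s_ok s : 0 < s -> s * N < Num.min r (rho' - rho) ->
    B (l + s *: h) /\ rho + s * M < rho'.
  move=> s0; rewrite lt_min => /andP[sr srho]; split.
    apply: Br => /=; rewrite opprD addNKr normrN normrZ gtr0_norm//.
    apply: le_lt_trans sr; rewrite ler_wpM2l ?(ltW s0)// /N -addrA lerDl.
    by rewrite addr_ge0.
  have : s * M <= s * N by rewrite ler_wpM2l ?(ltW s0)// /N -addrA addrCA lerDl addr_ge0.
  by lra.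
have su_le s t : 0 < s -> `|z l t + s *: u t| <= rho + s * M.
  move=> s0; rewrite (le_trans (ler_normD _ _))// lerD ?z_le//.
  by rewrite normrZ gtr0_norm// ler_wpM2l// ltW.
have cquot s : 0 < s -> s * N < Num.min r (rho' - rho) -> scont Th (quot s).
  move=> s0 /(s_ok s s0)[Bs rs]; apply: scontZ; apply: scontB.
    apply: (F_cont Bs rs) => [|t]; last exact: su_le.
    by apply: scontD; [exact: SolY_scont (z_sol Bl)|exact: scontZ].
  apply: (F_cont Bl rho_lt) => [|t]; last exact: z_le.
  exact: SolY_scont (z_sol Bl).
have quot_le s t : 0 < s -> s * N < Num.min r (rho' - rho) ->
    `|fderiv (F t) (l, z l t) (h, u t) - quot s t| <= LF * w t * N ^+ 2 * s.
  move=> s0 sN; have [Bs rs] := s_ok s s0 sN.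
  have Sp' : S (l + s *: h, z l t + s *: u t).
    by apply: SP => //; exact: le_lt_trans (su_le s t s0) rs.
  have pE : (l + s *: h, z l t + s *: u t) - (l, z l t) = s *: (h, u t).
    by apply: injective_projections => /=; rewrite addrAC subrr add0r.
  have := taylorF t (Sz t Bl) Sp'; rewrite pE => ht.
  have -> : fderiv (F t) (l, z l t) (h, u t) - quot s t =
      - (s^-1 *: (F t (l + s *: h, z l t + s *: u t) - F t (l, z l t)
       - fderiv (F t) (l, z l t) (s *: (h, u t)))).
    have E1 : fderiv (F t) (l, z l t) (s *: (h, u t)) = s *: fderiv (F t) (l, z l t) (h, u t).
      by rewrite linearZ.
    have E2 (a b : Y) : s^-1 *: (a - s *: b) = s^-1 *: a - b.
      by rewrite scalerBr scalerA mulVf ?gt_eqF// scale1r.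
    by rewrite E1 E2 opprB.
  rewrite normrN normrZ normfV gtr0_norm// ler_pdivrMl//.
  rewrite (le_trans ht)// normrZ gtr0_norm//.
  have huN : `|(h, u t)| <= N.
    rewrite prod_norm_le /N /= -!addrA lerDl addr_ge0//=.
    by rewrite addrCA (le_trans (uM t))// lerDl addr_ge0.
  have huN2 : `|(h, u t)| ^+ 2 <= N ^+ 2 by rewrite ler_sqr ?nnegrE// ltW.
  have -> : s * (LF * w t * N ^+ 2 * s) = LF * w t * (s ^+ 2 * N ^+ 2) by ring.
  by rewrite exprMn ler_wpM2l ?mulr_ge0// ler_wpM2l ?sqr_ge0.
move=> th Thth t0; apply/cvgrPdist_le => e e0.
have e3 : 0 < e / 3 by rewrite divr_gt0.
(* Wherever w t <= w t0 + 1, replacing the derivative by the quotient costs at most s D under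
   [th]. *)
pose D := (`|th| + 1) * (LF + 1) * (w t0 + 1) * N ^+ 2.
have D0 : 0 < D.
  apply: mulr_gt0; last exact: exprn_gt0.
  by apply: mulr_gt0; [apply: mulr_gt0|]; rewrite ltr_wpDl.
pose s := Num.min (Num.min r (rho' - rho) / N) (e / 3 / D) / 2.
have m0 : 0 < Num.min (Num.min r (rho' - rho) / N) (e / 3 / D).
  by rewrite lt_min !divr_gt0// lt_min r0 subr_gt0.
have s0 : 0 < s by rewrite divr_gt0.
have : s < Num.min (Num.min r (rho' - rho) / N) (e / 3 / D) by rewrite /s; lra.
rewrite lt_min ltr_pdivlMr// ltr_pdivlMr// => /andP[sN sD].
have /cvgrPdist_le/(_ _ e3) hq := cquot s s0 sN th Thth t0.
have hw : \forall t \near t0, w t < w t0 + 1.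
  have /cvgrPdist_lt/(_ 1 ltr01) := @contw t0.
  by apply: filterS => t; rewrite ltr_norml => /andP[? _]; lra.
near=> t.
have hqt : `|th (quot s t0) - th (quot s t)| <= e / 3 by near: t.
have hwt : w t <= w t0 + 1 by apply: ltW; near: t.
have hD t' : w t' <= w t0 + 1 ->
    `|th (fderiv (F t') (l, z l t') (h, u t') - quot s t')| <= e / 3.
  move=> wt'; rewrite (le_trans (ler_blin _ _))//.
  have h1 := quot_le s t' s0 sN.
  apply: (@le_trans _ _ (s * D)); last exact: ltW.
  rewrite (le_trans (ler_wpM2l _ h1))//.
  have -> : s * D = (`|th| + 1) * ((LF + 1) * (w t0 + 1) * N ^+ 2 * s).
    by rewrite /D; ring.
  apply: ler_pM => //.
  - by rewrite !mulr_ge0 ?sqr_ge0// ltW.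
  - by rewrite lerDl.
  - rewrite ler_wpM2r ?(ltW s0)// ler_wpM2r ?sqr_ge0// ler_pM//.
    by rewrite lerDl.
set v := fun t => fderiv (F t) (l, z l t) (h, u t).
have -> : th (v t0) - th (v t) = th (v t0 - quot s t0)
  + (th (quot s t0) - th (quot s t)) - th (v t - quot s t).
  by rewrite !linearB /=; zmodl.
rewrite (_ : e = e / 3 + e / 3 + e / 3); last by field.
have wt0 : w t0 <= w t0 + 1 by rewrite lerDl.
rewrite (le_trans (ler_normB _ _))// lerD ?hD//.
by rewrite (le_trans (ler_normD _ _))// lerD// hD.
Unshelve. all: by end_near. Qed.

(** The equation is solved for each direction h by [fixed_point]. The defect of linearity in h is a
    bounded solution whose source is at most c times itself, hence 0. *)
Lemma variational_solution l : B l -> exists2 v : R -> blin E Y,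
  (forall t, `|v t| <= KF * Lam / (1 - q)) &
  forall h, SolY Th (fun t => fderiv (F t) (l, z l t) (h, v t h)) (fun t => v t h).
Proof.
move=> Bl.
pose Dz t := fderiv (F t) (l, z l t).
have DzB t h u v : Dz t (h, u) - Dz t (h, v) = Dz t (0, u - v).
  rewrite -linearB; congr (Dz t _).
  by apply: injective_projections; rewrite //= subrr.
have Dz_lip t h u v : `|Dz t (h, u) - Dz t (h, v)| <= c t * `|u - v|.
  by rewrite DzB; apply: dF_snd => //; exact: z_lt.
have nh (h : E) : `|(h, 0 : Y)| = `|h| by rewrite prod_normE1 /= normr0 max_l.
have Dz0 t h : `|Dz t (h, 0)| <= KF * `|h| * w t.
  rewrite mulrAC -(nh h); apply: ler_blin2; apply: dF_le; exact: Sz.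
have KFh (h : E) : 0 <= KF * `|h| by exact: mulr_ge0.
have /choice[u uP] : forall h, exists u, SolY Th (fun t => Dz t (h, u t)) u /\
    exists M, forall t, `|u t| <= M.
  move=> h; have [u hu uM] := @fixed_point _ Th Thn Ths (fun t v => Dz t (h, v))
    (KF * `|h|) (KFh h) (fun t u v => Dz_lip t h u v) (fun t => Dz0 t h)
    (fun u M cu uM => dF_scont Bl cu uM).
  by exists u.
have u_le h t : `|u h t| <= KF * Lam / (1 - q) * `|h|.
  have [hu [M uM]] := uP h.
  have := @SolY_self_bound _ _ Thn _ _ (KF * `|h|) M hu (KFh h) uM.
  rewrite (_ : KF * `|h| * Lam / (1 - q) = KF * Lam / (1 - q) * `|h|); last by ring.
  apply=> s; rewrite -[Dz s (h, u h s)](subrK (Dz s (h, 0))).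
  rewrite (le_trans (ler_normD _ _))// lerD//.
  by rewrite (le_trans (Dz_lip _ _ _ _))// subr0.
have u_lin a h k t : u (a *: h + k) t = a *: u h t + u k t.
  have [hh [Mh uMh]] := uP h; have [hk [Mk uMk]] := uP k.
  have [hhk [Mhk uMhk]] := uP (a *: h + k).
  have hd := SolYB hhk (SolY_lin a hh hk).
  have := @SolY_eq0 _ _ _ _ (Mhk + (`|a| * Mh + Mk)) Thn hd.
  move=> /(_ _ _ t) h0; apply/eqP; rewrite -subr_eq0; apply/eqP; apply: h0 => s.
    rewrite (le_trans (ler_normB _ _))// lerD// (le_trans (ler_normD _ _))// lerD//.
    by rewrite normrZ ler_wpM2l.
  rewrite -linearP.
  have -> : a *: (h, u h s) + (k, u k s) = (a *: h + k, a *: u h s + u k s) by [].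
  exact: Dz_lip.
have [v vu vle] := lift_solutions (fun h => proj1 (uP h)) u_lin u_le.
exists v => [t|h].
  rewrite (le_trans (vle t))// ger0_norm//.
  by rewrite divr_ge0 ?mulr_ge0 ?(ltW q1_gt0).
have := proj1 (uP h); congr SolY; apply/funext => t; last by rewrite vu.
by rewrite vu.
Qed.

(** The remainder z_{l+h} - z_l - v h has a source at most c times itself plus the Taylor remainder
    LF w (1 + Lz)^2 |h|^2, so it is O(|h|^2) uniformly in t. *)
Lemma solution_hasd l (v : R -> blin E Y) t : B l ->
  (forall t, `|v t| <= KF * Lam / (1 - q)) ->
  (forall h, SolY Th (fun t => fderiv (F t) (l, z l t) (h, v t h)) (fun t => v t h)) ->
  hasd (fun m => z m t) l (v t).
Proof.
move=> Bl vle vsol e e0.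
set C1 := KF * Lam / (1 - q) in vle.
pose C2 := LF * (1 + Lz) ^+ 2 * Lam / (1 - q).
have C20 : 0 <= C2.
  by rewrite /C2 divr_ge0 ?(ltW q1_gt0)// mulr_ge0// mulr_ge0// sqr_ge0.
have /nbhs_normP[r /= r0 Br] : \forall m \near l, B m by exact: open_nbhs_nbhs.
exists (Num.min r (e / (C2 + 1))).
  by rewrite lt_min r0 divr_gt0// ltr_wpDl.
move=> h; rewrite lt_min => /andP[hr]; rewrite ltr_pdivlMr ?ltr_wpDl// => he.
have Blh : B (l + h) by apply: Br; rewrite /= opprD addNKr normrN.
have hd := SolYB (SolYB (z_sol Blh) (z_sol Bl)) (vsol h).
suff : `|z (l + h) t - z l t - v t h| <= C2 * `|h| ^+ 2.
  move=> /le_trans; apply; rewrite expr2 mulrA ler_wpM2r//.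
  by move: he; have := normr_ge0 h; nra.
have := @SolY_self_bound _ _ Thn _ _ (LF * (1 + Lz) ^+ 2 * `|h| ^+ 2)
  (rho + rho + C1 * `|h|) hd.
rewrite (_ : _ * Lam / (1 - q) = C2 * `|h| ^+ 2); last by rewrite /C2; ring.
apply=> [|s|s]; first by rewrite mulr_ge0 ?sqr_ge0// mulr_ge0// sqr_ge0.
  rewrite (le_trans (ler_normB _ _))// lerD//; last exact: ler_blin2.
  by rewrite (le_trans (ler_normB _ _))// lerD// z_le.
set D := (l + h, z (l + h) s) - (l, z l s).
have DE : D = (h, z (l + h) s - z l s).
  by apply: injective_projections => //=; rewrite addrAC subrr add0r.
have ht := taylorF s (Sz s Bl) (Sz s Blh); rewrite -/D in ht.
have -> : F s (l + h, z (l + h) s) - F s (l, z l s) - fderiv (F s) (l, z l s) (h, v s h)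
  = fderiv (F s) (l, z l s) (0, z (l + h) s - z l s - v s h) +
    (F s (l + h, z (l + h) s) - F s (l, z l s) - fderiv (F s) (l, z l s) D).
  have -> : fderiv (F s) (l, z l s) (0, z (l + h) s - z l s - v s h) =
    fderiv (F s) (l, z l s) D - fderiv (F s) (l, z l s) (h, v s h).
    rewrite -linearB DE; congr (fderiv (F s) (l, z l s) _).
    by apply: injective_projections; rewrite //= subrr.
  by zmodl.
rewrite (le_trans (ler_normD _ _))// lerD//.
  by apply: dF_snd => //; exact: z_lt.
rewrite (le_trans ht)//.
have nD : `|D| <= (1 + Lz) * `|h|.
  rewrite DE prod_norm_le /= mulrDl mul1r lerDl mulr_ge0//=.
  rewrite (le_trans (z_lip s Blh Bl))// addrAC subrr add0r.
  by rewrite lerDr.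
have nD2 : `|D| ^+ 2 <= ((1 + Lz) * `|h|) ^+ 2.
  by rewrite ler_sqr ?nnegrE// mulr_ge0// addr_ge0.
rewrite (le_trans (ler_wpM2l _ nD2)) ?mulr_ge0//.
by rewrite exprMn le_eqVlt; apply/orP; left; apply/eqP; ring.
Qed.

End Step.
(** [Y], [Th] and [F] are quantified inside the induction because the derivative of z solves an
    equation of the same form with values in B(E, Y). *)
Theorem smooth_solution n (Y : completeNormedModType R) (Th : set (blin Y X))
    (F : R -> E * Y -> Y) (z : E -> R -> Y) (rho rho' : R) :
  norming Th -> solvable Th -> 0 <= rho -> rho < rho' ->
  (forall l t, B l -> `|z l t| <= rho) ->
  (forall l, B l -> SolY Th (fun t => F t (l, z l t)) (z l)) ->
  (forall t l u v, B l -> `|u| < rho' -> `|v| < rho' ->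
     `|F t (l, u) - F t (l, v)| <= c t * `|u - v|) ->
  (forall l u r, B l -> r < rho' -> scont Th u -> (forall t, `|u t| <= r) ->
     scont Th (fun t => F t (l, u t))) ->
  cls (B `*` ball (0 : Y) rho') w true n F ->
  cls B one true n (fun t l => z l t).
Proof.
elim: n => [|n IH] in Y Th F z rho rho' *;
  move=> Thn Ths rho_ge0 rho_lt z_le z_sol F_lip F_cont clsF;
  have rho'_gt0 : 0 < rho' by exact: le_lt_trans rho_lt.
  split; first by exists rho => // t p Bp; rewrite /one mulr1; exact: z_le.
  by move=> _; apply: (solution_lip Thn rho_lt z_le z_sol F_lip) (proj2 clsF isT).
set S := B `*` ball (0 : Y) rho' in clsF.
have oS : open S by apply: open_setX oB _; exact: ball_open.
have cS : cvxset S by exact: cvxX cB (@ball_cvx _ _ _ _).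
have one_ge0 (t : R) : 0 <= one t :> R by rewrite /one.
(* First use of the induction hypothesis, for z itself with one order less: the coefficients of the
   variational equation are evaluated along z, and their class depends on it. *)
have clsz : cls B one true n (fun t l => z l t).
  by apply: (IH _ _ _ _ _ _ Thn Ths rho_ge0 rho_lt z_le z_sol F_lip F_cont);
    apply: cls_pred => //.
have [[K0 K00 FK0] dclsF] := clsF.
have [FD [[KF KF0 dFK] dclsDF]] := dcls_hasd dclsF.
have [LF LF0 dFL] := dcls_lip cS dclsDF.
have [Lz Lz0 zL] := dcls_lip cB (proj2 clsz).
have zL' t l m : B l -> B m -> `|z l t - z m t| <= Lz * `|l - m|.
  by move=> Bl Bm; have := zL t l m Bl Bm; rewrite /one mulr1.
have F_diff t p : S p -> differentiable (F t) p by move=> /(FD t)/hasd_diff.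
have /choice[v vP] : forall l, exists v : R -> blin E Y, B l ->
    (forall t, `|v t| <= KF * Lam / (1 - q)) /\
    forall h, SolY Th (fun t => fderiv (F t) (l, z l t) (h, v t h)) (fun t => v t h).
  move=> l; have [Bl|nBl] := pselect (B l); last by exists (fun=> 0).
  have [v v1 v2] := variational_solution Thn Ths rho_lt z_le z_sol F_lip F_cont
    KF0 LF0 F_diff dFK dFL Bl.
  by exists v.
set rho1 := KF * Lam / (1 - q) in vP.
have rho1_ge0 : 0 <= rho1 by rewrite divr_ge0 ?mulr_ge0 ?(ltW q1_gt0).
have z_hasd t l : B l -> hasd (fun m => z m t) l (v l t).
  move=> Bl; have [v1 v2] := vP l Bl.
  exact: (solution_hasd Thn rho_lt z_le z_sol F_lip LF0 Lz0 F_diff dFL zL' t Bl v1 v2).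
apply: (@cls_intro _ _ _ _ _ oB _ _ _ _ (fun t l => v l t)) => //.
  by exists rho => // t p Bp; rewrite /one mulr1; exact: z_le.
(* The graph map h -> (h, k h), affine in k; precomposing [fderiv (F t)] with it gives the right
   side of the variational equation for an operator k. *)
pose ext (k : blin E Y) : blin E (E * Y)%type :=
  blin_inl E Y + blin_comp (blin_inr E Y) k.
have extE k h : ext k h = (h, k h) by rewrite [RHS]pair_inlr.
pose F1 t (p : E * blin E Y) :=
  blin_compL E (E * Y)%type Y (fderiv (F t) (p.1, z p.1 t)) (ext p.2).
have F1E t l k h : F1 t (l, k) h = fderiv (F t) (l, z l t) (h, k h).
  by rewrite -extE.
have z_lt l t : B l -> `|z l t| < rho'.
  by move=> Bl; exact: le_lt_trans (z_le l t Bl) rho_lt.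
have Sz l t : B l -> S (l, z l t).
  by move=> Bl; split=> //=; rewrite -ball_normE /= sub0r normrN z_lt.
(* [F1] grows linearly in k, so its class is claimed only on a ball; any radius above the bound
   [rho1] of the derivatives will do. *)
have rho1_lt : rho1 < rho1 + 1 by rewrite ltrDl.
apply: (IH (blin E Y) (lift_th Th) F1 v rho1 (rho1 + 1)) => //.
- exact: lift_norming.
- exact: lift_solvable.
- by move=> l t Bl; have [v1 _] := vP l Bl; exact: v1.
- move=> l Bl; apply/lift_SolY => h; have [_ /(_ h)] := vP l Bl.
  by congr SolY; apply/funext => t; rewrite F1E.
- move=> t l k k' Bl _ _; apply: blin_le => [|h]; first exact: mulr_ge0.
  rewrite blinB !F1E -linearB.
  have -> : (h, k h) - (h, k' h) = (0, (k - k') h).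
    by apply: injective_projections; rewrite //= subrr.
  rewrite (le_trans (dF_snd F_lip F_diff t _ Bl (z_lt l t Bl)))//.
  by rewrite -mulrA ler_wpM2l// ler_blin.
- move=> l k r Bl _ ck kr; apply/lift_scont => h.
  have := @dF_scont _ _ _ _ _ _ rho_lt z_le z_sol F_cont _ LF0 F_diff dFL l h
    (fun t => k t h) (r * `|h|) Bl (proj1 (lift_scont _ _) ck h).
  move=> H; have {}H := H (fun t => ler_blin2 h (kr t)).
  move: H; congr scont; apply/funext => t; exact/esym/F1E.
set S1 := B `*` ball (0 : blin E Y) (rho1 + 1).
have r1 : 0 < rho1 + 1 by exact: le_lt_trans rho1_lt.
have oS1 : open S1 by apply: open_setX oB _; exact: ball_open.
have cS1 : cvxset S1 by exact: cvxX cB (@ball_cvx _ _ _ _).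
have fst_affine m : dcls S1 one true m
    (fun (_ : R) (p : E * blin E Y) => p.1).
  have := @dcls_affine R R _ S1 one oS1 true m E (blin_fst E (blin E Y)) (fun=> 0)
    (fun=> erefl).
  by apply: dcls_ext => // t p _; rewrite add0r.
apply: (@cls_bilin R R _ S1 w oS1 cS1 true n _ _ _ (blin_compL E (E * Y)%type Y)
  (fun t p => fderiv (F t) (p.1, z p.1 t)) (fun t p => ext p.2)).
- apply: (@cls_chain R R _ S1 w oS1 cS1 w_ge0 true n _ _ S oS cS
    (fun t => fderiv (F t)) (fun t p => (p.1, z p.1 t))).
  + by move=> t p [Bp _]; exact: Sz.
  + by split; [exists KF|].
  + have dz : dcls S1 one true n (fun t (p : E * blin E Y) => z p.1 t).
      have := @cls_chain R R _ S1 one oS1 cS1 one_ge0 true n _ _ B oB cB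
        (fun t l => z l t) (fun t p => p.1) _ clsz (fst_affine n).
      by case=> [t p []//|].
    have := @dclsD R R _ S1 one oS1 true n _ _ _
      (@dcls_postcomp R R _ S1 one oS1 true n _ _ (blin_inl E Y) _ (fst_affine n))
      (@dcls_postcomp R R _ S1 one oS1 true n _ _ (blin_inr E Y) _ dz).
    by apply: dcls_ext => // t p _; rewrite [RHS]pair_inlr.
- split.
    exists (`|blin_inl E Y| + `|blin_inr E Y| * (rho1 + 1)).
      by rewrite addr_ge0 ?mulr_ge0 ?(ltW r1).
    move=> t p [_]; rewrite -ball_normE /= sub0r normrN => pr.
    rewrite /one mulr1 (le_trans (ler_normD _ _))// lerD//.
    by rewrite (le_trans (blin_comp_le _ _))// ler_wpM2l// ltW.
  have := @dcls_affine R R _ S1 one oS1 true n _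
    (blin_comp (blin_postcomp (blin_inr E Y)) (blin_snd E (blin E Y)))
    (fun=> blin_inl E Y) (fun=> erefl).
  by apply: dcls_ext.
Qed.

End Smooth.

End SolutionOperator.

(** * Bounded solutions *)

Section GreenSup.
Context {R : realType} {X : completeNormedModType R}.
Context (T : R -> R -> blin X X) (P : R -> blin X X).
Notation mu := (@lebesgue_measure R).
Notation G := (green T P).

Lemma green_int_le_sup (h : R -> R) t :
  (\int[mu]_s (h s * `|G t s|)%:E <= green_sup T P h)%E.
Proof. by apply: ereal_sup_ubound; exists t. Qed.

Lemma green_sup_ge0 (h : R -> R) : (forall t, 0 <= h t) -> (0 <= green_sup T P h)%E.
Proof.
move=> h0; apply: le_trans (green_int_le_sup h 0).
by apply: integral_ge0 => s _; rewrite lee_fin mulr_ge0.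
Qed.

Lemma green_sup_fin (h : R -> R) : (forall t, 0 <= h t) ->
  (green_sup T P h < +oo)%E -> green_sup T P h \is a fin_num.
Proof. by move=> h0 hoo; rewrite ge0_fin_numE ?green_sup_ge0. Qed.

End GreenSup.

Section BoundedSolutions.
Context {R : realType} {X : completeNormedModType R}.
Context (A : R -> blin X X) (T : R -> R -> blin X X) (P : R -> blin X X).
Hypotheses (contA : continuous A) (TA : evolution_family A T)
  (contP : continuous P).
Hypothesis no_bounded : forall x : R -> X, is_solution A x ->
  (exists M : R, forall t, `|x t| <= M) -> forall t, x t = 0.
Context (c eps : R -> R) (q L : R).
Hypotheses (contc : continuous c) (c_ge0 : forall t, 0 <= c t)
  (conteps : continuous eps) (eps_ge0 : forall t, 0 <= eps t).
Notation mu := (@lebesgue_measure R).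
Notation G := (green T P).
Hypotheses
  (c_int : forall t, (\int[mu]_s (c s * `|G t s|)%:E <= q%:E)%E)
  (eps_int : forall t, (\int[mu]_s (eps s * `|G t s|)%:E <= L%:E)%E).

Let w t := c t + eps t.

Let contw : continuous w.
Proof. by move=> t; apply: cvgD; [exact: contc|exact: conteps]. Qed.

Let w_ge0 t : 0 <= w t. Proof. exact: addr_ge0. Qed.

Let mG (h : R -> R) t D : measurable D -> continuous h ->
  measurable_fun D (fun s => (h s * `|G t s|)%:E).
Proof. by move=> mD ch; exact: (green_integrand_measurable contA TA contP). Qed.

Let w_int t : (\int[mu]_s (w s * `|G t s|)%:E <= (q + L)%:E)%E.
Proof.
under eq_integral do rewrite mulrDl EFinD.
rewrite ge0_integralD//; first by rewrite EFinD leeD.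
- by move=> s _; rewrite lee_fin mulr_ge0.
- exact: mG.
- by move=> s _; rewrite lee_fin mulr_ge0.
- exact: mG.
Qed.

(** The bound of the source by a multiple of [w] gives access to Green's formula; the boundedness of
    [u] identifies [u] with what that formula produces. *)
Definition bounded_solution (g u : R -> X) :=
  [/\ continuous g, exists2 K : R, 0 <= K & forall t, `|g t| <= K * w t,
      exists M : R, forall t, `|u t| <= M &
      forall t, hasdc u t (A t (u t) + g t)].

(** [u] minus Green's solution is a bounded solution of the homogeneous equation, hence 0 by
    [no_bounded]. *)
Lemma bounded_solution_int g u : bounded_solution g u ->
  forall t, (`|u t|%:E <= \int[mu]_s (`|g s| * `|G t s|)%:E)%E.
Proof.
move=> [cg [K K0 gK] [M uM] hu].
have [v [hv vle]] := green_solution contA TA contP contw w_ge0 w_int cg K0 gK.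
suff uv : u = v by move=> t; rewrite uv.
apply/funext => t; apply/eqP; rewrite -subr_eq0; apply/eqP.
apply: (@no_bounded (fun t => u t - v t)).
  move=> s; apply/hasdcP.
  have := hasdcB (hu s) (hv s); congr hasdc.
  by rewrite linearB /=; zmodl.
exists (M + K * (q + L)) => s; rewrite (le_trans (ler_normB _ _))// lerD//.
rewrite -lee_fin; apply: le_trans (vle s) _.
exact: (green_source_le contA TA contP contw w_ge0 w_int cg K0 gK).
Qed.

Lemma bounded_solution_lin a g1 u1 g2 u2 :
  bounded_solution g1 u1 -> bounded_solution g2 u2 ->
  bounded_solution (fun t => a *: g1 t + g2 t) (fun t => a *: u1 t + u2 t).
Proof.
move=> [cg1 [K1 K10 g1K] [M1 u1M] hu1] [cg2 [K2 K20 g2K] [M2 u2M] hu2]; split.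
- by move=> t; apply: cvgD; [apply: cvgZr; exact: cg1|exact: cg2].
- exists (`|a| * K1 + K2); first by rewrite addr_ge0 ?mulr_ge0.
  move=> t; rewrite (le_trans (ler_normD _ _))// mulrDl lerD//.
  by rewrite normrZ -mulrA ler_wpM2l.
- exists (`|a| * M1 + M2) => t; rewrite (le_trans (ler_normD _ _))// lerD//.
  by rewrite normrZ ler_wpM2l.
- move=> t; have := hasdcD (hasdcZ a (hu1 t)) (hu2 t); congr hasdc.
  have -> : a *: (A t (u1 t) + g1 t) = a *: A t (u1 t) + a *: g1 t by exact: scalerDr.
  have -> : A t (a *: u1 t + u2 t) = a *: A t (u1 t) + A t (u2 t) by rewrite linearP.
  by zmodl.
Qed.

Lemma bounded_solution_cont g u : bounded_solution g u -> continuous u.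
Proof. by move=> [_ _ _ hu] t; exact: hasdc_continuous (hu t). Qed.

Lemma bounded_solution_ex g K : continuous g -> 0 <= K ->
  (forall t, `|g t| <= K * w t) -> exists u, bounded_solution g u.
Proof.
move=> cg K0 gK.
have [v [hv vle]] := green_solution contA TA contP contw w_ge0 w_int cg K0 gK.
exists v; split => //; first by exists K.
exists (K * (q + L)) => s; rewrite -lee_fin; apply: le_trans (vle s) _.
exact: (green_source_le contA TA contP contw w_ge0 w_int cg K0 gK).
Qed.

Lemma green_int_comb (f : R -> R) a b t : continuous f -> (forall s, 0 <= f s) ->
  0 <= a -> 0 <= b -> (forall s, f s <= a * c s + b * w s) ->
  (\int[mu]_s (f s * `|G t s|)%:E <= (a * q + b * (q + L))%:E)%E.
Proof.
move=> cf f0 a0 b0 fab.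
have cm (k : R) (h : R -> R) : continuous h -> continuous (fun s => k * h s).
  by move=> ch s; apply: cvgMr; exact: ch.
have cab : continuous (fun s => a * c s + b * w s).
  by move=> s; apply: cvgD; [exact: (cm a c contc)|exact: (cm b w contw)].
apply: (@le_trans _ _ (\int[mu]_s (a%:E * (c s * `|G t s|)%:E +
    b%:E * (w s * `|G t s|)%:E))%E).
  apply: ge0_le_integral => //.
  - by move=> s _; rewrite lee_fin mulr_ge0.
  - exact: mG.
  - by apply: emeasurable_funD; apply: measurable_funeM; exact: mG.
  - by move=> s _; rewrite -!EFinM -EFinD lee_fin !mulrA -mulrDl ler_wpM2r.
rewrite ge0_integralD//; last 4 first.
- by move=> s _; rewrite -EFinM lee_fin mulr_ge0// mulr_ge0.
- by apply: measurable_funeM; exact: mG.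
- by move=> s _; rewrite -EFinM lee_fin mulr_ge0// mulr_ge0.
- by apply: measurable_funeM; exact: mG.
rewrite !ge0_integralZl_EFin//.
- by rewrite EFinD !EFinM leeD// lee_wpmul2l// lee_fin.
- by move=> s _; rewrite lee_fin mulr_ge0.
- exact: mG.
- by move=> s _; rewrite lee_fin mulr_ge0.
- exact: mG.
Qed.

Lemma bounded_solution_bound g u a b : bounded_solution g u -> 0 <= a -> 0 <= b ->
  (forall t, `|g t| <= a * c t + b * w t) ->
  forall t, `|u t| <= a * q + b * (q + L).
Proof.
move=> gu a0 b0 gab t; rewrite -lee_fin.
apply: le_trans (bounded_solution_int gu t) _.
apply: green_int_comb => //.
by case: gu => cg _ _ _ s; apply: cvg_norm; exact: cg.
Qed.

(* By induction on [j], the upper limit of [|d n s|] is at most [M q^j] for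
   every [s]: what exceeds [M q^j] tends to [0] pointwise, so that its Green
   integral tends to [0] by dominated convergence. *)
Lemma bounded_solution_cvg0 (g d : nat -> R -> X) (m : nat -> R -> R) (M K : R) t :
  q < 1 -> (forall n, bounded_solution (g n) (d n)) ->
  (forall n s, `|d n s| <= M) -> 0 <= K ->
  (forall n, continuous (m n)) -> (forall n s, 0 <= m n s <= K * w s) ->
  (forall s, (fun n => m n s) @ \oo --> 0) ->
  (forall n s, `|g n s| <= c s * `|d n s| + m n s) ->
  (fun n => `|d n t|) @ \oo --> 0.
Proof.
move=> q1 gd dM K0 cm mK m0 gm.
have M0 : 0 <= M by exact: le_trans (normr_ge0 _) (dM 0%N 0).
have q0 : 0 <= q.
  rewrite -lee_fin; apply: le_trans (c_int 0).
  by apply: integral_ge0 => s _; rewrite lee_fin mulr_ge0.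
have L0 : 0 <= L.
  rewrite -lee_fin; apply: le_trans (eps_int 0).
  by apply: integral_ge0 => s _; rewrite lee_fin mulr_ge0.
pose p Q n s : R := Num.max 0 (`|d n s| - Q).
have cd n : continuous (fun s => `|d n s|).
  by move=> s; apply: cvg_norm; exact: bounded_solution_cont (gd n) s.
have p_ge0 Q n s : 0 <= p Q n s by rewrite le_max lexx.
have p_le Q n s : 0 <= Q -> p Q n s <= M.
  by move=> Q0; rewrite ge_max M0 (le_trans _ (dM n s))// gerBl.
have step Q s : 0 <= Q -> (forall r, (fun n => p Q n r) @ \oo --> 0) ->
    (fun n => p (Q * q) n s) @ \oo --> 0.
  move=> Q0 pQ.
  (* Since |d n| <= Q + p Q n, the source is at most Q c + e n: the first part contributes at most Q
     q, the second tends to 0 pointwise below the integrable (M + K) w |G|. *)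
  pose e n r := c r * p Q n r + m n r.
  have e_ge0 n r : 0 <= e n r.
    by rewrite addr_ge0 ?mulr_ge0//; case/andP: (mK n r).
  have ce n : continuous (e n).
    move=> r; apply: cvgD; last exact: cm.
    apply: cvgM; first exact: contc.
    apply: (@continuous_max _ _ (fun=> 0) (fun s => `|d n s| - Q)).
      exact: cvg_cst.
    by apply: cvgB; [exact: cd|exact: cvg_cst].
  have eMK n r : e n r <= 0 * c r + (M + K) * w r.
    rewrite mul0r add0r mulrDl lerD//; last by case/andP: (mK n r).
    rewrite mulrC ler_pM// ?p_le//; by rewrite lerDl.
  have MK0 : 0 <= M + K by exact: addr_ge0.
  have int_le n := @green_int_comb _ 0 (M + K) s (ce n) (e_ge0 n) (lexx 0) MK0 (eMK n).
  have int_ge0 n : (0 <= \int[mu]_r (e n r * `|G s r|)%:E)%E.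
    by apply: integral_ge0 => r _; rewrite lee_fin mulr_ge0.
  have int_fin n : (\int[mu]_r (e n r * `|G s r|)%:E)%E \is a fin_num.
    by rewrite ge0_fin_numE// (le_lt_trans (int_le n))// ltry.
  have int0 : (fun n => \int[mu]_r (e n r * `|G s r|)%:E)%E @ \oo --> 0%E.
    have -> : 0%E = (\int[mu]_(r in [set: R]) 0)%E by rewrite integral0.
    apply: (@dominated_cvg _ _ _ mu setT measurableT
       (fun n r => (e n r * `|G s r|)%:E) (fun=> 0%E)
       (fun r => ((M + K) * w r * `|G s r|)%:E)) => //.
    - by move=> n; exact: mG.
    - move=> r _; apply: cvg_EFin; first exact: nearW.
      rewrite -[0](mul0r `|G s r|); apply: cvgMl.
      rewrite -[0](addr0 0) -{1}[0](mulr0 (c r)).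
      by apply: cvgD; [apply: cvgMr; exact: pQ|exact: m0].
    - apply/integrableP; split.
        apply: (mG s measurableT) => r; apply: cvgMr; exact: contw.
      under eq_integral do rewrite gee0_abs ?lee_fin ?mulr_ge0//.
      have wc : continuous (fun r => (M + K) * w r).
        by move=> r; apply: cvgMr; exact: contw.
      apply: le_lt_trans (@green_int_comb _ 0 (M + K) s wc _ (lexx 0) MK0 _) _.
      + by move=> r; exact: mulr_ge0.
      + by move=> r; rewrite mul0r add0r.
      + exact: ltry.
    - move=> n r _; rewrite gee0_abs ?lee_fin ?mulr_ge0// ler_wpM2r//.
      by have := eMK n r; rewrite mul0r add0r.
  have int0' : (fun n => fine (\int[mu]_r (e n r * `|G s r|)%:E)%E) @ \oo --> 0.
    exact: fine_cvg int0.
  apply: (@squeeze_cvgr _ _ _ _ (fun=> 0) (fun n => fine (\int[mu]_r (e n r * `|G s r|)%:E)%E)) => //; last exact: cvg_cst.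
  apply: nearW => n; rewrite p_ge0/= ge_max fine_ge0//=.
  rewrite lerBlDr -lee_fin EFinD fineK// addeC.
  apply: le_trans (bounded_solution_int (gd n) s) _.
  have gn_le r : `|g n r| <= Q * c r + e n r.
    have hd : `|d n r| <= Q + p Q n r by rewrite -lerBlDl le_max lexx orbT.
    have hcd : c r * `|d n r| <= c r * (Q + p Q n r) by exact: ler_wpM2l.
    by rewrite (le_trans (gm n r))// /e addrA lerD2r [Q * _]mulrC -mulrDr.
  have cgn : continuous (fun r => `|g n r|).
    by case: (gd n) => cg _ _ _ r; apply: cvg_norm; exact: cg.
  apply: (@le_trans _ _ (\int[mu]_r (Q%:E * (c r * `|G s r|)%:E +
      (e n r * `|G s r|)%:E))%E).
    apply: ge0_le_integral => //.
    - exact: mG.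
    - by apply: emeasurable_funD; [apply: measurable_funeM|]; exact: mG.
    - by move=> r _; rewrite -EFinM -EFinD lee_fin mulrA -mulrDl ler_wpM2r.
  rewrite ge0_integralD//; last 4 first.
  - by move=> r _; rewrite -EFinM lee_fin mulr_ge0// mulr_ge0.
  - by apply: measurable_funeM; exact: mG.
  - by move=> r _; rewrite lee_fin mulr_ge0.
  - exact: mG.
  rewrite leeD2r// ge0_integralZl_EFin//.
  - by rewrite EFinM lee_wpmul2l// lee_fin.
  - by move=> r _; rewrite lee_fin mulr_ge0.
  - exact: mG.
have qM j : 0 <= M * q ^+ j by rewrite mulr_ge0// exprn_ge0.
(* For j = 0 nothing exceeds the level M; each [step] lowers the level by a factor q. *)
have pj j s : (fun n => p (M * q ^+ j) n s) @ \oo --> 0.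
  elim: j s => [|j IH] s.
    rewrite (_ : (fun n => _) = fun=> 0); first exact: cvg_cst.
    by apply/funext => n; rewrite /p expr0 mulr1 max_l// subr_le0.
  by rewrite exprSr mulrA; apply: step.
have Mq : (fun j => M * q ^+ j) @ \oo --> 0.
  rewrite -[0](mulr0 M); apply: cvgMr.
  by apply: cvg_expr; rewrite ger0_norm.
apply/cvgrPdist_lt => r r0.
have r2 : 0 < r / 2 by rewrite divr_gt0.
have /cvgrPdist_lt/(_ _ r2)[j _ /(_ j (leqnn _))] := Mq.
rewrite /= sub0r normrN ger0_norm// => Mj.
have /cvgrPdist_lt/(_ _ r2) := pj j t.
apply: filterS => n; rewrite !sub0r !normrN normr_id ger0_norm// => pn.
have : `|d n t| - M * q ^+ j <= p (M * q ^+ j) n t by rewrite le_max lexx orbT.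
lra.
Qed.

End BoundedSolutions.

(** * The equation of the difference x - y *)

Lemma fderivn_fderiv_le {R : realType} {U V : normedModType R} n (S : set U)
    (g : U -> V) p : open S -> diffn n S (fderiv g) -> S p ->
  `|fderivn n (fderiv g) p| <= `|fderivn n.+1 g p|.
Proof.
move=> oS gn Sp; have := fderivnS_curry oS gn Sp.
by move=> /(congr1 (uncurryS U V n)); rewrite currySK => <-; exact: uncurryS_le.
Qed.

Lemma dcls_weight {R : realType} {I : Type} {U V : normedModType R} (S : set U)
    (w w' : I -> R) b n (g : I -> U -> V) : (forall t, w t <= w' t) ->
  dcls S w b n g -> dcls S w' b n g.
Proof.
move=> ww'; case: n => [dg bT|n [dg bg cg]].
  have [K K0 gK] := dg bT; exists K => // t p q Sp Sq.
  by rewrite (le_trans (gK t p q Sp Sq))// ler_wpM2r// ler_wpM2l.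
by have [] := cls_weight ww' (conj bg cg).
Qed.

Section Perturbation.
Context {R : realType} {E X : completeNormedModType R} (B : set E).
Hypotheses (oB : open B) (cB : cvxset B).
Context (f : E -> R -> X -> X) (y : E -> R -> X) (c eps : R -> R).
Context (n : nat) (C M rho' : R).
Hypotheses (c_ge0 : forall t, 0 <= c t) (eps_ge0 : forall t, 0 <= eps t)
  (C_ge0 : 0 <= C) (M_ge0 : 0 <= M) (rho'_gt0 : 0 < rho').
Let SX : set (E * X) := B `*` [set: X].
Let S : set (E * X) := B `*` ball (0 : X) rho'.
Let w t := c t + eps t.
Let f2 t (p : E * X) := f p.1 t p.2.
Hypotheses
  (f_lip : forall t l u v, B l -> `|f l t u - f l t v| <= c t * `|u - v|)
  (f_diff : forall t, diffn n.+2 SX (f2 t))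
  (f_bound : forall (i j : nat) (t : R) (l : E) (v : X),
     (2 <= i <= n.+2)%N -> (j <= i)%N -> B l ->
     `|partialn (i - j) j (fun l' => f l' t) l v| <= C * eps t)
  (y_diff : forall t, diffn n.+2 B (fun l => y l t))
  (y_bound : forall (i : nat) (t : R) (l : E), (1 <= i <= n.+2)%N -> B l ->
     `|fderivn i (fun l' => y l' t) l| <= M).

Let w_ge0 t : 0 <= w t. Proof. exact: addr_ge0. Qed.
Let one_ge0 (t : R) : 0 <= one t :> R. Proof. by rewrite /one. Qed.
Let oSX : open SX. Proof. by apply: open_setX oB _; exact: openT. Qed.
Let cSX : cvxset SX.
Proof. by apply: cvxX cB _ => p q _ _ s _. Qed.
Let oS : open S. Proof. by apply: open_setX oB _; exact: ball_open. Qed.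
Let cS : cvxset S. Proof. exact: cvxX cB (@ball_cvx _ _ _ _). Qed.

Let df t := fderiv (f2 t).

Let f2_diff t p : SX p -> differentiable (f2 t) p.
Proof. by have [+ _] := proj1 (diffnS n.+1 (f2 t) oSX) (f_diff t); apply. Qed.

(** Derivatives of [df] of orders 1 to n + 1 are those of [f] of orders 2 to n + 2, exactly the
    bounded ones; [dcls] leaves the size of [df] free. *)
Let df_dcls : dcls SX w false n.+1 df.
Proof.
have dfn t := proj2 (proj1 (diffnS n.+1 (f2 t) oSX) (f_diff t)).
pose K := 2 ^+ n.+2 * C.
have K0 : 0 <= K by rewrite mulr_ge0// exprn_ge0.
apply: (@dcls_weight _ _ _ _ _ eps); first by move=> t; rewrite lerDr.
apply: (@dcls_of_bounds _ _ _ _ _ _ _ _ K oSX K0 dfn) => j t [l v] /andP[j1 jn] [/= Bl _].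
have dj : diffn j SX (df t) by exact: diffn_le (dfn t).
rewrite (le_trans (fderivn_fderiv_le oSX dj _))//.
have := @fderivn_le_partialn _ _ _ _ B (fun l' => f l' t) j.+1 (C * eps t) l v oB.
move=> /(_ _ Bl _ _) h; apply: le_trans (h _ _ _) _.
- exact: diffn_le (f_diff t).
- exact: mulr_ge0.
- by move=> i ij; apply: f_bound => //; rewrite ltnS j1.
- rewrite mulrA ler_wpM2r// ler_wpM2r// ler_weXn2l ?ler1n//.
Qed.

Let fst_affine m : dcls S one false m (fun (_ : R) (p : E * X) => p.1).
Proof.
have := @dcls_affine R R _ S one oS false m E (blin_fst E X) (fun=> 0) (fun=> erefl).
by apply: dcls_ext => // t p _; rewrite add0r.
Qed.

Let y_dcls : dcls B one false n.+2 (fun t l => y l t).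
Proof.
apply: (@dcls_of_bounds _ _ _ _ _ one n.+2 (fun t l => y l t) M oB M_ge0 y_diff).
by move=> j t p jn Bp; rewrite /one mulr1; exact: y_bound.
Qed.

(** [psi] and [phi] give the two points (l, y) and (l, y + u) at which the increment evaluates
    [f]. *)
Let psi t (p : E * X) := (p.1, y p.1 t).
Let phi t (p : E * X) := psi t p + blin_comp (blin_inr E X) (blin_snd E X) p.

Let psi_dcls : dcls S one false n.+2 psi.
Proof.
have dy : dcls S one false n.+2 (fun t (p : E * X) => y p.1 t).
  exact: (@dcls_chain R R _ S one oS cS one_ge0 false n.+2 _ _ B oB cB
    (fun t l => y l t) (fun t p => p.1) (fun t p => @proj1 _ _) y_dcls (fst_affine n.+2)).
have := @dclsD R R _ S one oS false n.+2 _ _ _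
  (@dcls_postcomp R R _ S one oS false n.+2 _ _ (blin_inl E X) _ (fst_affine n.+2))
  (@dcls_postcomp R R _ S one oS false n.+2 _ _ (blin_inr E X) _ dy).
by apply: dcls_ext => // t p _; rewrite /psi [RHS]pair_inlr.
Qed.

Let phi_dcls : dcls S one false n.+2 phi.
Proof.
have := @dclsD R R _ S one oS false n.+2 _ _ _ psi_dcls
  (@dcls_affine R R _ S one oS false n.+2 _
     (blin_comp (blin_inr E X) (blin_snd E X)) (fun=> 0) (fun=> erefl)).
by apply: dcls_ext => // t p _; rewrite add0r.
Qed.

Let phiE t p : phi t p = (p.1, y p.1 t + p.2).
Proof. by apply: injective_projections; rewrite /= ?addr0. Qed.

Let S_psi t p : S p -> SX (psi t p). Proof. by case. Qed.
Let S_phi t p : S p -> SX (phi t p). Proof. by rewrite phiE; case. Qed.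

Let df_snd t p v : SX p -> `|df t p (0, v)| <= c t * `|v|.
Proof.
case: p => l u [/= Bl _].
have Sp : SX (l, u) by [].
apply: hasd_dir_le (diff_hasd (f2_diff t Sp)) _.
exists 1 => // s /andP[s0 _].
have -> : (l, u) + s *: (0, v) = (l, u + s *: v).
  by apply: injective_projections; rewrite /= ?scaler0 ?addr0.
rewrite /f2 /= (le_trans (f_lip t _ _ Bl))//.
rewrite (_ : u + s *: v - u = s *: v); last by rewrite addrAC subrr add0r.
by rewrite normrZ gtr0_norm// mulrCA mulrC.
Qed.

Let Q t p := df t (phi t p) - df t (psi t p).

(** Neither term of [Q] is known to be bounded, but the second derivatives of [f] make [df]
    Lipschitz and the two points are less than rho' apart. *)
Let Q_cls : cls S w false n.+1 Q.
Proof.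
split.
  have [K K0 dfL] := dcls_lip cSX (dcls_true cSX df_dcls).
  exists (K * rho'); first by rewrite mulr_ge0// ltW.
  move=> t p Sp.
  rewrite (le_trans (dfL t _ _ (S_phi t Sp) (S_psi t Sp)))//.
  rewrite mulrAC ler_wpM2r// ler_wpM2l//.
  rewrite /phi addrAC subrr add0r.
  have -> : blin_comp (blin_inr E X) (blin_snd E X) p = (0, p.2) by [].
  rewrite prod_norm_le /= normr0 (ltW rho'_gt0)/= ltW//.
  by case: Sp => _; rewrite -ball_normE /= sub0r normrN.
have d1 := dcls_chain oS cS w_ge0 oSX cSX (fun t p => @S_phi t p) df_dcls (dcls_pred cS phi_dcls).
have d2 := dcls_chain oS cS w_ge0 oSX cSX (fun t p => @S_psi t p) df_dcls (dcls_pred cS psi_dcls).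
have d3 := @dcls_postcomp R R _ S w oS false n.+1 _ _ (- blin_id _) _ d2.
exact: (@dclsD R R _ S w oS false n.+1 _ _ _ d1 d3).
Qed.

Let in2 : blin (E * X)%type (E * X)%type := blin_comp (blin_inr E X) (blin_snd E X).

Let N_cls : cls S w false n.+1 (fun t p => blin_precomp in2 (df t (psi t p))).
Proof.
split.
  exists 1 => // t p Sp; apply: blin_le => [|u]; first by rewrite mul1r.
  rewrite mul1r (le_trans (df_snd _ _ (S_psi t Sp)))//.
  rewrite ler_pM//; first by rewrite lerDl.
  exact: prod_norm_snd.
apply: (@dcls_postcomp R R _ S w oS false n.+1 _ _ (blin_precomp in2)
  (fun t p => df t (psi t p))).
exact: (@dcls_chain R R _ S w oS cS w_ge0 false n.+1 _ _ SX oSX cSX df psi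
  (fun t p => @S_psi t p) df_dcls (dcls_pred cS psi_dcls)).
Qed.

(** As phi' = psi' + [in2], the derivative df(phi) phi' - df(psi) psi' equals Q phi' + df(psi)
    [in2]. The last term sees only the X-direction of [df], where the Lipschitz constant [c] of [f]
    bounds it ([N_cls]). *)
Lemma increment_cls :
  cls S w false n.+2 (fun t p => f p.1 t (y p.1 t + p.2) - f p.1 t (y p.1 t)).
Proof.
have [phiD phi_cls] := dcls_hasd phi_dcls.
have [psiD psi_cls] := dcls_hasd psi_dcls.
apply: (@cls_intro R R _ S w oS false n.+1 _ _ (fun t p =>
  blin_compL (E * X)%type (E * X)%type X (Q t p) (fderiv (phi t) p) +
  blin_precomp in2 (df t (psi t p)))).
- exists rho'; first exact: ltW.
  move=> t p [Bp]; rewrite -ball_normE /= sub0r normrN => p2.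
  rewrite (le_trans (f_lip t _ _ Bp))// (addrAC (y p.1 t)) subrr add0r mulrC.
  by rewrite ler_pM ?(ltW p2)// lerDl.
- move=> t p Sp.
  have phiD' : fderiv (phi t) p = fderiv (psi t) p + in2.
    by rewrite (hasd_fderiv (hasdD (psiD t p Sp) (hasd_blin in2 p))).
  have h1 := hasd_comp (diff_hasd (f2_diff t (S_phi t Sp))) (phiD t p Sp).
  have h2 := hasd_comp (diff_hasd (f2_diff t (S_psi t Sp))) (psiD t p Sp).
  have := hasdB h1 h2.
  have -> : (fun q => (f2 t \o phi t) q - (f2 t \o psi t) q) =
      (fun q => f q.1 t (y q.1 t + q.2) - f q.1 t (y q.1 t)).
    by apply/funext => q; rewrite /= phiE.
  congr hasd; apply/blin_eqP => u.
  change (df t (phi t p) (fderiv (phi t) p u) - df t (psi t p) (fderiv (psi t) p u) =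
    df t (phi t p) (fderiv (phi t) p u) - df t (psi t p) (fderiv (phi t) p u) +
    df t (psi t p) (in2 u)).
  move: phiD'; move: (fderiv (phi t) p) (fderiv (psi t) p) => a b ->.
  move: (df t (psi t p)) (df t (phi t p)) => D D'.
  have -> : D ((b + in2) u) = D (b u) + D (in2 u) by rewrite blinD linearD.
  by zmodl.
- apply: (@clsD R R _ S w oS false n.+1 _ (fun t p =>
    blin_compL (E * X)%type (E * X)%type X (Q t p) (fderiv (phi t) p)) _ _ N_cls).
  exact: (@cls_bilin R R _ S w oS cS false n.+1 _ _ _ (blin_compL _ _ _)
    Q (fun t => fderiv (phi t)) Q_cls phi_cls).
Qed.

Context (r : R -> E -> X).
Hypothesis r_cls : cls B w false n.+2 r.

Lemma perturbation_cls :
  cls S w true n.+1 (fun t p => f p.1 t (y p.1 t + p.2) - f p.1 t (y p.1 t) - r t p.1).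
Proof.
have rS := @cls_chain R R _ S w oS cS w_ge0 false n.+2 _ _ B oB cB r
    (fun t p => p.1) (fun t p => @proj1 _ _) r_cls (fst_affine n.+2).
exact: (cls_true cS (@clsB R R _ S w oS false n.+2 _ _ _ increment_cls rS)).
Qed.

End Perturbation.

(** Only qualitative, hence local: near each point [Ck_local] supplies bounds, and the chain rule
    for classes applies. *)
Lemma diffn_graph {R : realType} {U V W : normedModType R} n (S : set U)
    (g : U * V -> W) (y : U -> V) : open S ->
  Ck n (S `*` [set: V]) g -> Ck n S y -> diffn n S (fun l => g (l, y l)).
Proof.
move=> oS cg cy j p jn Sp.
have oSV : open (S `*` [set: V]) by apply: open_setX oS _; exact: openT.
have [r1 r10 [_ [_ dg]]] := Ck_local oSV cg (conj Sp I : (S `*` [set: V]) (p, y p)).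
have [r2 r20 [_ dy]] := Ck_local oS cy Sp.
have yc : {for p, continuous y} by have [_ /(_ p Sp)] := Ck_le (leq0n n) cy.
have : \forall q \near p, ball p r2 q /\ ball (p, y p) r1 (q, y q).
  apply: filterI; first exact: nbhsx_ballx.
  have h1 : \forall q \near p, ball p r1 q by exact: nbhsx_ballx.
  have h2 : \forall q \near p, ball (y p) r1 (y q) by apply: yc; exact: nbhsx_ballx.
  by apply: filterS2 h1 h2 => q q1 q2; split.
move=> /nbhs_ballP[r /= r0 rP].
have ob : open (ball p r) by exact: ball_open.
have cb : cvxset (ball p r) by exact: ball_cvx.
have one_ge0 (t : unit) : 0 <= one t :> R by rewrite /one.
have [_ dy'] := cls_sub (fun q pq => proj1 (rP q pq)) dy.
have dpair : dcls (ball p r) one false n (fun (_ : unit) q => (q, y q)).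
  have h1 := @dcls_affine R unit U (ball p r) one ob false n _ (blin_inl U V) (fun=> 0) (fun=> erefl).
  have h2 := @dcls_postcomp R unit U (ball p r) one ob false n _ _ (blin_inr U V) _ dy'.
  apply: dcls_ext (@dclsD R unit U (ball p r) one ob false n _ _ _ h1 h2) => // t q _.
  by rewrite add0r /=; congr pair; rewrite ?addr0 ?add0r.
have ob1 : open (ball (p, y p) r1) by exact: ball_open.
have := @dcls_chain R unit U (ball p r) one ob cb one_ge0 false n _ _
  (ball (p, y p) r1) ob1 (@ball_cvx _ _ _ _) (fun=> g) _
  (fun _ q pq => proj2 (rP q pq)) dg dpair.
move=> /(dcls_diffn tt ob)/(_ j p jn); apply; exact: ballxx.
Qed.

(** * Regularity of the solution near the approximate one *)

Section Shadowing.
Context {R : realType} {X E : completeNormedModType R} (Sigma : set E).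
Hypothesis oSigma : open Sigma.
Context (A : R -> blin X X) (T : R -> R -> blin X X) (P : R -> blin X X).
Hypotheses (contA : continuous A) (TA : evolution_family A T)
  (contP : continuous P).
Hypothesis no_bounded : forall x : R -> X, is_solution A x ->
  (exists M : R, forall t, `|x t| <= M) -> forall t, x t = 0.
Context (c eps : R -> R) (q L rho : R).
Hypotheses (contc : continuous c) (c_ge0 : forall t, 0 <= c t)
  (conteps : continuous eps) (eps_ge0 : forall t, 0 <= eps t)
  (q_lt1 : q < 1) (rho_ge0 : 0 <= rho).
Hypotheses
  (c_int : forall t,
     (\int[@lebesgue_measure R]_s (c s * `|green T P t s|)%:E <= q%:E)%E)
  (eps_int : forall t,
     (\int[@lebesgue_measure R]_s (eps s * `|green T P t s|)%:E <= L%:E)%E).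
Context (f : E -> R -> X -> X) (x y : E -> R -> X).
Hypotheses
  (contf : forall l, Sigma l -> continuous (fun p : R * X => f l p.1 p.2))
  (lipf : forall t l u v, Sigma l -> `|f l t u - f l t v| <= c t * `|u - v|)
  (y_C1 : forall l, Sigma l ->
     (forall t, derivable (y l) t 1) /\ continuous (derive1 (y l)))
  (y_approx : forall l t, Sigma l ->
     `|derive1 (y l) t - A t (y l t) - f l t (y l t)| <= eps t)
  (x_sol : forall l, Sigma l -> is_solution (fun t v => A t v + f l t v) (x l))
  (x_near_y : forall l t, Sigma l -> `|x l t - y l t| <= rho).

Let w t := c t + eps t.
Let z l t := x l t - y l t.
Let F t (p : E * X) := f p.1 t (y p.1 t + p.2) - derive1 (y p.1) t + A t (y p.1 t).
Let r t l := derive1 (y l) t - A t (y l t) - f l t (y l t).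

Let contw : continuous w.
Proof. by move=> t; apply: cvgD; [exact: contc|exact: conteps]. Qed.

Let y_hasdc l t : Sigma l -> hasdc (y l) t (derive1 (y l) t).
Proof.
by move=> Sl; apply/hasdcP; rewrite derive1E; apply/derivableP; exact: (proj1 (y_C1 Sl)).
Qed.

Let y_cont l : Sigma l -> continuous (y l).
Proof. by move=> Sl t; exact: hasdc_continuous (y_hasdc t Sl). Qed.

Let F_cont l (u : R -> X) : Sigma l -> continuous u ->
  continuous (fun t => F t (l, u t)).
Proof.
move=> Sl cu t; rewrite /F /=; apply: cvgD; last first.
  by apply: blin_app_continuous; [exact: contA|exact: y_cont].
apply: cvgB; last exact: (proj2 (y_C1 Sl)).
apply: (@cvg_comp _ _ _ (fun s => (s, y l s + u s)) (fun p : R * X => f l p.1 p.2)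
   _ (nbhs (t, y l t + u t))); last exact: (@contf l Sl (t, y l t + u t)).
have h1 : (fun s : R => s) @ t --> t by exact: cvg_id.
have h2 : (fun s => y l s + u s) @ t --> y l t + u t.
  by apply: cvgD; [exact: y_cont|exact: cu].
exact: cvg_pair h1 h2.
Qed.

Let F_lip t l u v : Sigma l -> `|F t (l, u) - F t (l, v)| <= c t * `|u - v|.
Proof.
move=> Sl; have := lipf t (y l t + u) (y l t + v) Sl.
rewrite /F /=.
have -> : y l t + u - (y l t + v) = u - v by zmodl.
by congr (`|_| <= _); zmodl.
Qed.

(** At u = 0 the source is minus the residual of y. *)
Let F_bound t l u : Sigma l -> `|F t (l, u)| <= c t * `|u| + eps t.
Proof.
move=> Sl; have F0 : `|F t (l, 0)| <= eps t.
  have := y_approx t Sl; rewrite -normrN /F /= addr0.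
  by congr (`|_| <= _); zmodl.
have := F_lip t u 0 Sl; rewrite subr0 => h.
rewrite (_ : F t (l, u) = (F t (l, u) - F t (l, 0)) + F t (l, 0)); last by zmodl.
by rewrite (le_trans (ler_normD _ _))// lerD.
Qed.

Let F_bound_rho t l u : Sigma l -> `|u| <= rho -> `|F t (l, u)| <= (rho + 1) * w t.
Proof.
move=> Sl ur; rewrite (le_trans (F_bound t _ Sl))// mulrDr lerD//.
  by rewrite mulrC ler_wpM2r// (le_trans ur)// lerDl.
by rewrite ler_peMl// lerDr.
Qed.

Let z_sol l : Sigma l -> bounded_solution A c eps (fun t => F t (l, z l t)) (z l).
Proof.
move=> Sl.
have xh t : hasdc (x l) t (A t (x l t) + f l t (x l t)).
  by apply/hasdcP; exact: x_sol.
have zh t : hasdc (z l) t (A t (z l t) + F t (l, z l t)).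
  have := hasdcB (xh t) (y_hasdc t Sl); congr hasdc.
  rewrite /F /z /=.
  have -> : A t (x l t - y l t) = A t (x l t) - A t (y l t) by rewrite linearB.
  have -> : y l t + (x l t - y l t) = x l t by zmodl.
  by zmodl.
split=> //.
- by apply: F_cont => // t; exact: hasdc_continuous (zh t).
- exists (rho + 1); first by rewrite addr_ge0.
  by move=> t; apply: F_bound_rho => //; exact: x_near_y.
- by exists rho => t; exact: x_near_y.
Qed.

(** Dominated convergence is sequential, so discontinuity is refuted along a sequence of parameters
    tending to [mu]. The differences [d n] satisfy [bounded_solution_cvg0], with [m n] the change of
    the source when only the parameter moves; it tends to 0 pointwise in time. *)
Lemma shadow_continuous mu t :
  (forall s p, Sigma p.1 -> {for p, continuous (fun p : E * X => f p.1 s p.2)}) ->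
  (forall s l, Sigma l -> {for l, continuous (fun l => y l s)}) ->
  (forall s l, Sigma l -> {for l, continuous (fun l => derive1 (y l) s)}) ->
  Sigma mu -> {for mu, continuous (fun l => x l t)}.
Proof.
move=> fc yc dyc Smu.
suff zc : {for mu, continuous (fun l => z l t)}.
  rewrite (_ : (fun l => x l t) = (fun l => z l t + y l t)).
    by apply: cvgD; [exact: zc|exact: yc].
  by apply/funext => l; rewrite /z subrK.
apply/cvgrPdist_lt => e e0; apply: contrapT => H.
have ex n : exists l, [/\ Sigma l, `|mu - l| < n.+1%:R^-1 & e <= `|z mu t - z l t|].
  apply: contrapT => /forallNP K; apply: H.
  have h1 : \forall l \near mu, Sigma l by exact: (open_near oSigma).
  have h2 : \forall l \near mu, `|mu - l| < n.+1%:R^-1.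
    by apply/nbhs_normP; exists n.+1%:R^-1 => //=; rewrite invr_gt0.
  apply: filterS2 h1 h2 => l Sl ml; rewrite ltNge; apply/negP => el.
  by apply: (K l).
have [lam lamP] := choice ex.
have Slam n : Sigma (lam n) by case: (lamP n).
have lam_cvg : lam @ \oo --> mu.
  apply/cvgrPdist_lt => d d0.
  have := near_infty_natSinv_lt (PosNum d0); apply: filterS => n /= nd.
  by apply: lt_trans nd; case: (lamP n).
pose g n s := -1 *: F s (mu, z mu s) + F s (lam n, z (lam n) s).
pose d n s := -1 *: z mu s + z (lam n) s.
pose m n s := `|F s (lam n, z mu s) - F s (mu, z mu s)|.
have gd n : bounded_solution A c eps (g n) (d n).
  exact: (bounded_solution_lin (-1) (z_sol Smu) (z_sol (Slam n))).
have z_cont l : Sigma l -> continuous (z l).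
  by move=> Sl; exact: bounded_solution_cont (z_sol Sl).
have dM n s : `|d n s| <= rho + rho.
  by rewrite /d scaleN1r (le_trans (ler_normD _ _))// normrN lerD//; exact: x_near_y.
have K0 : 0 <= (rho + 1) + (rho + 1) by rewrite !addr_ge0.
have cm n : continuous (m n).
  move=> s; apply: cvg_norm; apply: cvgB; apply: F_cont => //; exact: z_cont.
have mK n s : 0 <= m n s <= ((rho + 1) + (rho + 1)) * w s.
  rewrite normr_ge0 /= (le_trans (ler_normB _ _))// mulrDl.
  by rewrite lerD// F_bound_rho// x_near_y.
have m0 s : (fun n => m n s) @ \oo --> 0.
  have Fc : {for mu, continuous (fun l => F s (l, z mu s))}.
    rewrite /F /=; apply: cvgD; last first.
      by apply: (@cvg_comp _ _ _ (fun l => y l s) (A s) _ (nbhs (y mu s)));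
        [exact: yc|exact: blin_continuous].
    apply: cvgB; last exact: dyc.
    have h1 : (fun l : E => l) @ mu --> mu by exact: cvg_id.
    have h2 : (fun l => y l s + z mu s) @ mu --> y mu s + z mu s.
      by apply: cvgD; [exact: yc|exact: cvg_cst].
    apply: (@cvg_comp _ _ _ (fun l => (l, y l s + z mu s)) (fun p : E * X => f p.1 s p.2)
       _ (nbhs (mu, y mu s + z mu s))); first exact: cvg_pair h1 h2.
    exact: (fc s (mu, y mu s + z mu s)).
  have h := @cvg_comp _ _ _ lam (fun l => F s (l, z mu s)) _ _ _ lam_cvg Fc.
  rewrite -(@normr0 _ X) -(subrr (F s (mu, z mu s))).
  by apply: cvg_norm; apply: cvgB h _; exact: cvg_cst.
have gm n s : `|g n s| <= c s * `|d n s| + m n s.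
  rewrite /g /d !scaleN1r.
  rewrite (_ : - _ + _ = (F s (lam n, z (lam n) s) - F s (lam n, z mu s)) +
    (F s (lam n, z mu s) - F s (mu, z mu s))); last by zmodl.
  rewrite (le_trans (ler_normD _ _))// lerD2r [_ + z (lam n) s]addrC.
  exact: F_lip.
have := bounded_solution_cvg0 contA TA contP no_bounded contc c_ge0 conteps eps_ge0
  c_int eps_int t q_lt1 gd dM K0 cm mK m0 gm.
move=> /cvgrPdist_lt/(_ e e0)[N _ /(_ N (leqnn N))].
rewrite /= sub0r normrN normr_id /d scaleN1r -normrN opprD opprK.
by case: (lamP N) => _ _; rewrite leNgt => /negP.
Qed.

Section SmoothShadow.
Context (B : set E) (n : nat) (C M : R).
Hypotheses (oB : open B) (cB : cvxset B) (BSigma : B `<=` Sigma).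
Hypotheses (C_ge0 : 0 <= C) (M_ge0 : 0 <= M).
Hypotheses
  (f_Ck : forall t, Ck n.+2 (B `*` [set: X]) (fun p : E * X => f p.1 t p.2))
  (f_bound : forall (i j : nat) (t : R) (l : E) (v : X),
     (2 <= i <= n.+2)%N -> (j <= i)%N -> B l ->
     `|partialn (i - j) j (fun l' => f l' t) l v| <= C * eps t)
  (y_Ck : forall t, Ck n.+2 B (fun l => y l t))
  (dy_Ck : forall t, Ck n.+2 B (fun l => derive1 (y l) t))
  (dy_bound : forall (i : nat) (t : R) (l : E), (1 <= i <= n.+2)%N -> B l ->
     `|fderivn i (fun l' => derive1 (y l') t) l
       - mlin_comp i (A t) (fderivn i (fun l' => y l' t) l)
       - fderivn i (fun l' => f l' t (y l' t)) l| <= C * eps t)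
  (y_bound : forall (i : nat) (t : R) (l : E), (1 <= i <= n.+2)%N -> B l ->
     `|fderivn i (fun l' => y l' t) l| <= M).

(** The approximation hypothesis bounds the residual itself and [dy_bound] its derivatives, after
    splitting [fderivn] over the three summands. *)
Let r_cls : cls B w false n.+2 r.
Proof.
apply: (@cls_weight _ _ _ _ _ eps); first by move=> t; rewrite lerDr.
split.
  by exists 1 => // t l Bl; rewrite mul1r; apply: y_approx; exact: BSigma.
have yd t := Ck_diffn (y_Ck t).
have dyd t := Ck_diffn (dy_Ck t).
have fd t := diffn_graph oB (f_Ck t) (y_Ck t).
have rE t j : (j <= n.+2)%N -> diffn j B (r t) /\ forall p, B p -> fderivn j (r t) p =
    fderivn j (fun l' => derive1 (y l') t) p
    - mlin_comp j (A t) (fderivn j (fun l' => y l' t) p)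
    - fderivn j (fun l' => f l' t (y l' t)) p.
  move=> jn; have [h1 e1] := fderivn_postcomp (A t) oB (diffn_le jn (@yd t)).
  have [h2 e2] := fderivnB oB (diffn_le jn (@dyd t)) h1.
  have [h3 e3] := fderivnB oB h2 (diffn_le jn (@fd t)).
  by split=> // p Bp; rewrite [LHS]e3// e2// e1.
apply: (@dcls_of_bounds _ _ _ _ _ _ _ _ C oB C_ge0) => [t|j t p /andP[j1 jn] Bp].
  exact: (proj1 (rE t n.+2 (leqnn _))).
by rewrite (proj2 (rE t j jn))//; apply: dy_bound => //; rewrite j1.
Qed.

Let F_cls : cls (B `*` ball (0 : X) (rho + 1)) w true n.+1 F.
Proof.
have rho'_gt0 : 0 < rho + 1 by rewrite ltr_wpDl.
have f_lip t l u v (Bl : B l) := lipf t u v (BSigma Bl).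
have h := perturbation_cls oB cB c_ge0 eps_ge0 C_ge0 M_ge0 rho'_gt0 f_lip
  (fun t => Ck_diffn (f_Ck t)) f_bound (fun t => Ck_diffn (y_Ck t)) y_bound r_cls.
have oS : open (B `*` ball (0 : X) (rho + 1)).
  by apply: open_setX oB _; exact: ball_open.
apply: (cls_ext oS _ h) => t p _; rewrite /F /r /=; zmodl.
Qed.

Lemma shadow_Ck t : Ck n.+1 B (fun l => x l t).
Proof.
(* The induction starts with values in X, where the identity is the only test map. *)
have Thn : norming [set blin_id X].
  move=> v K K0 /(_ _ erefl) /=; move=> h; apply: le_trans h _.
  by rewrite ler_piMr// blin_id_le.
have Ths : solvable (bounded_solution A c eps) w [set blin_id X].
  move=> g K cg K0 gK.
  have [u gu] := bounded_solution_ex contA TA contP contc c_ge0 conteps eps_ge0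
    c_int eps_int (cg _ erefl) K0 gK.
  by exists u => _ ->.
have q_ge0 : 0 <= q.
  rewrite -lee_fin; apply: le_trans (c_int 0).
  by apply: integral_ge0 => s _; rewrite lee_fin mulr_ge0.
have L_ge0 : 0 <= L.
  rewrite -lee_fin; apply: le_trans (eps_int 0).
  by apply: integral_ge0 => s _; rewrite lee_fin mulr_ge0.
have c_le_w s : c s <= w s by rewrite lerDl.
have w_ge0 s : 0 <= w s by rewrite addr_ge0.
have z_le l s : B l -> `|z l s| <= rho by move=> Bl; apply: x_near_y; exact: BSigma.
have zs l : B l -> SolY (bounded_solution A c eps) [set blin_id X]
    (fun t => F t (l, z l t)) (z l).
  by move=> Bl _ ->; exact: (z_sol (BSigma Bl)).
have Fl s l u v : B l -> `|u| < rho + 1 -> `|v| < rho + 1 ->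
    `|F s (l, u) - F s (l, v)| <= c s * `|u - v|.
  by move=> Bl _ _; apply: F_lip; exact: BSigma.
have Fcont l u r' : B l -> r' < rho + 1 -> scont [set blin_id X] u ->
    (forall t, `|u t| <= r') -> scont [set blin_id X] (fun t => F t (l, u t)).
  by move=> Bl _ /(_ _ erefl) cu _ _ ->; exact: (F_cont (BSigma Bl) cu).
have rho_lt : rho < rho + 1 by rewrite ltrDl.
have := @smooth_solution R X (bounded_solution A c eps) c w q (q + L)
  (@bounded_solution_lin R X A c eps)
  (bounded_solution_bound contA TA contP no_bounded contc c_ge0 conteps eps_ge0 c_int eps_int)
  (@bounded_solution_cont R X A c eps) q_ge0 q_lt1 (addr_ge0 q_ge0 L_ge0) c_ge0 c_le_w contw
  E B oB cB n.+1 X [set blin_id X] F z rho (rho + 1) Thn Ths rho_ge0 rho_lt z_le zs Fl Fcont F_cls.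
move=> [_ zcls].
have one_ge0 (s : R) : 0 <= one s :> R by rewrite /one.
have zC := dcls_Ck t oB one_ge0 zcls.
rewrite (_ : (fun l => x l t) = (fun l => z l t + y l t)).
  exact: (CkD oB zC (Ck_le (leqnSn _) (y_Ck t))).
by apply/funext => l; rewrite /z subrK.
Qed.

End SmoothShadow.

End Shadowing.

Theorem theorem2 (R : realType) (X E : completeNormedModType R)
  (Sigma : set E) (openSigma : open Sigma)
  (A : R -> blin X X) (contA : continuous A)
  (T : R -> R -> blin X X) (TA : evolution_family A T)
  (P : R -> blin X X) (contP : continuous P)
  (f : E -> R -> X -> X)
  (contf : forall l, Sigma l -> continuous (fun p : R * X => f l p.1 p.2))
  (c : R -> R) (contc : continuous c) (c_ge0 : forall t, 0 <= c t)
  (lipf : forall t l x y, Sigma l -> `|f l t x - f l t y| <= c t * `|x - y|)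
  (no_bounded : forall x : R -> X, is_solution A x ->
     (exists M : R, forall t, `|x t| <= M) -> forall t, x t = 0)
  (q_lt1 : (green_sup T P c < 1)%E)
  (eps : R -> R) (conteps : continuous eps) (eps_gt0 : forall t, 0 < eps t)
  (L_fin : (green_sup T P eps < +oo)%E)
  (y : E -> R -> X)
  (y_C1 : forall l, Sigma l ->
     (forall t, derivable (y l) t 1) /\ continuous (derive1 (y l)))
  (y_approx : forall l t, Sigma l ->
     `|derive1 (y l) t - A t (y l t) - f l t (y l t)| <= eps t)
  (x : E -> R -> X)
  (x_sol : forall l, Sigma l -> is_solution (fun t v => A t v + f l t v) (x l))
  (x_near_y : forall l t, Sigma l ->
     `|x l t - y l t| <= fine (green_sup T P eps) / (1 - fine (green_sup T P c)))
  (k : nat) (C : R) (C_gt0 : 0 < C)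
  (f_Ck : forall t,
     Ck k.+1 (Sigma `*` [set: X]) (fun p : E * X => f p.1 t p.2))
  (f_bound : forall (i j : nat) (t : R) (l : E) (v : X),
     (2 <= i <= k.+1)%N -> (j <= i)%N -> Sigma l ->
     `|partialn (i - j) j (fun l' => f l' t) l v| <= C * eps t)
  (y_Ck : forall t, Ck k.+1 Sigma (fun l => y l t))
  (dy_Ck : forall t, Ck k.+1 Sigma (fun l => derive1 (y l) t))
  (dy_bound : forall (i : nat) (t : R) (l : E), (1 <= i <= k.+1)%N -> Sigma l ->
     `|fderivn i (fun l' => derive1 (y l') t) l
       - mlin_comp i (A t) (fderivn i (fun l' => y l' t) l)
       - fderivn i (fun l' => f l' t (y l' t)) l| <= C * eps t)
  (y_bound : forall l0, Sigma l0 -> exists M : R, 1 < M /\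
     \forall l \near l0, forall (i : nat) (t : R), (1 <= i <= k.+1)%N ->
       `|fderivn i (fun l' => y l' t) l| <= M) :
  forall t, Ck k Sigma (fun l => x l t).
Proof.
move=> t.
have eps_ge0 s : 0 <= eps s by exact: ltW.
have qf : green_sup T P c \is a fin_num.
  by apply: green_sup_fin => //; apply: lt_trans q_lt1 _; exact: ltry.
have Lf := green_sup_fin eps_ge0 L_fin.
set q := fine (green_sup T P c) in x_near_y.
set L := fine (green_sup T P eps) in x_near_y.
have q1 : q < 1 by rewrite -lte_fin fineK.
have rho_ge0 : 0 <= L / (1 - q).
  by apply: divr_ge0; [apply/fine_ge0/green_sup_ge0|rewrite subr_ge0 ltW].
have c_int s : (\int[lebesgue_measure]_r (c r * `|green T P s r|)%:E <= q%:E)%E.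
  by rewrite fineK//; exact: green_int_le_sup.
have eps_int s : (\int[lebesgue_measure]_r (eps r * `|green T P s r|)%:E <= L%:E)%E.
  by rewrite fineK//; exact: green_int_le_sup.
(* For k = 0 there are no second derivatives to make F uniformly Lipschitz in the parameter, so
   [smooth_solution] is reserved for k = n + 1. *)
case: k f_Ck f_bound y_Ck dy_Ck dy_bound y_bound => [|n] fC fB yC dyC dyB yB.
  have oSX : open (Sigma `*` [set: X]) by apply: open_setX openSigma _; exact: openT.
  have C1_cont (U V : normedModType R) (S : set U) (g : U -> V) p :
    Ck 1 S g -> S p -> {for p, continuous g}.
    by move=> /(Ck_le (leq0n 1))[_ gc]; exact: gc.
  split=> // l Sl.
  apply: (shadow_continuous openSigma contA TA contP no_bounded contc c_ge0 conteps
    eps_ge0 q1 rho_ge0 c_int eps_int contf lipf y_C1 y_approx x_sol x_near_y) => //.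
  - by move=> s p Sp; apply: C1_cont (fC s) _.
  - by move=> s l' Sl'; apply: C1_cont (yC s) _.
  - by move=> s l' Sl'; apply: C1_cont (dyC s) _.
(* [Ck] on a set is a condition at each of its points, so a ball around each parameter suffices,
   taken inside the neighbourhood where the derivatives of y are bounded by [M]. *)
suff loc l : Sigma l -> exists2 B : set E, B l & Ck n.+1 B (fun l => x l t).
  by split=> [i l il|l] /loc[B Bl [dB cB]]; [exact: dB|exact: cB].
move=> Sl; have [M [M1 yM]] := yB l Sl.
have nS : \forall m \near l, Sigma m by exact: (open_near openSigma).
have : \forall m \near l, Sigma m /\ forall (i : nat) (s : R), (1 <= i <= n.+2)%N ->
    `|fderivn i (fun l' => y l' s) m| <= M by exact: filterI nS yM.
move=> /nbhs_ballP[r /= r0 rP].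
have BS : ball l r `<=` Sigma by move=> m /rP[].
exists (ball l r); first exact: ballxx.
apply: (shadow_Ck contA TA contP no_bounded contc c_ge0 conteps eps_ge0 q1 rho_ge0
  c_int eps_int contf lipf y_C1 y_approx x_sol x_near_y (ball_open _ _)
  (@ball_cvx _ _ _ _) BS (ltW C_gt0) (ltW (lt_trans ltr01 M1))).
- by move=> s; apply: Ck_sub (fC s) => p [/BS].
- by move=> i j s m v hi hj /BS; exact: fB.
- by move=> s; exact: Ck_sub BS (yC s).
- by move=> s; exact: Ck_sub BS (dyC s).
- by move=> i s m hi /BS; exact: dyB.
- by move=> i s m hi /rP[_ h]; exact: h.
Qed.
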